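(* Let $d\ge2$, let $\kappa$ be a spherically symmetric probability distribution on the unit ball $B\subset\mathbb{R}^d$, let $\xi_1$ be distributed according to $\kappa$, and put $\eta=1-\|\xi_1\|$. Assume that for some $\alpha\ge0$ the cumulative distribution function $F(x)=\mathbf{P}\{\eta\le x\}$ of $\eta$ satisfies $$\lim_{s\downarrow0}s^{-\alpha}F(s)=a\in(0,\infty).$$ Then for every $t\ge0$ $$\lim_{n\to\infty}\mathbf{P}\left\{n^{2/\gamma}\big(2-\operatorname{diam}(\Pi_{n\kappa})\big)\le t\right\}=1-e^{-\frac12 t^\gamma\sigma_0},$$ where $\gamma=\frac12(d-1)+2\alpha$ and $$\sigma_0=a^2c\cdot\begin{cases}1, & F(0)>0,\\[1mm] \alpha^2\,\Gamma(\alpha)^2\,\dfrac{\Gamma(\frac12(d+1))}{\Gamma(2\alpha+\frac12(d+1))}, & F(0)=0,\end{cases}\qquad c=\frac{2^{d-1}\,\Gamma(\frac d2)}{(d-1)\,\pi^{1/2}\,\Gamma(\frac{d-1}{2})}.$$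
   Context: $B=\{x\in\mathbb{R}^d:\|x\|\le1\}$. $\Pi_{n\kappa}$ is the Poisson process on $B$ with intensity measure $n\kappa$. $\operatorname{diam}(F)=\sup_{x,y\in F}\|x-y\|$ (the value assigned to the empty set is immaterial for the limit). A distribution is spherically symmetric if it is invariant under all rotations about the origin. $\Gamma$ is the Gamma function. *)

(* Defs.v *)
From HB Require Import structures.
From mathcomp Require Import all_boot all_order all_algebra.
From mathcomp Require Import all_classical all_reals all_analysis.
From mathcomp Require Import measurable_realfun.

Set Implicit Arguments.
Unset Strict Implicit.
Unset Printing Implicit Defensive.

Import Order.TTheory GRing.Theory Num.Theory.
Import numFieldNormedType.Exports.

Local Open Scope classical_set_scope.
Local Open Scope ring_scope.

(* R^d with its Borel sigma-algebra. *)
Notation borel_space R d := (g_sigma_algebraType (@open 'rV[R]_d)).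

(* The library's norm on ['rV[R]_d] is the sup norm. *)
Definition enorm (R : realType) (d : nat) (x : 'rV[R]_d) : R :=
  Num.sqrt (\sum_(i < d) x ord0 i ^+ 2).

Definition unit_ball (R : realType) (d : nat) : set (borel_space R d) :=
  [set x | enorm x <= 1].

(* [sup set0 = 0], so the empty set has diameter 0. *)
Definition diam (R : realType) (d : nat) (F : set 'rV[R]_d) : R :=
  sup [set r | exists x y, [/\ F x, F y & r = enorm (x - y)]].

Definition rotation (R : realType) (d : nat) (U : 'M[R]_d) : Prop :=
  U *m U^T = 1%:M /\ \det U = 1.

Definition spherically_symmetric (R : realType) (d : nat)
    (kappa : probability (borel_space R d) R) : Prop :=
  forall U : 'M[R]_d, rotation U ->
  forall A : set (borel_space R d), measurable A ->
    kappa [set x | A ((x : 'rV[R]_d) *m U)] = kappa A.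

(* Taking some of the [C i] to be [setT] gives the product rule for every
   subfamily. *)
Definition mutually_independent (R : realType) (dO dT : measure_display)
    (Omega : measurableType dO) (T : measurableType dT) (P : probability Omega R)
    (m : nat) (X : 'I_m -> Omega -> T) : Prop :=
  forall C : 'I_m -> set T, (forall i, measurable (C i)) ->
    P [set w | forall i, C i (X i w)] =
    (\big[*%E/1]_(i < m) P [set w | C i (X i w)])%E.

(* A Poisson process on [E] with finite intensity measure [mu], as a random
   counting measure: a kernel [N] from [Omega] to [T] is a measurable map from
   [Omega] to the measures on [T], [N w A] being the number of points in [A].
   The second argument of [poisson_prob] is a dummy; [poisson_prob 0 _] is the
   Dirac mass at 0. *)
Record poisson_process (R : realType) (dO dT : measure_display)
    (Omega : measurableType dO) (T : measurableType dT)
    (P : probability Omega R) (E : set T) (mu : {finite_measure set T -> \bar R})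
    (N : R.-ker Omega ~> T) : Prop := PoissonProcess {
  poisson_process_counting : forall w (A : set T), measurable A ->
    exists k : nat, N w A = k%:R%:E ;
  poisson_process_on : forall w, N w (~` E) = 0%E ;
  poisson_process_law : forall A : set T, measurable A -> forall k : nat,
    P [set w | N w A = k%:R%:E] = poisson_prob (fine (mu A)) 0%N [set k] ;
  poisson_process_indep : forall (m : nat) (A : 'I_m -> set T),
    (forall i, measurable (A i)) -> trivIset setT A ->
    mutually_independent P (fun i w => N w (A i)) }.

(* The points of a finite counting measure (without multiplicities) are its
   atoms. *)
Definition points (R : realType) (d : nat)
    (nu : {measure set (borel_space R d) -> \bar R}) : set 'rV[R]_d :=
  [set x | (0 < nu [set x])%E].

(* Euler's integral; only used at [s > 0]. *)
Definition Gamma (R : realType) (s : R) : R :=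
  \int[@lebesgue_measure R]_(x in `]0, +oo[) (x `^ (s - 1) * expR (- x)).

Definition gamma_exp (R : realType) (d : nat) (alpha : R) : R :=
  (d%:R - 1) / 2 + 2 * alpha.

Definition const_c (R : realType) (d : nat) : R :=
  2 ^+ (d - 1) * Gamma (d%:R / 2) /
  ((d%:R - 1) * Num.sqrt pi * Gamma ((d%:R - 1) / 2)).

Definition sigma0 (R : realType) (d : nat) (alpha a F0 : R) : R :=
  a ^+ 2 * const_c R d *
  (if 0 < F0 then 1 else
     alpha ^+ 2 * Gamma alpha ^+ 2 *
     (Gamma ((d%:R + 1) / 2) / Gamma (2 * alpha + (d%:R + 1) / 2))).

(* Main.v *)
Require Import Defs.
From HB Require Import structures.
From mathcomp Require Import all_boot all_order all_algebra.
From mathcomp Require Import all_classical all_reals all_analysis.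
From mathcomp Require Import measurable_realfun.
From mathcomp Require Import ring lra.
Import Order.TTheory GRing.Theory Num.Theory.
Import numFieldNormedType.Exports.
Set Implicit Arguments.
Unset Strict Implicit.
Unset Printing Implicit Defensive.
Local Open Scope classical_set_scope.
Local Open Scope ring_scope.

(** Two points of the ball are at distance almost 2 only if they are almost
    antipodal and both close to the sphere, so a given point has few far
    partners and the number of pairs of points at distance at least
    [2 - e] is close to a Poisson variable of mean half of
    [n ^+ 2 * far_pairs (2 - e)], where [far_pairs s] is the probability that
    two independent points of law [kappa] are at distance at least [s]. The
    diameter is smaller than [2 - e] when there is no such pair, whence the
    limit law, once [e ^ (- gamma) * far_pairs (2 - e)] is known to converge to
    [sigma0] and the number of far partners of a point to be negligible.

    Poisson approximation. Cut the ball into small cells and join two cells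
    when they contain points at distance at least [s]. The occupied cells form
    a random set in which the cells are independent, and the event that this
    set spans no edge is treated by adding the cells one at a time, from the
    void probabilities of the process ([edgeless_bounds]). Refining the cells yields [diam_upper] and [diam_lower].

    Far pairs. With the overlap [V = <x, y>^2 |x|^2 |y|^2] one has
    [1 - V = (4 - |x - y|^2) + O((4 - |x - y|^2)^2)] when [<x, y> < 0]: this
    product of three factors linearises [|x - y|^2] near 4 ([far_overlap],
    [overlap_far]), and by symmetry half of the mass of [1 - h <= V] has
    [<x, y> < 0] ([opposite_half]). The interest of [V] is that its moments
    are explicit: rotation invariance gives
    [E V^j = (E |x|^(4j))^2 * prod_(i < j) (2i + 1) / (2i + d)]
    ([overlap_moment]). The product is a quotient of values of [Gamma], of order
    [j^(- (d - 1) / 2)] ([wallis_lim]); the moments of [|x|] follow from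
    the hypothesis on [F] by an Abelian theorem ([abelian]); and Karamata's
    Tauberian theorem ([karamata]) turns the asymptotics of the moments of [V]
    into those of [P (1 - h <= V)], hence of the far pairs
    ([far_pairs_lim]).

    Few partners. Markov's inequality for [V^j] with [j] of order [1 / e]
    bounds the mass of the points at distance at least [2 - e] from a given
    one by [e ^ ((d - 1) / 2 + alpha)] up to a constant ([far_bound]); at the
    scale [e = n ^ (- 2 / gamma)] this is negligible against [1 / n] because
    [2 * ((d - 1) / 2 + alpha) > gamma]. *)

(** * Integrals over the positive half-line *)

Section calculus.
Context {R : realType}.
Local Notation mu := (@lebesgue_measure R).

Lemma within_cy_gt0 (f : R -> R) (a : R) : 0 < a ->
  (forall x : R, 0 < x -> {for x, continuous f}) -> {within `[a, +oo[, continuous f}.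
Proof.
move=> a0 cf; apply: continuous_in_subspaceT => x; rewrite inE/= in_itv/= andbT => ax.
by apply: cf; exact: lt_le_trans ax.
Qed.

Lemma measurable_gt0 (f : R -> R) :
  (forall x : R, 0 < x -> {for x, continuous f}) -> measurable_fun (`]0, +oo[%classic : set R) f.
Proof.
move=> cf; apply: open_continuous_measurable_fun; first exact: interval_open.
by move=> x; rewrite inE/= in_itv/= andbT => x0; exact: cf.
Qed.

(** The limits of integration decrease to 0 along a sequence, which reduces
    integrals over the open half-line to the closed half-lines that the
    calculus theorems are stated for. *)
Lemma integral_gt0_lim (f : R -> R) (a : nat -> R) :
  (forall x : R, 0 < x -> 0 <= f x) ->
  (forall x : R, 0 < x -> {for x, continuous f}) ->
  (forall n, 0 < a n) -> (forall m n, (m <= n)%N -> a n <= a m) ->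
  a n @[n --> \oo] --> 0 ->
  (\int[mu]_(x in `[a n, +oo[) (f x)%:E)%E @[n --> \oo] -->
  (\int[mu]_(x in `]0%R, +oo[) (f x)%:E)%E.
Proof.
move=> f0 cf a0 amono acvg.
have -> : `]0%R, +oo[%classic = \bigcup_n `[a n, +oo[%classic.
  apply/seteqP; split => x/=; rewrite ?in_itv/= ?andbT.
    move=> x0; move/cvgrPdist_lt : acvg => /(_ x x0)[N _ /(_ N (leqnn N))]/=.
    rewrite sub0r normrN gtr0_norm// => aNx; exists N => //=.
    by rewrite in_itv/= andbT ltW.
  by move=> [n _]/=; rewrite in_itv/= andbT; exact: lt_le_trans.
apply: ge0_nondecreasing_set_cvg_integral => //.
- move=> m n mn; apply/subsetPset => x/=; rewrite !in_itv/= !andbT.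
  by apply: le_trans; exact: amono.
- move=> n; apply/measurable_EFinP; apply: measurable_funS (measurable_gt0 cf) => //.
  by move=> x/=; rewrite !in_itv/= !andbT; exact: lt_le_trans.
- move=> n x/=; rewrite in_itv/= andbT lee_fin => anx; apply: f0.
  exact: lt_le_trans anx.
Qed.

Lemma invS_gt0 (n : nat) : (0 : R) < n.+1%:R^-1. Proof. by []. Qed.
Lemma invS_mono (m n : nat) : (m <= n)%N -> n.+1%:R^-1 <= m.+1%:R^-1 :> R.
Proof. by move=> mn; rewrite lef_pV2 ?posrE// ler_nat. Qed.

(** The substitution formula on a closed half-line, passed to the limit at
    its left end; [F1] may blow up at 0, as for the square root. *)
Lemma substitution_gt0 (F F1 G : R -> R) :
  (forall x y : R, 0 < x -> x < y -> F x < F y) ->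
  (forall x : R, 0 < x -> 0 < F x) ->
  (forall x : R, 0 < x -> is_derive x 1 F (F1 x)) ->
  (forall x : R, 0 < x -> 0 <= F1 x) ->
  (forall x : R, 0 < x -> {for x, continuous F1}) ->
  cvg (F1 x @[x --> +oo]) ->
  F x @[x --> +oo] --> +oo -> F x @[x --> 0^'+] --> 0 ->
  (forall x : R, 0 < x -> {for x, continuous G}) ->
  (forall x : R, 0 < x -> 0 <= G x) ->
  (\int[mu]_(x in `]0%R, +oo[) (G x)%:E =
   \int[mu]_(x in `]0%R, +oo[) (G (F x) * F1 x)%:E)%E.
Proof.
move=> incF F0 dF F1_ge0 cF1 cvgF1 Foo F00 cG G0.
have F1E x : 0 < x -> F^`()%classic x = F1 x.
  by move=> x0; rewrite derive1E; have [_ ->] := dF x x0.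
have cF x : 0 < x -> {for x, continuous F}.
  by move=> x0; apply/differentiable_continuous/derivable1_diffP; have [] := dF x x0.
have c0 : (n.+1%:R : R)^-1 @[n --> \oo] --> (0:R).
  exact: cvg_harmonic.
have cFn : F n.+1%:R^-1 @[n --> \oo] --> (0:R).
  apply: (cvg_comp _ F _ F00).
  move=> A [e e0 Ae]; have [N _ NP] := (cvgrPdist_lt _ _).1 c0 e e0.
  by exists N => // n /NP nP; apply: Ae => //=.
have Fmono m n : (m <= n)%N -> F n.+1%:R^-1 <= F m.+1%:R^-1.
  move=> mn; have [->//|ne] := eqVneq (n.+1%:R^-1 : R) m.+1%:R^-1.
  by rewrite ltW// incF// lt_neqAle ne invS_mono.
have H1 := integral_gt0_lim G0 cG (fun n => F0 _ (invS_gt0 n)) Fmono cFn.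
have H2 := @integral_gt0_lim (fun x => G (F x) * F1 x) (fun n => n.+1%:R^-1) _ _ invS_gt0 invS_mono c0.
apply: (cvg_unique _ H1) => //.
rewrite (_ : (fun n => _) = (fun n =>
   (\int[mu]_(x in `[(n.+1%:R^-1)%R, +oo[) (G (F x) * F1 x)%:E)%E)).
  apply: H2 => x x0; first by rewrite mulr_ge0// ?G0 ?F0 ?F1_ge0.
  apply: cvgM; last exact: cF1.
  by apply: continuous_comp; [exact: cF|apply: cG; exact: F0].
apply/funext => n; rewrite increasing_ge0_integration_by_substitutiony.
- apply: eq_integral => x; rewrite inE/= in_itv/= andbT => nx.
  by rewrite fctE F1E//; apply: lt_le_trans nx.
- move=> x y; rewrite !in_itv/= !andbT => nx _; apply: incF.
  exact: lt_le_trans nx.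
- move=> x; rewrite in_itv/= andbT => nx.
  have x0 : 0 < x by exact: lt_trans nx.
  rewrite /continuous_at F1E//; apply: cvg_trans (cF1 x x0).
  apply: near_eq_cvg; near=> y; rewrite F1E//; near: y; exact: lt_nbhsr.
- apply/cvg_ex; exists (F1 n.+1%:R^-1).
  apply: cvg_trans (cvg_at_right_filter (cF1 _ (invS_gt0 n))).
  apply: near_eq_cvg; near=> y; rewrite F1E//.
  by apply: lt_trans (invS_gt0 n) _; near: y; exact: nbhs_right_gt.
- move: cvgF1 => /cvg_ex[l F1l]; apply/cvg_ex; exists l.
  apply: cvg_trans F1l; apply: near_eq_cvg; exists 0; split=> // y y0.
  by rewrite F1E.
- split.
    move=> x; rewrite in_itv/= andbT => nx.
    have x0 : 0 < x by exact: lt_trans nx.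
    by have [] := dF x x0.
  exact/cvg_at_right_filter/cF.
- by [].
- by apply: within_cy_gt0 => //; exact: F0.
- move=> x; rewrite in_itv/= andbT => Fx; apply: G0; apply: lt_trans Fx; exact: F0.
Unshelve. all: by end_near. Qed.
End calculus.

Section gamma.
Context {R : realType}.
Local Notation mu := (@lebesgue_measure R).

Lemma is_derive_continuous (f : R -> R) (x v : R) : is_derive x 1 f v -> {for x, continuous f}.
Proof. by case=> df _; apply/differentiable_continuous/derivable1_diffP. Qed.

(** The integrand may be singular at 0, where only the primitive has to
    converge. *)
Lemma FTC_gt0c (f F : R -> R) (b m : R) : 0 < b ->
  (forall x : R, 0 < x -> x <= b -> 0 <= f x) ->
  (forall x : R, 0 < x -> {for x, continuous f}) ->
  (forall x : R, 0 < x -> is_derive x 1 F (f x)) ->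
  F x @[x --> 0^'+] --> m ->
  (\int[mu]_(x in `]0%R, b]) (f x)%:E = (F b - m)%:E)%E.
Proof.
move=> b0 f0 cf dF Fm.
have c0 : b / 2 * (n.+1%:R : R)^-1 @[n --> \oo] --> (0:R).
  by rewrite -[X in _ --> X](mulr0 (b / 2)); apply: cvgMr; exact: cvg_harmonic.
have b20 : 0 < b / 2 by rewrite divr_gt0.
have an0 n : 0 < b / 2 / n.+1%:R by rewrite divr_gt0.
have anb n : b / 2 / n.+1%:R < b.
  rewrite ltr_pdivrMr// (@lt_le_trans _ _ b)//; first by rewrite ltr_pdivrMr// ltr_pMr// ltr1n.
  by rewrite ler_pMr// ler1n.
have H : (\int[mu]_(x in `[(b / 2 / n.+1%:R)%R, b]) (f x)%:E)%E @[n --> \oo] -->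
  (\int[mu]_(x in `]0%R, b]) (f x)%:E)%E.
  have -> : `]0%R, b]%classic = \bigcup_n `[b / 2 / n.+1%:R, b]%classic.
    apply/seteqP; split => x/=; rewrite ?in_itv/=.
      move=> /andP[x0 xb]; move/cvgrPdist_lt : c0 => /(_ x x0)[N _ /(_ N (leqnn N))]/=.
      rewrite sub0r normrN gtr0_norm// => aNx; exists N => //=.
      by rewrite in_itv/= xb ltW.
    move=> [n _]/=; rewrite in_itv/= => /andP[+ ->]; rewrite andbT.
    exact: lt_le_trans.
  apply: ge0_nondecreasing_set_cvg_integral => //.
  - move=> i j ij; apply/subsetPset => x/=; rewrite !in_itv/= => /andP[+ ->].
    by rewrite andbT; apply: le_trans; rewrite ler_pM2l// invS_mono.
  - move=> n; apply/measurable_EFinP; apply: measurable_funS (measurable_gt0 cf) => //.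
    by move=> x/=; rewrite !in_itv/= andbT => /andP[+ _]; exact: lt_le_trans.
  - move=> n x/=; rewrite in_itv/= lee_fin => /andP[anx xb]; apply: f0 => //.
    exact: lt_le_trans anx.
have cFn : F (b / 2 / n.+1%:R) @[n --> \oo] --> m.
  apply: (cvg_comp _ F _ Fm).
  move=> A [e e0 Ae]; have [N _ NP] := (cvgrPdist_lt _ _).1 c0 e e0.
  by exists N => // n /NP nP; apply: Ae => //=.
apply: (cvg_unique _ H) => //.
rewrite (_ : (fun n => _) = (fun n => (F b - F (b / 2 / n.+1%:R)%R)%:E)); last first.
  apply/funext => n; rewrite (@continuous_FTC2 _ _ F)//.
  - apply: continuous_in_subspaceT => x; rewrite inE/= in_itv/= => /andP[ax _].
    by apply: cf; exact: lt_le_trans ax.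
  - split.
    + move=> x; rewrite in_itv/= => /andP[ax _].
      have x0 : 0 < x by exact: lt_trans ax.
      by have [] := dF x x0.
    + by apply: cvg_at_right_filter; apply: is_derive_continuous; exact: dF.
    + by apply: cvg_at_left_filter; apply: is_derive_continuous; exact: dF.
  - move=> x; rewrite in_itv/= => /andP[nx _]; rewrite derive1E.
    have x0 : 0 < x by exact: lt_trans nx.
    by have [_ ->] := dF x x0.
apply: cvg_EFin; first by near=> n.
by apply: cvgB => //; exact: cvg_cst.
Unshelve. all: by end_near. Qed.

Lemma continuous_powR (p x : R) : 0 < x -> {for x, continuous (fun y : R => y `^ p)}.
Proof. by move=> x0; exact: (is_derive_continuous (is_derive1_powR p x0)). Qed.

Lemma integral_powR0 (s b : R) : 0 < s -> 0 < b ->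
  (\int[mu]_(x in `]0%R, b]) (x `^ (s - 1))%:E = (b `^ s / s)%:E)%E.
Proof.
move=> s0 b0; apply: (etrans (@FTC_gt0c _ (fun x => s^-1 * x `^ s) b 0 _ _ _ _ _)) => //; last first.
- by rewrite subr0 mulrC.
- by rewrite -[X in _ --> X](mulr0 s^-1); apply: cvgMr; exact: powR_cvg0.
- move=> x x0; apply: is_derive_eq.
    exact: (is_deriveM (is_derive_cst _ _ _) (is_derive1_powR s x0)).
  by rewrite /= scaler0 addr0 /GRing.scale/= mulrA mulVf ?mul1r ?gt_eqF.
- by move=> x x0; exact: continuous_powR.
- by move=> *; exact: powR_ge0.
Qed.

(** The exponential series dominates every power. *)
Lemma cvg_powR_expR (s : R) : x `^ s * expR (- x) @[x --> +oo] --> (0 : R).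
Proof.
have [N sN] : exists N : nat, s <= N%:R.
  by exists (Num.bound s); exact/ltW/unstable.ltr_bound.
apply: (@squeeze_cvgr _ _ _ _ (fun=> 0) (fun x : R => (N.+1)`!%:R / x)).
- near=> x; have x1 : 1 <= x by near: x; exact: nbhs_pinfty_ge.
  have x0 : 0 < x by rewrite (lt_le_trans _ x1).
  rewrite mulr_ge0 ?powR_ge0 ?expR_ge0//= expRN ler_pdivrMr ?expR_gt0//.
  apply: (@le_trans _ _ (x ^+ N)); first by rewrite -(powR_mulrn N (ltW x0)) ler_powR.
  rewrite mulrAC ler_pdivlMr// -exprSr.
  have := expR_ge1Dxn N (ltW x0); rewrite -ler_pdivrMl ?ltr0n ?fact_gt0//.
  by apply: le_trans; rewrite mulrC lerDr.
- exact: cvg_cst.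
- rewrite -[X in _ --> X](mulr0 (N.+1)`!%:R); apply: cvgMr.
  apply/gtr0_cvgV0; last exact: cvg_id.
  by exists 0; split.
Unshelve. all: by end_near. Qed.

End gamma.

(** * Euler's integral *)

Section gamma.
Context {R : realType}.
Local Notation mu := (@lebesgue_measure R).
Implicit Types s x : R.

Lemma continuous_gamma (p l x : R) : 0 < x ->
  {for x, continuous (fun y : R => y `^ p * expR (- (l * y)))}.
Proof.
move=> x0; apply: cvgM; first exact: continuous_powR.
apply: continuous_comp; last exact: continuous_expR.
by apply: continuousN; exact: mulrl_continuous.
Qed.

Lemma continuous_gamma1 (p x : R) : 0 < x ->
  {for x, continuous (fun y : R => y `^ p * expR (- y))}.
Proof.
move=> x0; have := @continuous_gamma p 1 x x0.
by under [X in {for _, continuous X}]eq_fun do rewrite mul1r.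
Qed.

Lemma measurable_gamma (p l : R) (D : set R) : D `<=` `]0, +oo[ -> measurable D ->
  measurable_fun D (fun y : R => (y `^ p * expR (- (l * y)))%:E).
Proof.
move=> D0 mD; apply/measurable_EFinP; apply: measurable_funS D0 _ => //.
by apply: measurable_gt0 => x x0; exact: continuous_gamma.
Qed.

Lemma measurable_gamma1 (p : R) (D : set R) : D `<=` `]0, +oo[ -> measurable D ->
  measurable_fun D (fun y : R => (y `^ p * expR (- y))%:E).
Proof.
move=> D0 mD; have := @measurable_gamma p 1 _ D0 mD.
by under [X in measurable_fun _ X]eq_fun do rewrite mul1r.
Qed.

Lemma measurable_powR_gt0 (p : R) (D : set R) : D `<=` `]0, +oo[ -> measurable D ->
  measurable_fun D (fun y : R => (y `^ p)%:E).
Proof.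
move=> D0 mD; apply/measurable_EFinP; apply: measurable_funS D0 _ => //.
by apply: measurable_gt0 => x x0; exact: continuous_powR.
Qed.

Lemma gamma_ge01 (p x : R) : (0 <= (x `^ p * expR (- x))%:E)%E.
Proof. by rewrite lee_fin mulr_ge0 ?powR_ge0 ?expR_ge0. Qed.

Lemma gt0_split (b : R) : 0 < b -> `]0%R, +oo[%classic = `]0, b] `|` `]b, +oo[ :> set R.
Proof.
move=> b0; apply/seteqP; split => x/=; rewrite !in_itv/= ?andbT.
  by move=> x0; rewrite x0/=; case: (leP x b) => xb; [left|right].
by case=> [/andP[]//|]; exact: lt_trans.
Qed.

Lemma integral_gt0_split (f : R -> \bar R) (b : R) : 0 < b ->
  measurable_fun (`]0, +oo[%classic : set R) f -> (forall x, 0 < x -> (0 <= f x)%E) ->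
  (\int[mu]_(x in `]0%R, +oo[) f x =
   \int[mu]_(x in `]0%R, b]) f x + \int[mu]_(x in `]b, +oo[) f x)%E.
Proof.
move=> b0 mf f0; rewrite (gt0_split b0) ge0_integral_setU//.
- by rewrite -(gt0_split b0).
- by rewrite -(gt0_split b0) => x; rewrite /= in_itv/= andbT; exact: f0.
- apply/disj_setPS => x /=; rewrite !in_itv/= andbT => -[/andP[_ xb] /(le_lt_trans xb)].
  by rewrite ltxx.
Qed.

Lemma derive_powR_expR s x : 0 < x ->
  is_derive x 1 (fun y : R => y `^ s * expR (- y))
    (s * (x `^ (s - 1) * expR (- x)) - x `^ s * expR (- x)).
Proof.
move=> x0; have d1 := is_derive1_powR s x0.
have d2 : is_derive x 1 (fun y : R => expR (- y)) (- expR (- x)).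
  by apply: is_derive_eq; rewrite /GRing.scale/= mulrN1.
apply: (is_derive_eq (is_deriveM d1 d2)).
by rewrite /GRing.scale/=; ring.
Qed.

Lemma cvg_powR_expR0 s : 0 < s -> x `^ s * expR (- x) @[x --> 0^'+] --> (0 : R).
Proof.
move=> s0; rewrite -[X in _ --> X](mul0r (expR (- (0:R)))); apply: cvgM.
  exact: powR_cvg0.
apply: cvg_at_right_filter; apply: continuous_comp; last exact: continuous_expR.
exact: continuousN.
Qed.

Let G s := (\int[mu]_(x in `]0%R, +oo[) (x `^ (s - 1) * expR (- x))%:E)%E.

(** Integration by parts with nonnegative integrands only: the derivative
    of [x ^ s * exp (- x)] has a constant sign on each side of [x = s], so the
    half-line is cut at [s]. *)
Let GS s : 0 < s -> (s%:E * G s = G (s + 1))%E.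
Proof.
move=> s0; rewrite /G addrK.
have sub1 b : (`]0, b]%classic : set R) `<=` `]0, +oo[%classic.
  by move=> x/=; rewrite !in_itv/= andbT => /andP[].
have sub2 b : 0 < b -> (`]b, +oo[%classic : set R) `<=` `]0, +oo[%classic.
  by move=> b0 x/=; rewrite !in_itv/= !andbT; exact: lt_trans.
pose u x := x `^ s * expR (- x).
have mg D := @measurable_gamma1 (s - 1) D.
have mgS D := @measurable_gamma1 s D.
rewrite -ge0_integralZl//; last 3 first.
  by apply: mg.
  by move=> x _; exact: gamma_ge01.
  by rewrite lee_fin ltW.
rewrite (integral_gt0_split s0)/=; last 2 first.
  by apply: mgS.
  by move=> x _; rewrite gamma_ge01.
rewrite (integral_gt0_split s0)/=; last 2 first.
  by apply: measurable_funeM; apply: mg.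
  by move=> x _; rewrite mule_ge0 ?gamma_ge01// lee_fin ltW.
have cu x : 0 < x -> {for x, continuous
    (fun x => s * (x `^ (s - 1) * expR (- x)) - x `^ s * expR (- x))}.
  move=> x0; apply: cvgB; last exact: continuous_gamma1.
  by apply: cvgMr; exact: continuous_gamma1.
have ux x : 0 < x -> s * (x `^ (s - 1) * expR (- x)) - x `^ s * expR (- x) =
    x `^ (s - 1) * expR (- x) * (s - x).
  by move=> x0; rewrite -(mulr_powRB1 (ltW x0) s0); ring.
have I1 : (\int[mu]_(x in `]0%R, s]) (s%:E * (x `^ (s - 1) * expR (- x))%:E) =
   \int[mu]_(x in `]0%R, s]) (x `^ s * expR (- x))%:E + (u s)%:E)%E.
  have -> : (u s = u s - 0)%R by rewrite subr0.
  have u'0 x : 0 < x -> x <= s ->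
      0 <= s * (x `^ (s - 1) * expR (- x)) - x `^ s * expR (- x).
    by move=> x0 xs; rewrite ux// mulr_ge0 ?mulr_ge0 ?powR_ge0 ?expR_ge0 ?subr_ge0.
  have du x : 0 < x -> is_derive x 1 u
      (s * (x `^ (s - 1) * expR (- x)) - x `^ s * expR (- x)).
    exact: derive_powR_expR.
  rewrite -(FTC_gt0c s0 u'0 cu du (cvg_powR_expR0 s0)).
  rewrite -ge0_integralD//=.
  - by apply: eq_integral => x _; rewrite -EFinD/=; congr EFin; ring.
  - by move=> x _; exact: gamma_ge01.
  - by apply: mgS => //; exact: sub1.
  - move=> x/=; rewrite in_itv/= => /andP[x0 xs].
    by rewrite lee_fin ux// mulr_ge0 ?mulr_ge0 ?powR_ge0 ?expR_ge0 ?subr_ge0.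
  - apply/measurable_EFinP; apply: measurable_funS (measurable_gt0 cu) => //.
have I2 : (\int[mu]_(x in `]s, +oo[) (x `^ s * expR (- x))%:E =
   \int[mu]_(x in `]s, +oo[) (s%:E * (x `^ (s - 1) * expR (- x))%:E) + (u s)%:E)%E.
  have -> : (u s = 0 - (- u s))%R by rewrite opprK add0r.
  have cu' x : 0 < x -> {for x, continuous
    (fun x => - (s * (x `^ (s - 1) * expR (- x)) - x `^ s * expR (- x)))}.
    by move=> x0; apply: continuousN; exact: cu.
  have du' x : 0 < x -> is_derive x 1 (fun x => - u x)
      (- (s * (x `^ (s - 1) * expR (- x)) - x `^ s * expR (- x))).
    by move=> x0; apply: is_deriveN; exact: derive_powR_expR.
  rewrite EFinB -(@ge0_continuous_FTC2y _
    (fun x => - (s * (x `^ (s - 1) * expR (- x)) - x `^ s * expR (- x)))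
    (fun x => - u x) s 0)//; last 6 first.
  - move=> x sx; rewrite ux ?(lt_le_trans s0)// -mulrN opprB.
    by rewrite mulr_ge0 ?mulr_ge0 ?powR_ge0 ?expR_ge0 ?subr_ge0.
  - exact: within_cy_gt0.
  - by rewrite -oppr0; apply: cvgN; exact: cvg_powR_expR.
  - by move=> x sx; have [] := du' x (lt_trans s0 sx).
  - by apply: cvg_at_right_filter; exact: (is_derive_continuous (du' s s0)).
  - move=> x; rewrite in_itv/= andbT => sx; rewrite derive1E.
    by have [_ ->] := du' x (lt_trans s0 sx).
  rewrite -integral_itv_obnd_cbnd; last first.
    apply/measurable_EFinP; apply: measurable_funS (measurable_gt0 cu') => //.
    exact: sub2.
  rewrite -ge0_integralD//=.
  - by apply: eq_integral => x _; rewrite -EFinM -EFinD/=; congr EFin; ring.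
  - by move=> x _; rewrite mule_ge0 ?gamma_ge01// lee_fin ltW.
  - by apply: measurable_funeM; apply: mg => //; exact: sub2.
  - move=> x/=; rewrite in_itv/= andbT => sx.
    rewrite lee_fin ux ?(lt_trans s0)// -mulrN opprB.
    by rewrite mulr_ge0 ?mulr_ge0 ?powR_ge0 ?expR_ge0 ?subr_ge0// ltW.
  - apply/measurable_EFinP; apply: measurable_funS (measurable_gt0 cu') => //.
    exact: sub2.
rewrite [X in (X + _)%E]I1 [X in (_ = _ + X)%E]I2.
by rewrite -addeA [X in (_ + X)%E = _]addeC.
Qed.

Lemma integral_expR_y (a : R) : 0 <= a ->
  (\int[mu]_(x in `[a, +oo[) (expR (- x))%:E = (expR (- a))%:E)%E.
Proof.
move=> a0.
have dE (x : R) : is_derive x 1 (fun y : R => - expR (- y)) (expR (- x)).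
  by apply: is_derive_eq; rewrite /GRing.scale/= mulrN1 opprK.
have cE : continuous (fun y : R => expR (- y)).
  move=> y; apply: continuous_comp; last exact: continuous_expR.
  exact: continuousN.
rewrite (@ge0_continuous_FTC2y _ _ (fun x => - expR (- x)) a 0)//.
- by rewrite -EFinB opprK add0r.
- by apply: continuous_in_subspaceT => x _; exact: cE.
- by rewrite -oppr0; apply: cvgN; exact: cvgr_expR.
- by apply: cvg_at_right_filter; exact: (is_derive_continuous (dE a)).
- by move=> x _; rewrite derive1E; have [_ ->] := dE x.
Qed.

Let G_fin_small s : 0 < s -> s <= 1 -> (G s < +oo)%E.
Proof.
move=> s0 s1; rewrite /G (integral_gt0_split (@ltr01 R)); last 2 first.
- by apply: measurable_gamma1.
- by move=> x _; exact: gamma_ge01.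
have m1 : measurable_fun (`]0, 1]%classic : set R) (fun x : R => (x `^ (s - 1))%:E).
  by apply: measurable_powR_gt0 => // x/=; rewrite !in_itv/= andbT => /andP[].
apply: lte_add_pinfty.
  apply: (@le_lt_trans _ _ (\int[mu]_(x in `]0%R, 1%R]) (x `^ (s - 1))%:E)%E).
    apply: ge0_le_integral => //.
    - by move=> x _; exact: gamma_ge01.
    - by apply: measurable_gamma1 => // x/=; rewrite !in_itv/= andbT => /andP[].
    - move=> x/=; rewrite in_itv/= => /andP[x0 x1].
      by rewrite lee_fin ler_piMr ?powR_ge0// expR_le1 oppr_le0 ltW.
  by rewrite integral_powR0// ltry.
apply: (@le_lt_trans _ _ (\int[mu]_(x in `]1%R, +oo[) (expR (- x))%:E)%E).
  have s1y : (`]1, +oo[%classic : set R) `<=` `]0, +oo[%classic.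
    by move=> x/=; rewrite !in_itv/= !andbT; exact: lt_trans.
  apply: ge0_le_integral => //.
  - by move=> x _; exact: gamma_ge01.
  - by apply: measurable_gamma1.
  - have := @measurable_gamma1 0 _ s1y (measurable_itv _).
    by under [X in measurable_fun _ X]eq_fun do rewrite powRr0 mul1r.
  - move=> x/=; rewrite in_itv/= andbT => x1.
    rewrite lee_fin ler_piMl ?expR_ge0//.
    by rewrite -[leRHS](powRr0 x) ler_powR ?subr_le0 ?(ltW x1).
rewrite integral_itv_obnd_cbnd ?integral_expR_y ?ltry//.
have s1y : (`]1, +oo[%classic : set R) `<=` `]0, +oo[%classic.
  by move=> x/=; rewrite !in_itv/= !andbT; exact: lt_trans.
have := @measurable_gamma1 0 _ s1y (measurable_itv _).
by under [X in measurable_fun _ X]eq_fun do rewrite powRr0 mul1r.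
Qed.

Let G_fin s : 0 < s -> (G s < +oo)%E.
Proof.
have H (n : nat) : forall t : R, 0 < t -> t <= n.+1%:R -> (G t < +oo)%E.
  elim: n => [|n IH] t t0 tn; first exact: G_fin_small.
  have [t1|t1] := leP t 1; first exact: G_fin_small.
  have tB : 0 < t - 1 by rewrite subr_gt0.
  rewrite -(subrK 1 t) -GS// lte_mul_pinfty ?lee_fin ?ltW//.
  by apply: IH => //; rewrite lerBlDr natr1.
move=> s0; apply: (H (Num.bound s)) => //.
by rewrite ltW// (lt_le_trans (unstable.ltr_bound s))// ler_nat.
Qed.

(** [Gamma] takes the [fine] of an extended real integral; its finiteness
    for [0 < s <= 1] is by comparison with [x ^ (s - 1)] on [0, 1] and with
    [exp (- x)] beyond, and is propagated by the functional equation. *)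
Lemma GammaE s : 0 < s ->
  (\int[mu]_(x in `]0%R, +oo[) (x `^ (s - 1) * expR (- x))%:E = (Gamma s)%:E)%E.
Proof.
move=> s0; rewrite /Gamma /Rintegral fineK// ge0_fin_numE ?G_fin//.
by apply: integral_ge0 => x _; exact: gamma_ge01.
Qed.

Lemma GammaS s : 0 < s -> Gamma (s + 1) = s * Gamma s.
Proof.
move=> s0; have := GS s0; rewrite /G !GammaE//; last by rewrite addr_gt0.
by rewrite -EFinM => -[].
Qed.

Lemma Gamma_gt0 s : 0 < s -> 0 < Gamma s.
Proof.
move=> s0; rewrite -lte_fin -GammaE// (integral_gt0_split (@ltr01 R)); last 2 first.
- by apply: measurable_gamma1.
- by move=> x _; exact: gamma_ge01.
have sub : (`]0, 1]%classic : set R) `<=` `]0, +oo[%classic.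
  by move=> x/=; rewrite !in_itv/= !andbT => /andP[].
have m1 : measurable_fun (`]0, 1]%classic : set R) (fun x : R => (x `^ (s - 1))%:E).
  by apply: measurable_powR_gt0.
apply: (@lt_le_trans _ _ ((expR (-1))%:E * \int[mu]_(x in `]0%R, 1%R]) (x `^ (s - 1))%:E)%E).
  by rewrite integral_powR0// -EFinM lte_fin powR1 mul1r mulr_gt0 ?expR_gt0// invr_gt0.
rewrite -ge0_integralZl//; last by move=> x _; rewrite lee_fin powR_ge0.
rewrite -[leLHS]adde0 leeD//; last by apply: integral_ge0 => x _; exact: gamma_ge01.
apply: ge0_le_integral => //.
- by move=> x _; rewrite -EFinM lee_fin mulr_ge0 ?powR_ge0 ?expR_ge0.
- exact: measurable_funeM.
- by apply: measurable_gamma1.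
- move=> x/=; rewrite in_itv/= => /andP[x0 x1].
  by rewrite -EFinM lee_fin mulrC ler_wpM2l ?powR_ge0// ler_expR lerN2.
Qed.

Lemma Gamma_scale s (l : R) : 0 < s -> 0 < l ->
  (\int[mu]_(x in `]0%R, +oo[) (x `^ (s - 1) * expR (- (l * x)))%:E =
   (l `^ (- s) * Gamma s)%:E)%E.
Proof.
move=> s0 l0; rewrite EFinM -GammaE//.
have dl (x : R) : is_derive x 1 (fun x : R => l * x) l.
  apply: (is_derive_eq (is_deriveM (is_derive_cst _ _ _) (is_derive_id _ _))).
  by rewrite /GRing.scale/= mulr1 mulr0 addr0.
rewrite (@substitution_gt0 _ (fun x => l * x) (fun=> l) (fun x => x `^ (s - 1) * expR (- x)))//; first last.
- by move=> x x0; rewrite mulr_ge0 ?powR_ge0 ?expR_ge0.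
- by move=> x x0; exact: continuous_gamma1.
- rewrite -[X in _ --> X](mulr0 l); apply: cvgMr.
  by apply: cvg_at_right_filter; exact: cvg_id.
- by apply: gt0_cvgMry => //; exact: cvg_id.
- exact: is_cvg_cst.
- by move=> x x0; exact: cvg_cst.
- by move=> x _; exact: ltW.
- by move=> x x0; rewrite mulr_gt0.
- by move=> x y _ xy; rewrite ltr_pM2l.
rewrite -ge0_integralZl//; last 3 first.
- have := @measurable_gamma (s - 1) l _ (@subset_refl _ _) (measurable_itv `]0, +oo[).
  move=> /measurable_EFinP mf; apply/measurable_EFinP.
  apply: (eq_measurable_fun (fun x => l `^ s * (x `^ (s - 1) * expR (- (l * x))))).
    move=> x; rewrite inE/= in_itv/= andbT => x0.
    rewrite powRM ?ltW// -{1}(mulr_powRB1 (ltW l0) s0); ring.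
  exact: measurable_funM.
- by move=> x _; rewrite lee_fin !mulr_ge0 ?powR_ge0 ?expR_ge0 ?ltW.
- by rewrite lee_fin powR_ge0.
apply: eq_integral => x; rewrite inE/= in_itv/= andbT => x0; rewrite -EFinM; congr EFin.
rewrite powRM ?ltW// powRN -(mulr_powRB1 (ltW l0) s0) invfM.
by field; rewrite (gt_eqF l0) powR_eq0 (gt_eqF l0).
Qed.

Lemma Gamma1 : Gamma (1 : R) = 1.
Proof.
apply: EFin_inj; rewrite -GammaE//.
under eq_integral do rewrite subrr powRr0 mul1r.
rewrite integral_itv_obnd_cbnd ?integral_expR_y ?oppr0 ?expR0//.
have := @measurable_gamma1 0 _ (@subset_refl _ _) (measurable_itv `]0, +oo[).
by under [X in measurable_fun _ X]eq_fun do rewrite powRr0 mul1r.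
Qed.

(** The Gaussian integral, after the substitution by the square root. *)
Lemma Gamma_half : Gamma (2^-1 : R) = Num.sqrt pi.
Proof.
have ds (x : R) : 0 < x -> is_derive x 1 (fun x : R => x `^ 2^-1) (2^-1 * x `^ (2^-1 - 1)).
  by move=> x0; exact: is_derive1_powR.
have h0 : 0 < 2^-1 :> R by rewrite invr_gt0.
have gE x : 0 < x -> gauss_fun (x `^ 2^-1) * (2^-1 * x `^ (2^-1 - 1)) =
    2^-1 * (x `^ (2^-1 - 1) * expR (- x)).
  move=> x0; rewrite /gauss_fun powR12_sqrt ?ltW// sqr_sqrtr ?ltW//; ring.
apply: (@mulfI _ 2^-1); first by rewrite gt_eqF.
rewrite [RHS]mulrC; apply: EFin_inj; rewrite -integral0y_gauss.
rewrite -integral_itv_obnd_cbnd; last first.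
  by apply/measurable_EFinP; apply: measurable_funTS; exact: measurable_gauss_fun.
rewrite (@substitution_gt0 _ (fun x => x `^ 2^-1) (fun x => 2^-1 * x `^ (2^-1 - 1)))//; first last.
- by move=> x _; exact: gauss_fun_ge0.
- by move=> x _; exact: continuous_gauss_fun.
- exact: powR_cvg0.
- apply/cvgryPge => A; exists (A ^+ 2); split => [|x Ax]; first by rewrite num_real.
  have x0 : 0 < x by apply: le_lt_trans Ax; exact: sqr_ge0.
  rewrite (powR12_sqrt (ltW x0)) (le_trans (ler_norm A))// -sqrtr_sqr.
  by rewrite ler_wsqrtr // (ltW Ax).
- apply/cvg_ex; exists (2^-1 * 0); apply: cvgMr.
  rewrite (_ : 2^-1 - 1 = - 2^-1 :> R); last by field.
  under eq_fun do rewrite powRN.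
  apply/gtr0_cvgV0.
    by exists 0; split => // x x0; rewrite powR_gt0.
  apply/cvgryPge => A; exists (A ^+ 2); split => [|x Ax]; first by rewrite num_real.
  have x0 : 0 < x by apply: le_lt_trans Ax; exact: sqr_ge0.
  rewrite (powR12_sqrt (ltW x0)) (le_trans (ler_norm A))// -sqrtr_sqr.
  by rewrite ler_wsqrtr // (ltW Ax).
- by move=> x x0; apply: cvgMr; exact: continuous_powR.
- by move=> x x0; rewrite mulr_ge0 ?powR_ge0 ?ltW.
- by move=> x x0; rewrite powR_gt0.
- move=> x y x0 xy; rewrite gt0_ltr_powR// nnegrE ltW//; exact: lt_trans xy.
rewrite EFinM -GammaE// -ge0_integralZl//.
- apply: eq_integral => x; rewrite inE/= in_itv/= andbT => x0.
  by rewrite gE.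
- by apply: measurable_gamma1.
- by move=> x _; exact: gamma_ge01.
Qed.

(** Half of log-convexity, by the inequality
    [2 sqrt s * sqrt x <= x + s] under the integral sign. Together with the
    functional equation it pins down the ratio of two values of [Gamma] at
    distance [1 / 2]. *)
Lemma Gamma_half_step s : 0 < s -> Gamma (s + 2^-1) <= Num.sqrt s * Gamma s.
Proof.
move=> s0.
have q0 : 0 < Num.sqrt s by rewrite sqrtr_gt0.
have h0 : 0 < 2^-1 :> R by rewrite invr_gt0.
suff : (2 * Num.sqrt s) * Gamma (s + 2^-1) <= Gamma (s + 1) + s * Gamma s.
  rewrite (GammaS s0) => H; rewrite -(ler_pM2l (mulr_gt0 (ltr0Sn R 1) q0)).
  apply: (le_trans H); rewrite mulrA -(mulrA 2) -expr2 (sqr_sqrtr (ltW s0)).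
  by rewrite -mulrA mulr_natl mulr2n.
rewrite -lee_fin EFinD !EFinM -(GammaE s0) -(GammaE (addr_gt0 s0 h0)) -(GammaE (addr_gt0 s0 ltr01)).
rewrite -!ge0_integralZl//; try exact: measurable_gamma1; try (by move=> x _; exact: gamma_ge01);
  try by rewrite lee_fin ?mulr_ge0 ?ltW.
rewrite -ge0_integralD//=; first last.
- by apply: measurable_funeM; exact: measurable_gamma1.
- by move=> x _; rewrite mule_ge0 ?gamma_ge01// lee_fin ltW.
- by apply: measurable_gamma1.
- by move=> x _; exact: gamma_ge01.
apply: ge0_le_integral => //.
- by move=> x _; rewrite mule_ge0 ?gamma_ge01// lee_fin mulr_ge0 ?ltW.
- by apply: measurable_funeM; exact: measurable_gamma1.
- apply: emeasurable_funD; first exact: measurable_gamma1.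
  by apply: measurable_funeM; exact: measurable_gamma1.
move=> x/=; rewrite in_itv/= andbT => x0.
rewrite -!EFinM -EFinD lee_fin.
have -> : s + 2^-1 - 1 = (s - 1) + 2^-1 by ring.
have -> : s + 1 - 1 = (s - 1) + 1 by ring.
move: (s - 1) => p.
rewrite !powRD ?(gt_eqF x0) ?implybT// (powRr1 (ltW x0)) (powR12_sqrt (ltW x0)).
have Q : 2 * Num.sqrt s * Num.sqrt x <= x + s.
  rewrite -{2}(sqr_sqrtr (ltW s0)) -{2}(sqr_sqrtr (ltW x0)).
  have := sqr_ge0 (Num.sqrt x - Num.sqrt s); lra.
have W : 0 <= x `^ p * expR (- x) by rewrite mulr_ge0 ?powR_ge0 ?expR_ge0.
apply: le_trans (le_trans (ler_wpM2r W Q) _).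
  by rewrite le_eqVlt; apply/orP; left; apply/eqP; ring.
by rewrite le_eqVlt; apply/orP; left; apply/eqP; ring.
Qed.

End gamma.

(** * A polynomial close to a step function *)

Section kernel.
Context {R : realType}.

(** Without constant term, and close to 0 below [1 / 2] and to 1 above:
    [v ^+ k.+1] is compared with [2 ^- k.+1], that is [2 v] with 1, and raising
    to the power [2 ^ k.+1] makes the comparison sharp. *)
Definition step_poly (k : nat) (v : R) : R := 1 - (1 - v ^+ k.+1) ^+ (2 ^ k.+1).

Definition step_coef (k i : nat) : R := (-1) ^+ i * 'C(2 ^ k.+1, i.+1)%:R.

Lemma step_poly_expand k v :
  step_poly k v = \sum_(i < 2 ^ k.+1) step_coef k i * v ^+ (k.+1 * i.+1).
Proof.
rewrite /step_poly exprBn big_ord_recl /= expr0 !mul1r subn0 expr1n bin0 mulr1n.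
rewrite mulr1 opprD addNKr -sumrN; apply: eq_bigr => i _.
by rewrite /step_coef expr1n mulr1 -exprM exprS -mulr_natr; ring.
Qed.

Lemma bernoulli_le (x : R) n : 0 <= x <= 1 -> 1 - n%:R * x <= (1 - x) ^+ n.
Proof.
move=> /andP[x0 x1]; elim: n => [|n IH]; first by rewrite mul0r subr0 expr0.
rewrite exprS; apply: (@le_trans _ _ ((1 - x) * (1 - n%:R * x))); last by rewrite ler_wpM2l// subr_ge0.
rewrite -natr1; have : 0 <= n%:R * (x * x) :> R by rewrite !mulr_ge0.
lra.
Qed.

Lemma step_poly_ge0 k v : 0 <= v <= 1 -> 0 <= step_poly k v.
Proof.
move=> /andP[v0 v1]; rewrite /step_poly subr_ge0 exprn_ile1 ?subr_ge0 ?exprn_ile1//.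
by rewrite lerBlDr lerDl exprn_ge0.
Qed.

Lemma step_poly_le1 k v : 0 <= v <= 1 -> step_poly k v <= 1.
Proof.
by move=> /andP[v0 v1]; rewrite /step_poly lerBlDr lerDl exprn_ge0// subr_ge0 exprn_ile1.
Qed.

(** [(1 - u) ^+ N <= exp (- N u) <= (1 + N u)^-1] with
    [u = v ^+ k.+1] and [N = 2 ^ k.+1], where [N u = (2 v) ^+ k.+1]. *)
Lemma step_poly_lower k (v r : R) : 1 < r -> 0 <= v <= 1 ->
  (1 - r ^- k) * (r / 2 <= v)%R%:R <= step_poly k v.
Proof.
move=> r1 /andP[v0 v1]; case: (boolP (r / 2 <= v)) => rv; last first.
  by rewrite mulr0; apply: step_poly_ge0; rewrite v0.
rewrite mulr1 /step_poly lerD2l lerN2.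
have r0 : 0 < r by apply: lt_trans r1.
have vk1 : v ^+ k.+1 <= 1 by rewrite exprn_ile1.
apply: (@le_trans _ _ (expR (- v ^+ k.+1) ^+ (2 ^ k.+1))).
  by rewrite lerXn2r ?nnegrE ?subr_ge0 ?expR_ge0 ?expR_ge1Dx.
rewrite -expRM_natl mulrN expRN lef_pV2 ?posrE ?expR_gt0 ?exprn_gt0//.
apply: (le_trans _ (expR_ge1Dx _)); rewrite natrX -exprMn.
apply: (@le_trans _ _ (r ^+ k.+1)); first by rewrite ler_eXn2l.
apply: (@le_trans _ _ ((2 * v) ^+ k.+1)); last by rewrite lerDr.
by rewrite lerXn2r ?nnegrE ?(ltW r0) ?mulr_ge0// mulrC -ler_pdivrMr.
Qed.

(** Below the threshold Bernoulli's inequality gives [(2 v) ^+ k.+1]; the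
    factor [v] is kept so that the error is integrable against the weights
    below, which may have infinite mass. *)
Lemma step_poly_upper k (v r : R) : 1 < r -> 0 <= v <= 1 ->
  step_poly k v <= ((2 * r)^-1 <= v)%R%:R + 2 * r ^- k * v.
Proof.
move=> r1 /andP[v0 v1]; have v01 : 0 <= v <= 1 by rewrite v0.
have r0 : 0 < r by apply: lt_trans r1.
have t0 : 0 <= 2 * r ^- k * v by rewrite !mulr_ge0 ?invr_ge0 ?exprn_ge0// ltW.
case: (boolP ((2 * r)^-1 <= v)) => rv.
  by apply: (le_trans (step_poly_le1 k v01)); rewrite lerDl.
rewrite add0r; move: rv; rewrite -ltNge => rv.
have B := @bernoulli_le (v ^+ k.+1) (2 ^ k.+1) _.
apply: (@le_trans _ _ ((2 ^ k.+1)%:R * v ^+ k.+1)).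
  by rewrite /step_poly lerBlDr -lerBlDl B// exprn_ge0//= exprn_ile1.
rewrite natrX -exprMn exprS (_ : 2 * r ^- k * v = 2 * v * r ^- k); last by ring.
rewrite ler_wpM2l ?mulr_ge0// -exprVn.
rewrite lerXn2r ?nnegrE ?mulr_ge0 ?invr_ge0 ?(ltW r0)//.
by move: (ltW rv); rewrite invfM -ler_pdivlMl.
Qed.
End kernel.

Section weighted.
Context dT {T : measurableType dT} {R : realType} (mu : {measure set T -> \bar R}).
Variables (D : set T) (w v : T -> R).
Hypothesis mD : measurable D.
Hypothesis mw : measurable_fun D w.
Hypothesis mv : measurable_fun D v.
Hypothesis w0 : forall x, D x -> 0 <= w x.
Hypothesis v01 : forall x, D x -> 0 <= v x <= 1.
Hypothesis iwv : mu.-integrable D (fun x => (w x * v x)%:E).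

Lemma integrable_dominated (f : T -> R) (M : R) : measurable_fun D f ->
  (forall x, D x -> `|f x| <= M * (w x * v x)) ->
  mu.-integrable D (fun x => (f x)%:E).
Proof.
move=> mf fM; apply: (@le_integrable _ _ _ _ D mD _ (fun x => (M * (w x * v x))%:E)).
- exact/measurable_EFinP.
- move=> x Dx; rewrite !abse_EFin lee_fin; apply: (le_trans (fM x Dx)); exact: ler_norm.
- rewrite (_ : (fun x => _) = (fun x => M%:E * (w x * v x)%:E)%E) //.
  exact: integrableZl.
Qed.

Let ind (a : R) x : R := (a <= v x)%R%:R.
Let mind a : measurable_fun D (ind a).
Proof.
rewrite /ind (_ : (fun x => _) = (fun x => if a <= v x then 1 else 0)); last first.
  by apply/funext => x; case: ifP.
apply: measurable_fun_if => //.
- by apply: measurable_fun_ler => //.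
Qed.

(** The weight [w] need not be integrable, only [w * v]: the absence of a
    constant term in [step_poly] is what makes all the integrals finite. *)
Lemma weighted_step_poly k (r : R) : 1 < r -> r < 2 ->
  (1 - r ^- k) * \int[mu]_(x in D) (w x * (r / 2 <= v x)%R%:R) <=
  \sum_(i < 2 ^ k.+1) step_coef k i * \int[mu]_(x in D) (w x * v x ^+ (k.+1 * i.+1)) <=
  \int[mu]_(x in D) (w x * ((2 * r)^-1 <= v x)%R%:R) + 2 * r ^- k * \int[mu]_(x in D) (w x * v x).
Proof.
move=> r1 r2.
have r0 : 0 < r by exact: lt_trans r1.
have wv0 x : D x -> 0 <= w x * v x.
  by move=> Dx; rewrite mulr_ge0 ?w0//; have /andP[] := v01 Dx.
have ip n : mu.-integrable D (fun x => (w x * v x ^+ n.+1)%:E).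
  apply: (@integrable_dominated _ 1).
    by apply: measurable_funM => //; exact: measurable_funX.
  move=> x Dx; have /andP[a b] := v01 Dx.
  rewrite mul1r ger0_norm ?mulr_ge0 ?w0 ?exprn_ge0// ler_wpM2l ?w0// exprS ler_piMr// exprn_ile1//.
have ii a : 0 < a -> mu.-integrable D (fun x => (w x * (a <= v x)%R%:R)%:E).
  move=> a0; apply: (@integrable_dominated _ a^-1).
    by apply: measurable_funM => //; exact: mind.
  move=> x Dx; rewrite ger0_norm ?mulr_ge0 ?w0 ?ler0n//.
  case: (boolP (a <= v x)) => av; last by rewrite mulr0 mulr_ge0 ?wv0// invr_ge0 ltW.
  by rewrite mulr1 mulrC -mulrA ler_peMr ?w0// ler_pdivlMr// mul1r.
have mb k' : measurable_fun D (fun x => step_poly k' (v x)).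
  rewrite /step_poly; apply: measurable_funB => //; apply: measurable_funX.
  by apply: measurable_funB => //; exact: measurable_funX.
have ib : mu.-integrable D (fun x => (w x * step_poly k (v x))%:E).
  apply: (@integrable_dominated _ (2 * r + 2 * r ^- k)); first exact: measurable_funM.
  move=> x Dx; have /andP[a b] := v01 Dx.
  rewrite ger0_norm ?mulr_ge0 ?w0 ?step_poly_ge0 ?v01//.
  have -> : (2 * r + 2 * r ^- k) * (w x * v x) = w x * ((2 * r + 2 * r ^- k) * v x) by ring.
  rewrite ler_wpM2l ?w0//; apply: (le_trans (step_poly_upper k r1 (v01 Dx))).
  rewrite [leRHS]mulrDl lerD2r; case: (boolP (_ <= v x)) => av; last by rewrite !mulr_ge0// ltW.
  by rewrite -ler_pdivrMl ?mulr_gt0// mulr1.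
have -> : \sum_(i < 2 ^ k.+1) step_coef k i * \int[mu]_(x in D) (w x * v x ^+ (k.+1 * i.+1)) =
    \int[mu]_(x in D) (w x * step_poly k (v x)).
  transitivity (\sum_(i < 2 ^ k.+1) \int[mu]_(x in D) (step_coef k i * (w x * v x ^+ (k.+1 * i.+1)))).
    by apply: eq_bigr => i _; rewrite RintegralZl//; rewrite mulnS addSn; exact: ip.
  transitivity (\int[mu]_(x in D) (\sum_(i < 2 ^ k.+1) step_coef k i * (w x * v x ^+ (k.+1 * i.+1)))).
    have gen (s : seq 'I_(2 ^ k.+1)) :
        mu.-integrable D (fun x => (\sum_(i <- s) step_coef k i * (w x * v x ^+ (k.+1 * i.+1)))%:E) /\
        \sum_(i <- s) \int[mu]_(x in D) (step_coef k i * (w x * v x ^+ (k.+1 * i.+1))) =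
        \int[mu]_(x in D) (\sum_(i <- s) step_coef k i * (w x * v x ^+ (k.+1 * i.+1))).
      elim: s => [|i s [IH1 IH2]].
        split.
          by under eq_fun do rewrite big_nil; exact: integrable0.
        rewrite big_nil; under [RHS]eq_Rintegral do rewrite big_nil.
        by rewrite Rintegral_cst// mul0r.
      have i1 : mu.-integrable D (fun x => (step_coef k i * (w x * v x ^+ (k.+1 * i.+1)))%:E).
        rewrite (_ : (fun x => _) = (fun x => (step_coef k i)%:E * (w x * v x ^+ (k.+1 * i.+1))%:E)%E)//.
        by apply: integrableZl => //; rewrite mulnS addSn; exact: ip.
      split.
        under eq_fun do rewrite big_cons EFinD; exact: integrableD.
      rewrite big_cons IH2 -RintegralD//.
      by apply: eq_Rintegral => x _; rewrite big_cons.
    by have [_] := gen (index_enum 'I_(2 ^ k.+1)).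
  apply: eq_Rintegral => x _; rewrite step_poly_expand mulr_sumr.
  by apply: eq_bigr => i _; ring.
apply/andP; split.
  rewrite -RintegralZl//; last by apply: ii; rewrite divr_gt0.
  apply: le_Rintegral => //.
    rewrite (_ : EFin \o _ = (fun x => (1 - r ^- k)%:E * (w x * (r / 2 <= v x)%R%:R)%:E)%E)//.
    by apply: integrableZl => //; apply: ii; rewrite divr_gt0.
  move=> x Dx; have := ler_wpM2l (w0 Dx) (step_poly_lower k r1 (v01 Dx)).
  by apply: le_trans; rewrite le_eqVlt; apply/orP; left; apply/eqP; ring.
have i2 : mu.-integrable D (fun x => (2 * r ^- k * (w x * v x))%:E).
  rewrite (_ : (fun x => _) = (fun x => (2 * r ^- k)%:E * (w x * v x)%:E)%E)//.
  exact: integrableZl.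
have i1 := ii ((2 * r)^-1) ltac:(by rewrite invr_gt0 mulr_gt0).
rewrite -RintegralZl// -RintegralD//; apply: le_Rintegral => //.
  by under [X in _.-integrable _ X]eq_fun do rewrite /= EFinD; exact: integrableD.
move=> x Dx; have := ler_wpM2l (w0 Dx) (step_poly_upper k r1 (v01 Dx)).
by move=> H; apply: (le_trans H); rewrite le_eqVlt; apply/orP; left; apply/eqP; ring.
Qed.
End weighted.

(** * Karamata's Tauberian theorem *)

Section reference.
Context {R : realType}.
Local Notation mu := (@lebesgue_measure R).
Variable g : R.
Hypothesis g0 : 0 < g.

(** The value of the linear form [v ^ n -> n ^ (- g)] at [step_poly]; it is
    the integral of [step_poly (exp (- x))] against the measure
    [x ^ (g - 1) dx / Gamma g]. *)
Definition gamma_step (k : nat) : R := \sum_(i < 2 ^ k.+1) step_coef k i * (k.+1 * i.+1)%:R `^ (- g).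

Lemma gamma_power_moment n : (0 < n)%N ->
  \int[mu]_(x in `]0, +oo[) (x `^ (g - 1) * expR (- x) ^+ n) = n%:R `^ (- g) * Gamma g.
Proof.
move=> n0; rewrite /Rintegral.
under eq_integral do rewrite -expRM_natl mulrN.
by rewrite Gamma_scale// ltr0n.
Qed.

Lemma gamma_tail (a : R) : 0 < a < 1 ->
  \int[mu]_(x in `]0, +oo[) (x `^ (g - 1) * (a <= expR (- x))%R%:R) = (- ln a) `^ g / g.
Proof.
move=> /andP[a0 a1]; have la : 0 < - ln a by rewrite oppr_gt0 ln_lt0// a0.
rewrite /Rintegral (integral_gt0_split la)/=; last 2 first.
- apply/measurable_EFinP; apply: measurable_funM.
    by apply/measurable_EFinP; exact: measurable_powR_gt0.
  rewrite (_ : (fun x => _) = (fun x : R => if a <= expR (- x) then 1 else 0)); last first.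
    by apply/funext => x; case: ifP.
  apply: measurable_fun_if => //; apply: measurable_fun_ler => //.
  by apply: measurableT_comp => //; exact: measurable_expR.
- by move=> x _; rewrite lee_fin mulr_ge0 ?powR_ge0// ler0n.
have cmp x : (a <= expR (- x)) = (x <= - ln a).
  by rewrite -[in LHS](lnK (_ : a \is Num.pos)) ?posrE// ler_expR lerNr.
under eq_integral => x.
  rewrite inE/= in_itv/= => /andP[_ xa]; rewrite cmp xa mulr1; over.
rewrite integral_powR0// [X in (_ + X)%E]integral0_eq ?adde0//.
by move=> x/=; rewrite in_itv/= andbT => xa; rewrite cmp leNgt xa mulr0.
Qed.

(** The sandwich of [step_poly] for the measure [x ^ (g - 1) dx], for which
    moments and tails are both explicit. *)
Lemma gamma_step_bounds k (r : R) : 1 < r -> r < 2 ->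
  (1 - r ^- k) * (ln (2 / r) `^ g / Gamma (g + 1)) <= gamma_step k <=
  ln (2 * r) `^ g / Gamma (g + 1) + 2 * r ^- k.
Proof.
move=> r1 r2; have r0 : 0 < r by exact: lt_trans r1.
have G0 := Gamma_gt0 g0.
have := @weighted_step_poly _ _ _ mu `]0, +oo[%classic (fun x => x `^ (g - 1)) (fun x => expR (- x)).
move=> /(_ (measurable_itv _) _ _ _ _ _ k r r1 r2).
have E (x : R) : `]0, +oo[%classic x -> 0 < x by rewrite /= in_itv/= andbT.
rewrite gamma_tail; last by rewrite divr_gt0//= ltr_pdivrMr// mul1r.
rewrite gamma_tail; last first.
  by rewrite invr_gt0 mulr_gt0//= invf_lt1 ?mulr_gt0//; lra.
have -> : - ln (r / 2) = ln (2 / r) by rewrite -lnV ?posrE ?divr_gt0// invf_div.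
have -> : - ln (2 * r)^-1 = ln (2 * r) by rewrite lnV ?opprK// posrE mulr_gt0.
have -> : \sum_(i < 2 ^ k.+1) step_coef k i *
    \int[mu]_(x in `]0, +oo[) (x `^ (g - 1) * expR (- x) ^+ (k.+1 * i.+1)) = gamma_step k * Gamma g.
  by rewrite /gamma_step mulr_suml; apply: eq_bigr => i _; rewrite gamma_power_moment ?muln_gt0// mulrA.
have -> : \int[mu]_(x in `]0, +oo[) (x `^ (g - 1) * expR (- x)) = Gamma g by [].
move=> H; have {H} : [/\ True & (1 - r ^- k) * (ln (2 / r) `^ g / g) <= gamma_step k * Gamma g
     <= ln (2 * r) `^ g / g + 2 * r ^- k * Gamma g].
  split => //; apply: H.
  - by apply/measurable_EFinP; exact: measurable_powR_gt0.
  - apply: measurable_funTS; apply: measurableT_comp => //; exact: measurable_expR.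
  - by move=> x _; exact: powR_ge0.
  - by move=> x /E x0; rewrite expR_ge0/= expR_le1 oppr_le0 ltW.
  - apply/integrableP; split; first by apply: measurable_gamma1.
    under eq_integral do rewrite gee0_abs ?gamma_ge01//.
    by rewrite GammaE// ltry.
move=> [_ /andP[L U]]; rewrite GammaS//; apply/andP; split.
- rewrite -(ler_pM2r G0); apply: le_trans L.
  by rewrite le_eqVlt; apply/orP; left; apply/eqP; field; rewrite ?(gt_eqF G0) ?(gt_eqF g0) ?(gt_eqF (exprn_gt0 k r0)) ?(gt_eqF r0).
- rewrite -(ler_pM2r G0); apply: (le_trans U).
  by rewrite le_eqVlt; apply/orP; left; apply/eqP; field; rewrite expf_eq0 !gt_eqF// andbF.
Qed.
End reference.

Lemma powRVl (R : realType) (z p : R) : 0 <= z -> z^-1 `^ p = (z `^ p)^-1.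
Proof. by move=> z0; rewrite -powR_inv1// -powRrM mulN1r powRN. Qed.

Lemma cvg_bigsum (R : realType) (I : Type) (s : seq I) (f : I -> nat -> R) (l : I -> R) :
  (forall i, f i j @[j --> \oo] --> l i) ->
  \sum_(i <- s) f i j @[j --> \oo] --> \sum_(i <- s) l i.
Proof.
move=> fl; elim: s => [|i s IH].
  by under eq_fun do rewrite big_nil; rewrite big_nil; exact: cvg_cst.
by under eq_fun do rewrite big_cons; rewrite big_cons; apply: cvgD.
Qed.

Section karamata.
Context dT {T : measurableType dT} {R : realType} (mu : {measure set T -> \bar R}).
Variables (D : set T) (V : T -> R) (g L : R).
Hypothesis mD : measurable D.
Hypothesis muD : (mu D < +oo)%E.
Hypothesis mV : measurable_fun D V.
Hypothesis V01 : forall x, D x -> 0 <= V x <= 1.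
Hypothesis g0 : 0 < g.

Definition power_moment (j : nat) : R := \int[mu]_(x in D) V x ^+ j.
(** The measure of [V >= exp (- y)]; the exponential parameter makes the
    level sets of a power of [V] a rescaling: [V ^+ j >= exp (- y)] is
    [V >= exp (- (y / j))]. *)
Definition upper_tail (y : R) : R := \int[mu]_(x in D) (expR (- y) <= V x)%R%:R.

Hypothesis moment_lim : j%:R `^ g * power_moment j @[j --> \oo] --> L.

Let itail y : mu.-integrable D (EFin \o (fun x => (expR (- y) <= V x)%R%:R)).
Proof.
apply: measurable_bounded_integrable => //.
  rewrite (_ : (fun x => _) = (fun x => if expR (- y) <= V x then 1 else 0)); last first.
    by apply/funext => x; case: ifP.
  by apply: measurable_fun_if => //; apply: measurable_fun_ler => //.
exists 1; split => // N N1 x _ /=; apply: le_trans (ltW N1).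
by rewrite normr_nat lern1 leq_b1.
Qed.

Lemma upper_tail_ge0 y : 0 <= upper_tail y.
Proof. by apply: Rintegral_ge0 => x _; rewrite ler0n. Qed.

Lemma upper_tail_mono y z : y <= z -> upper_tail y <= upper_tail z.
Proof.
move=> yz; apply: le_Rintegral => // x _; rewrite ler_nat.
case: (boolP (expR (- y) <= V x)) => // H; rewrite (le_trans _ H)// ler_expR lerN2//.
Qed.

Lemma power_moment_ge0 j : 0 <= power_moment j.
Proof. by apply: Rintegral_ge0 => x Dx; rewrite exprn_ge0//; have /andP[] := V01 Dx. Qed.

Lemma moment_lim_ge0 : 0 <= L.
Proof.
apply: (ler_cvg_to (cvg_cst 0) moment_lim); near=> j.
by rewrite mulr_ge0 ?powR_ge0 ?power_moment_ge0.
Unshelve. all: by end_near. Qed.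

(** [step_poly] evaluated at [V ^+ j], which jumps where [V] is about
    [exp (- ln 2 / j)]. *)
Lemma tail_moment_sandwich k j (r : R) : (0 < j)%N -> 1 < r -> r < 2 ->
  (1 - r ^- k) * upper_tail (ln (2 / r) / j%:R) <=
  \sum_(i < 2 ^ k.+1) step_coef k i * power_moment (j * (k.+1 * i.+1)) <=
  upper_tail (ln (2 * r) / j%:R) + 2 * r ^- k * power_moment j.
Proof.
move=> j0 r1 r2; have r0 : 0 < r by exact: lt_trans r1.
have := @weighted_step_poly _ _ _ mu D (fun=> 1) (fun x => V x ^+ j) mD (measurable_cst _)
  (measurable_funX _ mV) _ _ _ k r r1 r2.
have cmp a x : 0 < a -> D x -> (a <= V x ^+ j) = (expR (- (- ln a / j%:R)) <= V x).
  move=> a0 Dx; have /andP[V0 V1] := V01 Dx.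
  rewrite -[RHS](@ler_pXn2r _ j)// ?nnegrE ?expR_ge0// -expRM_natl.
  have jn : j%:R != 0 :> R by rewrite pnatr_eq0 -lt0n.
  have -> : j%:R * - (- ln a / j%:R) = ln a by field.
  by rewrite lnK.
have tailE a : 0 < a -> \int[mu]_(x in D) (1 * (a <= V x ^+ j)%R%:R) = upper_tail (- ln a / j%:R).
  by move=> a0; apply: eq_Rintegral => x; rewrite inE => Dx; rewrite mul1r cmp.
rewrite tailE ?divr_gt0// tailE ?invr_gt0 ?mulr_gt0//.
have -> : - ln (r / 2) = ln (2 / r) by rewrite -lnV ?posrE ?divr_gt0// invf_div.
have -> : - ln (2 * r)^-1 = ln (2 * r) by rewrite lnV ?opprK// posrE mulr_gt0.
have -> : \int[mu]_(x in D) (1 * V x ^+ j) = power_moment j by apply: eq_Rintegral => x _; rewrite mul1r.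
have -> : \sum_(i < 2 ^ k.+1) step_coef k i * \int[mu]_(x in D) (1 * V x ^+ j ^+ (k.+1 * i.+1)) =
  \sum_(i < 2 ^ k.+1) step_coef k i * power_moment (j * (k.+1 * i.+1)).
  apply: eq_bigr => i _; congr (_ * _); apply: eq_Rintegral => x _.
  by rewrite mul1r -exprM.
apply => //.
- by move=> x Dx; have /andP[a b] := V01 Dx; rewrite exprn_ge0//= exprn_ile1.
- have : mu.-integrable D (EFin \o (fun x => 1 * V x ^+ j)); last by [].
  apply: measurable_bounded_integrable => //.
    by apply: measurable_funM => //; exact: measurable_funX.
  exists 1; split => // N N1 x Dx /=; have /andP[a b] := V01 Dx.
  by rewrite mul1r ger0_norm ?exprn_ge0// (le_trans _ (ltW N1))// exprn_ile1 //.
Qed.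

Lemma moment_sum_lim k : j%:R `^ g *
  (\sum_(i < 2 ^ k.+1) step_coef k i * power_moment (j * (k.+1 * i.+1))) @[j --> \oo] --> L * gamma_step g k.
Proof.
have E : (fun j : nat => j%:R `^ g * (\sum_(i < 2 ^ k.+1) step_coef k i * power_moment (j * (k.+1 * i.+1)))) =
   (fun j => \sum_(i < 2 ^ k.+1) (step_coef k i * (k.+1 * i.+1)%:R `^ (- g)) *
      ((j * (k.+1 * i.+1))%:R `^ g * power_moment (j * (k.+1 * i.+1)))).
  apply/funext => j; rewrite mulr_sumr; apply: eq_bigr => i _.
  set n := (k.+1 * i.+1)%N; have n0 : (0 : R) < n%:R by rewrite ltr0n muln_gt0.
  rewrite natrM powRM ?ler0n// powRN; field.
  by rewrite powR_eq0 (gt_eqF n0).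
rewrite E mulrC /gamma_step mulr_suml; apply: cvg_bigsum => i.
apply: cvgMr.
have n0 : (0 < k.+1 * i.+1)%N by rewrite muln_gt0.
move: (k.+1 * i.+1)%N n0 => n n0.
apply: (cvg_comp (fun j => (j * n)%N) _ _ moment_lim).
move=> A [N _ NA]; exists N => // j /= Nj; apply: NA => /=.
by rewrite (leq_trans Nj)// leq_pmulr.
Qed.

Let c := L / Gamma (g + 1).
Let c_ge0 : 0 <= c.
Proof. by rewrite divr_ge0 ?moment_lim_ge0// ltW// Gamma_gt0// addr_gt0. Qed.

Let pow_lim (r : R) : 1 < r -> r ^- k @[k --> \oo] --> (0 : R).
Proof.
move=> r1; under eq_fun do rewrite -exprVn.
apply: cvg_expr; rewrite ger0_norm ?invr_ge0 ?ltW ?(lt_trans _ r1)//.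
by rewrite invf_lt1// (lt_trans _ r1).
Qed.

(** First [k] is chosen so that the errors [r ^- k] are absorbed in the
    gap, then [j] tends to infinity. *)
Let upper_j (r b : R) : 1 < r -> r < 2 -> c * ln (2 * r) `^ g < b ->
  \forall j \near \oo, j%:R `^ g * upper_tail (ln (2 / r) / j%:R) <= b.
Proof.
move=> r1 r2 cb.
have lim1 : b * (1 - r ^- k) - L * (ln (2 * r) `^ g / Gamma (g + 1) + 2 * r ^- k) @[k --> \oo] -->
    b * (1 - 0) - L * (ln (2 * r) `^ g / Gamma (g + 1) + 2 * 0).
  apply: cvgB; first by apply: cvgMr; apply: cvgB; [exact: cvg_cst|exact: pow_lim].
  by apply: cvgMr; apply: cvgD; [exact: cvg_cst|apply: cvgMr; exact: pow_lim].
have pos : 0 < b * (1 - 0) - L * (ln (2 * r) `^ g / Gamma (g + 1) + 2 * 0).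
  by rewrite mulr0 addr0 subr0 mulr1 subr_gt0; move: cb; rewrite /c mulrAC mulrA.
have [k [kpos k1]] : exists k, 0 < b * (1 - r ^- k) - L * (ln (2 * r) `^ g / Gamma (g + 1) + 2 * r ^- k)
    /\ (0 < k)%N.
  have [N _ NP] : \forall k \near \oo, _ := cvgr_gt _ lim1 _ pos.
  by exists N.+1; split => //; apply: NP => /=.
have d1 : 0 < 1 - r ^- k.
  have r0 : 0 < r by exact: lt_trans r1.
  by rewrite subr_gt0 invf_lt1 ?exprn_gt0// exprn_egt1// -lt0n.
have Lk : L * gamma_step g k < b * (1 - r ^- k).
  have /andP[_ U] := gamma_step_bounds g0 k r1 r2.
  rewrite -subr_gt0; apply: (lt_le_trans kpos); rewrite lerD2l lerN2 ler_wpM2l ?moment_lim_ge0//.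
near=> j.
have j0 : (0 < j)%N by near: j; exists 1%N.
have /andP[S _] := tail_moment_sandwich k j0 r1 r2.
rewrite -(ler_pM2r d1).
apply: (@le_trans _ _ (j%:R `^ g * (\sum_(i < 2 ^ k.+1) step_coef k i * power_moment (j * (k.+1 * i.+1))))).
  by rewrite -mulrA ler_wpM2l ?powR_ge0// mulrC.
near: j; apply: cvgr_le Lk; exact: moment_sum_lim.
Unshelve. all: by end_near. Qed.

Let lower_j (r b : R) : 1 < r -> r < 2 -> b < c * ln (2 / r) `^ g ->
  \forall j \near \oo, b <= j%:R `^ g * upper_tail (ln (2 * r) / j%:R).
Proof.
move=> r1 r2 cb.
have lim1 : L * ((1 - r ^- k) * (ln (2 / r) `^ g / Gamma (g + 1))) - 2 * r ^- k * L @[k --> \oo] -->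
    L * ((1 - 0) * (ln (2 / r) `^ g / Gamma (g + 1))) - 2 * 0 * L.
  apply: cvgB.
    by apply: cvgMr; apply: cvgMl; apply: cvgB; [exact: cvg_cst|exact: pow_lim].
  by apply: cvgMl; apply: cvgMr; exact: pow_lim.
have pos : b < L * ((1 - 0) * (ln (2 / r) `^ g / Gamma (g + 1))) - 2 * 0 * L.
  by rewrite mulr0 mul0r subr0 subr0 mul1r; move: cb; rewrite /c mulrAC mulrA.
have [k kpos] : exists k, b < L * ((1 - r ^- k) * (ln (2 / r) `^ g / Gamma (g + 1))) - 2 * r ^- k * L.
  have [N _ NP] : \forall k \near \oo, _ := cvgr_gt _ lim1 _ pos.
  by exists N; apply: NP => /=.
have lim2 : j%:R `^ g * (\sum_(i < 2 ^ k.+1) step_coef k i * power_moment (j * (k.+1 * i.+1)))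
   - 2 * r ^- k * (j%:R `^ g * power_moment j) @[j --> \oo] --> L * gamma_step g k - 2 * r ^- k * L.
  by apply: cvgB; [exact: moment_sum_lim|apply: cvgMr; exact: moment_lim].
have Lk : b < L * gamma_step g k - 2 * r ^- k * L.
  have /andP[U _] := gamma_step_bounds g0 k r1 r2.
  by apply: (lt_le_trans kpos); rewrite lerD2r ler_wpM2l ?moment_lim_ge0.
near=> j.
have j0 : (0 < j)%N by near: j; exists 1%N.
have /andP[_ S] := tail_moment_sandwich k j0 r1 r2.
apply: (@le_trans _ _ (j%:R `^ g * (\sum_(i < 2 ^ k.+1) step_coef k i * power_moment (j * (k.+1 * i.+1)))
   - 2 * r ^- k * (j%:R `^ g * power_moment j))).
  near: j; apply: cvgr_ge Lk; exact: lim2.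
have := ler_wpM2l (powR_ge0 j%:R g) S; lra.
Unshelve. all: by end_near. Qed.

Let ratio_lim : ((j.+1)%:R / j%:R) `^ g @[j --> \oo] --> (1 : R).
Proof.
have e1 : (1:R) = 1 `^ g by rewrite powR1.
rewrite [X in _ --> X]e1.
apply: (@cvg_comp _ _ _ (fun j : nat => j.+1%:R / j%:R : R) (fun x => x `^ g) _ (nbhs (1:R))).
  have : 1 + (j%:R : R)^-1 @[j --> \oo] --> (1 + 0 : R).
    apply: cvgD; first exact: cvg_cst.
    by apply/gtr0_cvgV0; [exists 1%N => // j /= j0; rewrite ltr0n|exact: cvgr_idn].
  rewrite addr0; apply: cvg_trans; apply: near_eq_cvg; exists 1%N => // j /= j0.
  by rewrite -natr1 mulrDl mul1r divff// pnatr_eq0 -lt0n.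
exact: continuous_powR.
Qed.

(** Passage from integers to real arguments: [x] lies between
    [y / j.+1] and [y / j] for [j = truncn (y / x)]. *)
Let near_trunc (y : R) (P : nat -> Prop) : 0 < y -> (\forall j \near \oo, P j) ->
  \forall x \near 0^'+, P (Num.truncn (y / x)).
Proof.
move=> y0 [N _ NP]; near=> x.
have x0 : 0 < x by near: x; exact: nbhs_right_gt.
apply: NP => /=; rewrite (truncn_ge_nat _ (divr_ge0 (ltW y0) (ltW x0))) ler_pdivlMr//.
have N0 : 0 < N.+1%:R :> R by rewrite ltr0n.
apply: (@le_trans _ _ (N.+1%:R * x)); first by rewrite ler_pM2r// ler_nat.
rewrite -ler_pdivlMl//; near: x; apply: nbhs_right_le; rewrite mulr_gt0 ?invr_gt0//.
Unshelve. all: by end_near. Qed.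

Let upper_x (r b : R) : 1 < r -> r < 2 -> c * ln (2 * r) `^ g / ln (2 / r) `^ g < b ->
  \forall x \near 0^'+, x `^ (- g) * upper_tail x <= b.
Proof.
move=> r1 r2 cb; have r0 : 0 < r by exact: lt_trans r1.
set y := ln (2 / r) in cb *.
have y0 : 0 < y by rewrite ln_gt0// ltr_pdivlMr// mul1r.
have yg : 0 < y `^ g by rewrite powR_gt0.
set a := c * _ / _ in cb.
have [b1 /andP[ab1 b1b]] : exists b1, a < b1 < b by exists ((a + b) / 2); apply/andP; split; lra.
have a0 : 0 <= a by rewrite /a divr_ge0 ?powR_ge0// mulr_ge0 ?powR_ge0.
have H1 : \forall j \near \oo, j%:R `^ g * upper_tail (y / j%:R) <= b1 * y `^ g.
  by apply: (@upper_j r) => //; rewrite -ltr_pdivrMr.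
have H2 : \forall j \near \oo, ((j.+1)%:R / j%:R) `^ g * b1 <= b.
  apply: cvgr_le b1b; rewrite -[X in _ --> X]mul1r; apply: cvgMl; exact: ratio_lim.
have H3 : \forall j \near \oo, (0 < j)%N by exists 1%N.
pose Q (j : nat) := j%:R `^ g * upper_tail (y / j%:R) <= b1 * y `^ g /\
  (((j.+1)%:R / j%:R) `^ g * b1 <= b /\ (0 < j)%N).
have H := @near_trunc y Q y0 (filterI H1 (filterI H2 H3)).
near=> x; have x0 : 0 < x by near: x; exact: nbhs_right_gt.
have [A1 [A2 A3]] : Q (Num.truncn (y / x)) by near: x; exact: H.
have yx0 : 0 <= y / x by rewrite divr_ge0// ltW.
have /andP[t1 t2] := truncn_itv yx0.
set j := Num.truncn (y / x) in A1 A2 A3 t1 t2.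
have jp : 0 < j%:R :> R by rewrite ltr0n.
have xy : x <= y / j%:R by rewrite ler_pdivlMr// mulrC -ler_pdivlMr.
have xi : x `^ (- g) <= (j.+1%:R / y) `^ g.
  rewrite -(invf_div y) (powRVl _ (divr_ge0 (ltW y0) (ler0n R j.+1))) powRN.
  rewrite lef_pV2 ?posrE ?powR_gt0 ?divr_gt0//.
  rewrite ge0_ler_powR ?nnegrE ?(divr_ge0 (ltW y0) (ler0n R j.+1)) ?(ltW g0) ?(ltW x0)//.
  by rewrite ler_pdivrMr// mulrC -ler_pdivrMr// ltW.
apply: (@le_trans _ _ ((j.+1%:R / y) `^ g * upper_tail (y / j%:R))).
  by apply: ler_pM => //; rewrite ?powR_ge0 ?upper_tail_ge0 ?upper_tail_mono.
apply: le_trans A2.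
have -> : (j.+1%:R / y) `^ g = (j.+1%:R / j%:R) `^ g * (j%:R `^ g / y `^ g).
  have -> : j.+1%:R / y = (j.+1%:R / j%:R) * (j%:R * y^-1).
    by field; rewrite !gt_eqF.
  have jr0 : 0 <= j.+1%:R / j%:R :> R by rewrite divr_ge0.
  have jy0 : 0 <= j%:R / y by rewrite divr_ge0// ltW.
  have yi0 : 0 <= y^-1 by rewrite invr_ge0 ltW.
  by rewrite (powRM _ jr0 jy0) (powRM _ (ler0n R j) yi0) (powRVl _ (ltW y0)).
rewrite -mulrA ler_wpM2l ?powR_ge0// mulrAC ler_pdivrMr//.
Unshelve. all: by end_near. Qed.

Let lower_x (r b : R) : 1 < r -> r < 2 -> 0 < b -> b < c * ln (2 / r) `^ g / ln (2 * r) `^ g ->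
  \forall x \near 0^'+, b <= x `^ (- g) * upper_tail x.
Proof.
move=> r1 r2 b0 cb; have r0 : 0 < r by exact: lt_trans r1.
set y := ln (2 * r) in cb *.
have y0 : 0 < y by rewrite ln_gt0//; lra.
have yg : 0 < y `^ g by rewrite powR_gt0.
set a := c * _ / _ in cb.
have [b1 /andP[ab1 b1b]] : exists b1, b < b1 < a by exists ((a + b) / 2); apply/andP; split; lra.
have H1 : \forall j \near \oo, b1 * y `^ g <= j.+1%:R `^ g * upper_tail (y / j.+1%:R).
  have [N _ NP] : \forall j \near \oo, b1 * y `^ g <= j%:R `^ g * upper_tail (y / j%:R).
    by apply: (@lower_j r) => //; rewrite -ltr_pdivlMr.
  by exists N; [exact: Logic.I|move=> j /= Nj; apply: (NP j.+1); exact: leqW Nj].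
have H2 : \forall j \near \oo, ((j.+1)%:R / j%:R) `^ g * b <= b1.
  apply: cvgr_le ab1; rewrite -[X in _ --> X]mul1r; apply: cvgMl; exact: ratio_lim.
have H3 : \forall j \near \oo, (0 < j)%N by exists 1%N.
pose Q (j : nat) := b1 * y `^ g <= j.+1%:R `^ g * upper_tail (y / j.+1%:R) /\
  (((j.+1)%:R / j%:R) `^ g * b <= b1 /\ (0 < j)%N).
have H := @near_trunc y Q y0 (filterI H1 (filterI H2 H3)).
near=> x; have x0 : 0 < x by near: x; exact: nbhs_right_gt.
have [A1 [A2 A3]] : Q (Num.truncn (y / x)) by near: x; exact: H.
have yx0 : 0 <= y / x by rewrite divr_ge0// ltW.
have /andP[t1 t2] := truncn_itv yx0.
set j := Num.truncn (y / x) in A1 A2 A3 t1 t2.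
have jp : 0 < j%:R :> R by rewrite ltr0n.
have jp1 : 0 < j.+1%:R :> R by rewrite ltr0n.
have xy : y / j.+1%:R <= x by rewrite ler_pdivrMr// mulrC -ler_pdivrMr// ltW.
have xj : x <= y / j%:R by rewrite ler_pdivlMr// mulrC -ler_pdivlMr.
have jj : 0 < (j.+1%:R / j%:R) `^ g :> R by rewrite powR_gt0// divr_gt0.
have xg : x `^ g <= (y / j%:R) `^ g.
  by rewrite ge0_ler_powR ?nnegrE ?(divr_ge0 (ltW y0) (ltW jp)) ?(ltW g0) ?(ltW x0).
have xg0 : 0 < x `^ g by rewrite powR_gt0.
rewrite powRN mulrC ler_pdivlMr//.
apply: (@le_trans _ _ (b * (y / j%:R) `^ g)); first by rewrite ler_wpM2l// ltW.
apply: le_trans (upper_tail_mono xy).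
have jg0 : 0 < j.+1%:R `^ g :> R by rewrite powR_gt0.
rewrite -(ler_pM2l jg0); apply: le_trans A1.
have -> : j.+1%:R `^ g * (b * (y / j%:R) `^ g) = ((j.+1%:R / j%:R) `^ g * b) * y `^ g.
  rewrite mulrCA -powRM ?divr_ge0 ?ltW//.
  have -> : j.+1%:R * (y / j%:R) = (j.+1%:R / j%:R) * y by ring.
  by rewrite powRM ?divr_ge0 ?ltW//; ring.
by rewrite ler_pM2r.
Unshelve. all: by end_near. Qed.

Let lnratio_lim : (ln (2 * r) / ln (2 / r)) `^ g @[r --> 1^'+] --> (1 : R).
Proof.
have e1 : (1:R) = 1 `^ g by rewrite powR1.
have l2 : ln 2 != 0 :> R by rewrite gt_eqF// ln_gt0// ltr1n.
have step : ln (2 * r) / ln (2 / r) @[r --> (1:R)] --> (1 : R).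
  rewrite -[X in _ --> X](divff l2).
  apply: cvgM.
    rewrite -{2}(mulr1 2); apply: continuous_cvg; first by apply: continuous_ln; rewrite mulr1.
    by apply: cvgMr; exact: cvg_id.
  apply: cvgV => //.
  rewrite -{2}(divr1 2); apply: continuous_cvg; first by apply: continuous_ln; rewrite divr1.
  by apply: cvgMr; apply: cvgV => //; exact: cvg_id.
rewrite [X in _ --> X]e1; apply: cvg_at_right_filter.
by apply: (cvg_comp _ (fun x : R => x `^ g) step); exact: continuous_powR.
Qed.

(** Karamata's argument: the moments of [V ^+ j], rescaled, converge to
    those of a Gamma-type measure, hence so do the integrals of the polynomials
    [step_poly]. These approximate the indicator that defines the tail up to a
    factor [r] in the threshold, and [r] tends to 1 at the end. *)
Theorem karamata : x `^ (- g) * upper_tail x @[x --> 0^'+] --> L / Gamma (g + 1).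
Proof.
have powdiv (x y : R) : 0 < x -> 0 < y -> x `^ g / y `^ g = (x / y) `^ g.
  move=> x0 y0; rewrite powRM ?invr_ge0 ?ltW//; congr (_ * _).
  by rewrite powRVl // ltW.
have l1 : c * (ln (2 * r) / ln (2 / r)) `^ g @[r --> 1^'+] --> c * 1.
  by apply: cvgMr; exact: lnratio_lim.
have l2 : c * ((ln (2 * r) / ln (2 / r)) `^ g)^-1 @[r --> 1^'+] --> c * 1^-1.
  by apply: cvgMr; apply: cvgV; [exact: oner_neq0|exact: lnratio_lim].
rewrite mulr1 in l1; rewrite invr1 mulr1 in l2.
apply/cvgrPdist_le => e e0; rewrite -/c.
have ce : c < c + e by rewrite ltrDl.
have ce' : c - e < c by rewrite ltrBlDr ltrDl.
have [r [r1 r2 u1 u2]] : exists r, [/\ 1 < r, r < 2,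
    c * (ln (2 * r) / ln (2 / r)) `^ g < c + e & c - e < c * ((ln (2 * r) / ln (2 / r)) `^ g)^-1].
  near ((1:R)^'+) => r; exists r; split; near: r.
  - exact: nbhs_right_gt.
  - by apply: nbhs_right_lt; rewrite ltr1n.
  - by apply: cvgr_lt ce; exact: l1.
  - by apply: cvgr_gt ce'; exact: l2.
have r0 : 0 < r by exact: lt_trans r1.
have y0 : 0 < ln (2 / r) by rewrite ln_gt0// ltr_pdivlMr// mul1r.
have y0' : 0 < ln (2 * r) by rewrite ln_gt0//; lra.
have U : \forall x \near 0^'+, x `^ (- g) * upper_tail x <= c + e.
  by apply: (@upper_x r) => //; rewrite -mulrA powdiv.
have Lo : \forall x \near 0^'+, c - e <= x `^ (- g) * upper_tail x.
  have [ce0|ce0] := leP (c - e) 0.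
    by near=> x; apply: (le_trans ce0); rewrite mulr_ge0 ?powR_ge0 ?upper_tail_ge0.
  apply: (@lower_x r) => //; rewrite -mulrA powdiv//.
  have -> : ln (2 / r) / ln (2 * r) = (ln (2 * r) / ln (2 / r))^-1 by rewrite invf_div.
  by rewrite powRVl // divr_ge0 // ltW.
near=> x.
have Ux : x `^ (- g) * upper_tail x <= c + e by near: x; exact: U.
have Lx : c - e <= x `^ (- g) * upper_tail x by near: x; exact: Lo.
rewrite ler_norml; lra.
Unshelve. all: by end_near. Qed.

End karamata.

(** * An Abelian theorem *)

Section abelian.
Context dT {T : measurableType dT} {R : realType} (mu : probability T R).
Variables (D : set T) (r : T -> R) (al a : R).
Hypothesis mD : measurable D.
Hypothesis mr : measurable_fun setT r.
Hypothesis r01 : forall x, D x -> 0 <= r x <= 1.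
Hypothesis al0 : 0 <= al.
Local Notation leb := (@lebesgue_measure R).
Local Notation tail := (upper_tail mu D r).
Local Notation mom := (power_moment mu D r).

(** [q ^+ j] as the integral of the exponential density of rate [j] beyond
    [- ln q]. *)
Lemma power_layer (j : nat) (q : R) : (0 < j)%N -> 0 <= q <= 1 ->
  (\int[leb]_(y in `]0%R, +oo[) (j%:R * expR (- (j%:R * y)) * (expR (- y) <= q)%R%:R)%:E
   = (q ^+ j)%:E)%E.
Proof.
move=> j0 /andP[q0 q1].
have jp : 0 < j%:R :> R by rewrite ltr0n.
move: q0; rewrite le_eqVlt => /predU1P[<-|q0].
  rewrite expr0n -[j == 0%N]negbK -lt0n j0/= integral0_eq// => y _.
  by rewrite leNgt expR_gt0/= mulr0.
set b := - ln q; have b0 : 0 <= b by rewrite oppr_ge0 ln_le0.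
have qE : q = expR (- b) by rewrite /b opprK lnK.
have cmp y : (expR (- y) <= q) = (b <= y) by rewrite qE ler_expR lerN2.
have cE : continuous (fun y : R => j%:R * expR (- (j%:R * y))).
  move=> y; apply: cvgMr; apply: continuous_comp; last exact: continuous_expR.
  by apply: continuousN; exact: mulrl_continuous.
transitivity (\int[leb]_(y in `[b, +oo[) (j%:R * expR (- (j%:R * y)))%:E)%E.
  have -> : (\int[leb]_(y in `[b, +oo[) (j%:R * expR (- (j%:R * y)))%:E =
     \int[leb]_(y in `]b, +oo[) (j%:R * expR (- (j%:R * y)))%:E)%E.
    rewrite integral_itv_obnd_cbnd//; apply/measurable_EFinP; apply: measurable_funTS.
    exact: continuous_measurable_fun.
  have sub : (`]b, +oo[%classic : set R) `<=` `]0, +oo[%classic.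
    by move=> y/=; rewrite !in_itv/= !andbT; exact: le_lt_trans.
  have mB : measurable_fun (`]0, +oo[%classic : set R)
      (fun y : R => (j%:R * expR (- (j%:R * y)) * (expR (- y) <= q)%R%:R)%:E).
    apply/measurable_EFinP; apply: measurable_funM.
      by apply: measurable_funTS; exact: continuous_measurable_fun.
    rewrite (_ : (fun x => _) = (fun x : R => if expR (- x) <= q then 1 else 0)); last first.
      by apply/funext => x; case: ifP.
    apply: measurable_fun_if => //; apply: measurable_fun_ler => //.
    by apply: measurableT_comp => //; exact: measurable_expR.
  move: b0; rewrite le_eqVlt => /predU1P[b0|b0].
    rewrite -b0; apply: eq_integral => y; rewrite inE/= in_itv/= andbT => y0.
    by rewrite cmp -b0 ltW// mulr1.
  rewrite (integral_gt0_split b0)//.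
  rewrite [X in (X + _)%E](_ : _ = 0%E) ?add0e.
    apply: eq_integral => y; rewrite inE/= in_itv/= andbT => y0.
    by rewrite cmp ltW// mulr1.
  have mb : measurable_fun (`]0, b]%classic : set R)
      (fun y : R => (j%:R * expR (- (j%:R * y)) * (expR (- y) <= q)%R%:R)%:E).
    by apply: measurable_funS mB => // y/=; rewrite !in_itv/= andbT => /andP[].
  apply: (@eq_trans _ _ (\int[leb]_(y in `]0%R, b[) (j%:R * expR (- (j%:R * y)) * (expR (- y) <= q)%R%:R)%:E)%E).
    rewrite -integral_itv_bndo_bndc//.
    by apply: measurable_funS mb => // y/=; rewrite !in_itv/= => /andP[-> /ltW].
  rewrite integral0_eq// => y/=; rewrite in_itv/= => /andP[_ yb].
  by rewrite cmp leNgt yb mulr0.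
have dE (y : R) : is_derive y 1 (fun y : R => - expR (- (j%:R * y))) (j%:R * expR (- (j%:R * y))).
  by apply: is_derive_eq; rewrite /GRing.scale/=; ring.
rewrite (@ge0_continuous_FTC2y _ _ (fun y => - expR (- (j%:R * y))) b 0)//.
- rewrite -EFinB sub0r opprK; congr EFin.
  have -> : q ^+ j = expR (- b) ^+ j by rewrite -qE.
  by rewrite -(expRM_natl j (- b)) [in RHS]mulrN.
- by apply: continuous_in_subspaceT => y _; exact: cE.
- rewrite -oppr0; apply: cvgN.
  apply: (cvg_comp _ (fun z : R => expR (- z)) _ (@cvgr_expR R)).
  by apply: gt0_cvgMry => //; exact: cvg_id.
- by apply: cvg_at_right_filter; exact: (is_derive_continuous (dE b)).
- by move=> y _; rewrite derive1E; have [_ ->] := dE y.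
Qed.

Lemma integrable_tail y : mu.-integrable D (EFin \o (fun x => (expR (- y) <= r x)%R%:R)).
Proof.
apply: measurable_bounded_integrable => //.
- by rewrite (le_lt_trans (probability_le1 _ _))// ltry.
- rewrite (_ : (fun x => _) = (fun x => if expR (- y) <= r x then 1 else 0)); last first.
    by apply/funext => x; case: ifP.
  by apply: measurable_fun_if => //; apply: measurable_fun_ler => //; apply: measurable_funTS.
- exists 1; split => // N N1 x _ /=; apply: le_trans (ltW N1).
  by rewrite normr_nat lern1 leq_b1.
Qed.

Lemma integral_tail y : (\int[mu]_(x in D) ((expR (- y) <= r x)%R%:R)%:E = (tail y)%:E)%E.
Proof.
have := integrable_tail y.
by move=> /integrable_fin_num H; rewrite /upper_tail /Rintegral fineK//; exact: H.
Qed.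

Lemma integral_moment j : (\int[mu]_(x in D) (r x ^+ j)%:E = (mom j)%:E)%E.
Proof.
have : mu.-integrable D (EFin \o (fun x => r x ^+ j)).
  apply: measurable_bounded_integrable => //.
  - by rewrite (le_lt_trans (probability_le1 _ _))// ltry.
  - by apply: measurable_funX; apply: measurable_funTS.
  - exists 1; split => // N N1 x Dx /=; apply: le_trans (ltW N1).
    have /andP[x0 x1] := r01 Dx.
    by rewrite ger0_norm ?exprn_ge0// exprn_ile1.
by move=> /integrable_fin_num H; rewrite /power_moment /Rintegral fineK//; exact: H.
Qed.

(** Tonelli's theorem after [power_layer]. *)
Lemma moment_tail (j : nat) : (0 < j)%N ->
  ((mom j)%:E = \int[leb]_(y in `]0%R, +oo[) (j%:R * expR (- (j%:R * y)) * tail y)%:E)%E.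
Proof.
move=> j0.
pose h (z : T * R) : R := \1_D z.1 * \1_(`]0, +oo[%classic : set R) z.2 *
  (j%:R * expR (- (j%:R * z.2))) * (expR (- z.2) <= r z.1)%R%:R.
have m1 : measurable_fun [set: T * R] (fun z => r z.1).
  by apply: (measurableT_comp mr); exact: measurable_fst.
have mexp (c : R) : measurable_fun [set: T * R] (fun z => expR (- (c * z.2))).
  have cc : continuous (fun y : R => expR (- (c * y))).
    move=> y; apply: continuous_comp; last exact: continuous_expR.
    by apply: continuousN; exact: mulrl_continuous.
  exact: (measurableT_comp (continuous_measurable_fun cc) measurable_snd).
have mh : measurable_fun setT (fun z => (h z)%:E).
  apply/measurable_EFinP; rewrite /h; apply: measurable_funM.
    apply: measurable_funM; last by apply: measurable_funM.
    apply: measurable_funM.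
      by apply: (measurableT_comp (measurable_indic mD)); exact: measurable_fst.
    by apply: (measurableT_comp (measurable_indic (measurable_itv `]0, +oo[))); exact: measurable_snd.
  rewrite (_ : (fun x => _) = (fun z : T * R => if expR (- (1 * z.2)) <= r z.1 then 1 else 0)); last first.
    by apply/funext => z; rewrite mul1r; case: ifP.
  by apply: measurable_fun_if => //; apply: measurable_fun_ler.
have h0 z : (0 <= (h z)%:E)%E.
  by rewrite lee_fin /h !mulr_ge0 ?expR_ge0 ?ler0n.
have := @fubini_tonelli _ _ T (measurableTypeR R) R mu leb (fun z => (h z)%:E) mh h0.
have -> : (\int[mu]_x fubini_F leb (fun z => (h z)%:E) x = (mom j)%:E)%E.
  rewrite -integral_moment [RHS]integral_mkcond; apply: eq_integral => x _.
  rewrite patchE /fubini_F /h/=; case: ifPn => xD.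
    rewrite inE in xD; rewrite -(power_layer j0 (r01 xD)) [RHS]integral_mkcond.
    apply: eq_integral => y _; rewrite patchE !indicE (mem_set xD) mul1r.
    by case: ifPn => // _; rewrite ?mul1r ?mul0r.
  by rewrite integral0_eq// => y _; rewrite indicE (negbTE xD) !mul0r.
move=> ->; rewrite [RHS]integral_mkcond; apply: eq_integral => y _.
rewrite patchE /fubini_G /h/=; case: ifPn => yD.
  rewrite EFinM -integral_tail -ge0_integralZl//; last first.
  - apply/measurable_EFinP.
    rewrite (_ : (fun x => _) = (fun x => if expR (- y) <= r x then 1 else 0)); last first.
      by apply/funext => x; case: ifP.
    by apply: measurable_fun_if => //; apply: measurable_fun_ler => //; apply: measurable_funTS.
  rewrite [RHS]integral_mkcond; apply: eq_integral => x _.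
  rewrite patchE !indicE yD mulr1.
  by case: ifPn => // _; rewrite ?mul1r ?mul0r// -EFinM.
by rewrite integral0_eq// => x _; rewrite !indicE (negbTE yD) mulr0 !mul0r.
Qed.

Hypothesis tail_lim : y `^ (- al) * tail y @[y --> 0^'+] --> a.

Let tail_le1 y : tail y <= 1.
Proof.
rewrite -lee_fin -integral_tail; apply: (@le_trans _ _ (\int[mu]_(x in D) 1)%E).
  apply: ge0_le_integral => //.
  - apply/measurable_EFinP.
    rewrite (_ : (fun x => _) = (fun x => if expR (- y) <= r x then 1 else 0)); last first.
      by apply/funext => x; case: ifP.
    by apply: measurable_fun_if => //; apply: measurable_fun_ler => //; apply: measurable_funTS.
  - by move=> x _; rewrite lee_fin lern1 leq_b1.
by rewrite integral_cst// mul1e probability_le1.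
Qed.

Let tail_ge0 y : 0 <= tail y.
Proof. exact: upper_tail_ge0. Qed.

Let a_ge0 : 0 <= a.
Proof.
apply: (ler_cvg_to (cvg_cst 0) tail_lim); near=> y.
by rewrite mulr_ge0 ?powR_ge0.
Unshelve. all: by end_near. Qed.

Let I (l : R) : 0 < l -> (\int[leb]_(y in `]0%R, +oo[) (y `^ al * expR (- (l * y)))%:E =
  (l `^ (- (al + 1)) * Gamma (al + 1))%:E)%E.
Proof.
move=> l0; rewrite -Gamma_scale//; last by rewrite ltr_wpDl.
by under [RHS]eq_integral do rewrite addrK.
Qed.

(** A bound valid for all [y] with a single form of error: the last term
    exceeds 1 beyond [de], and is killed by the kernel [exp (- j y)], against
    which it integrates to something exponentially small in [j]. *)
Let bound e : 0 < e -> exists de K, [/\ 0 < de, 0 <= K &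
  forall (j y : R), 0 < j -> 0 < y ->
   tail y <= (a + e) * y `^ al + K * (y `^ al * expR (2^-1 * j * (y - de))) /\
   a * y `^ al <= tail y + e * y `^ al + K * (y `^ al * expR (2^-1 * j * (y - de)))].
Proof.
move=> e0; move/cvgrPdist_le : tail_lim => /(_ e e0) [de /= de0 H].
pose d2 := de / 2; have d20 : 0 < d2 by rewrite divr_gt0.
exists d2, (d2 `^ (- al) + a); split => //; first by rewrite addr_ge0 ?powR_ge0.
move=> j y j0 y0; have ya : 0 < y `^ al by rewrite powR_gt0.
set x := expR _; have x0 : 0 <= x by exact: expR_ge0.
have [yd|yd] := leP y d2.
  have : `|a - y `^ (- al) * tail y| <= e.
    apply: H => //=; rewrite sub0r normrN gtr0_norm// (le_lt_trans yd)// /d2.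
    by rewrite ltr_pdivrMr// ltr_pMr// ltr1n.
  rewrite ler_norml powRN mulrC => /andP[L U].
  have K0 : 0 <= (d2 `^ (- al) + a) * (y `^ al * x).
    by rewrite !mulr_ge0 ?addr_ge0 ?powR_ge0.
  have E : tail y = (tail y / y `^ al) * y `^ al by rewrite divfK// gt_eqF.
  have L' : tail y / y `^ al <= a + e by lra.
  have U' : a <= tail y / y `^ al + e by lra.
  have := ler_wpM2r (ltW ya) L'; have := ler_wpM2r (ltW ya) U'.
  rewrite -E mulrDl -E => U2 L2; split; lra.
have x1 : 1 <= x.
  by rewrite /x -expR0 ler_expR !mulr_ge0 ?invr_ge0 ?(ltW j0)// subr_ge0 ltW.
have dy : d2 `^ (- al) * y `^ al >= 1.
  rewrite powRN mulrC ler_pdivlMr ?powR_gt0// mul1r ge0_ler_powR ?nnegrE// ltW//.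
have K1 : 1 + a * y `^ al <= (d2 `^ (- al) + a) * (y `^ al * x).
  apply: (@le_trans _ _ ((d2 `^ (- al) + a) * (y `^ al * 1))).
    rewrite mulr1 mulrDl; lra.
  rewrite ler_wpM2l ?addr_ge0 ?powR_ge0// ler_wpM2l ?powR_ge0//.
have t1 := tail_le1 y; have t0 := tail_ge0 y.
have ay : 0 <= a * y `^ al by rewrite mulr_ge0// ltW.
have ey : 0 <= e * y `^ al by rewrite mulr_ge0// ltW.
split; lra.
Qed.

(** The tail is replaced by [a * y ^ al] in [moment_tail]; the kernel
    concentrates at [y] of order [1 / j]. *)
Theorem abelian : j%:R `^ al * mom j @[j --> \oo] --> a * Gamma (al + 1).
Proof.
have G0 : 0 < Gamma (al + 1) by apply: Gamma_gt0; rewrite ltr_wpDl.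
set G := Gamma (al + 1) in G0 *.
have key e : 0 < e -> exists de K, 0 < de /\ forall j : nat, (0 < j)%N ->
    `|a * G - j%:R `^ al * mom j| <= G * e + G * (K * 2 `^ (al + 1)) * expR (- (2^-1 * de * j%:R)).
  move=> e0; have [de [K [de0 K0 H]]] := bound e0.
  exists de, K; split => // j j0; have jp : 0 < j%:R :> R by rewrite ltr0n.
  pose W (y : R) := j%:R * expR (- (j%:R * y)).
  have W0 y : 0 <= W y by rewrite mulr_ge0 ?expR_ge0.
  have mgam (l : R) := @measurable_gamma R al l _ (@subset_refl _ _) (measurable_itv `]0, +oo[).
  have l20 : 0 < 2^-1 * j%:R :> R by rewrite mulr_gt0// invr_gt0.
  have I1 : (\int[leb]_(y in `]0%R, +oo[) (W y * y `^ al)%:E = (j%:R `^ (- al) * G)%:E)%E.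
    transitivity (\int[leb]_(y in `]0%R, +oo[) (j%:R%:E * (y `^ al * expR (- (j%:R * y)))%:E))%E.
      by apply: eq_integral => y _; rewrite -EFinM /W; congr EFin; ring.
    rewrite ge0_integralZl//; last 2 first.
    - by apply: mgam.
    - by move=> y _; rewrite lee_fin mulr_ge0 ?powR_ge0 ?expR_ge0.
    rewrite I// -EFinM; congr EFin; rewrite mulrA; congr (_ * _).
    rewrite opprD powRD ?(gt_eqF jp) ?implybT// powR_inv1 ?ler0n//.
    by field; rewrite gt_eqF.
  have I2 : (\int[leb]_(y in `]0%R, +oo[) (W y * (y `^ al * expR (2^-1 * j%:R * (y - de))))%:E
      = (j%:R `^ (- al) * G * (2 `^ (al + 1) * expR (- (2^-1 * de * j%:R))))%:E)%E.
    transitivity (\int[leb]_(y in `]0%R, +oo[) ((j%:R * expR (- (2^-1 * de * j%:R)))%:E *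
        (y `^ al * expR (- (2^-1 * j%:R * y)))%:E))%E.
      apply: eq_integral => y _; rewrite -EFinM /W; congr EFin.
      have -> : - (j%:R * y) = - (2^-1 * j%:R * y) + - (2^-1 * j%:R * y) :> R by field.
      have -> : 2^-1 * j%:R * (y - de) = (2^-1 * j%:R * y) + - (2^-1 * de * j%:R) by ring.
      rewrite !expRD; have := expRxMexpNx_1 (2^-1 * j%:R * y).
      set A := expR (2^-1 * j%:R * y); set A' := expR (- _); set C := expR _ => AA.
      have -> : j%:R * (A' * A') * (y `^ al * (A * C)) = (j%:R * C * (y `^ al * A')) * (A * A') by ring.
      by rewrite AA mulr1.
    rewrite ge0_integralZl//; last 2 first.
    - by apply: mgam.
    - by move=> y _; rewrite lee_fin mulr_ge0 ?powR_ge0 ?expR_ge0.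
    rewrite I// -EFinM -/G; congr EFin.
    have h2 : 0 <= 2^-1 :> R by rewrite invr_ge0.
    rewrite powRN (powRM _ h2 (ler0n R j)) (powRVl _ (ler0n R 2)).
    rewrite (powRD (x := j%:R)) ?(gt_eqF jp) ?implybT// powRr1 ?ler0n// powRN.
    have q0 : 2 `^ (al + 1) != 0 :> R by rewrite gt_eqF// powR_gt0.
    have J0 : j%:R `^ al != 0 :> R by rewrite gt_eqF// powR_gt0.
    by field; rewrite q0 J0 gt_eqF.
  have mg1 : measurable_fun (`]0, +oo[%classic : set R) (fun y => (W y * y `^ al)%:E).
    rewrite (_ : (fun y => _) = (fun y => (j%:R%:E * (y `^ al * expR (- (j%:R * y)))%:E)%E)); last first.
      by apply/funext => y; rewrite -EFinM /W; congr EFin; ring.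
    by apply: measurable_funeM; apply: mgam.
  have cW : continuous (fun y : R => W y).
    move=> y; apply: cvgMr; apply: continuous_comp; last exact: continuous_expR.
    by apply: continuousN; exact: mulrl_continuous.
  have cX : continuous (fun y : R => expR (2^-1 * j%:R * (y - de))).
    move=> y; apply: continuous_comp; last exact: continuous_expR.
    apply: cvgMr; apply: cvgB; [exact: cvg_id|exact: cvg_cst].
  have mg2 : measurable_fun (`]0, +oo[%classic : set R)
      (fun y => (W y * (y `^ al * expR (2^-1 * j%:R * (y - de))))%:E).
    apply/measurable_EFinP; apply: measurable_funM.
      by apply: measurable_funTS; exact: continuous_measurable_fun.
    apply: measurable_funM; first by apply/measurable_EFinP; exact: measurable_powR_gt0.
    by apply: measurable_funTS; exact: continuous_measurable_fun.
  have mt : measurable_fun (`]0, +oo[%classic : set R) (fun y => (W y * tail y)%:E).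
    apply/measurable_EFinP; apply: measurable_funM.
      by apply: measurable_funTS; exact: continuous_measurable_fun.
    apply: nondecreasing_measurable => // y z yz.
    apply: le_Rintegral => //; [exact: integrable_tail|exact: integrable_tail|].
    move=> x _; rewrite ler_nat; case: (boolP (expR (- y) <= r x)) => // Hy.
    by rewrite (le_trans _ Hy)// ler_expR lerN2.
  have p1 y : 0 <= W y * y `^ al by rewrite mulr_ge0 ?powR_ge0.
  have p2 y : 0 <= W y * (y `^ al * expR (2^-1 * j%:R * (y - de))).
    by rewrite mulr_ge0 ?mulr_ge0 ?powR_ge0 ?expR_ge0.
  have p3 y : 0 <= W y * tail y by rewrite mulr_ge0.
  have lin2 (f h : R -> R) (F H' c c' : R) : 0 <= c -> 0 <= c' ->
     (forall y, 0 <= f y) -> (forall y, 0 <= h y) ->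
     measurable_fun (`]0, +oo[%classic : set R) (fun y => (f y)%:E) ->
     measurable_fun (`]0, +oo[%classic : set R) (fun y => (h y)%:E) ->
     (\int[leb]_(y in `]0%R, +oo[) (f y)%:E = F%:E)%E ->
     (\int[leb]_(y in `]0%R, +oo[) (h y)%:E = H'%:E)%E ->
     (\int[leb]_(y in `]0%R, +oo[) (c * f y + c' * h y)%:E = (c * F + c' * H')%:E)%E.
    move=> c0 c'0 f0 h0 mf mh fF hH.
    under eq_integral do rewrite EFinD !EFinM.
    rewrite ge0_integralD//=.
    - by rewrite !ge0_integralZl// ?lee_fin// ?fF ?hH => *; rewrite ?lee_fin.
    - by move=> y _; rewrite mule_ge0 ?lee_fin.
    - exact: measurable_funeM.
    - by move=> y _; rewrite mule_ge0 ?lee_fin.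
    - exact: measurable_funeM.
  have ae0 : 0 <= a + e by rewrite addr_ge0// ltW.
  have mlin (f h : R -> R) c c' :
     measurable_fun (`]0, +oo[%classic : set R) (fun y => (f y)%:E) ->
     measurable_fun (`]0, +oo[%classic : set R) (fun y => (h y)%:E) ->
     measurable_fun (`]0, +oo[%classic : set R) (fun y => (c * f y + c' * h y)%:E).
    move=> /measurable_EFinP mf /measurable_EFinP mh; apply/measurable_EFinP.
    by apply: measurable_funD; apply: measurable_funM.
  set Q := 2 `^ (al + 1) * _ in I2.
  have U : mom j <= (a + e) * (j%:R `^ (- al) * G) + K * (j%:R `^ (- al) * G * Q).
    rewrite -lee_fin moment_tail// -(lin2 _ _ _ _ _ _ ae0 K0 p1 p2 mg1 mg2 I1 I2).
    apply: ge0_le_integral => //.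
    - by move=> y _; rewrite lee_fin; exact: p3.
    - exact: mlin.
    move=> y /=; rewrite in_itv/= andbT => y0; rewrite lee_fin.
    have [H1 _] := H j%:R y jp y0.
    apply: (le_trans (ler_wpM2l (W0 y) H1)); rewrite le_eqVlt; apply/orP; left; apply/eqP; ring.
  have L : a * (j%:R `^ (- al) * G) <= mom j + (e * (j%:R `^ (- al) * G) + K * (j%:R `^ (- al) * G * Q)).
    have I3 := lin2 _ _ _ _ _ _ (ltW e0) K0 p1 p2 mg1 mg2 I1 I2.
    have p4 y : 0 <= e * (W y * y `^ al) + K * (W y * (y `^ al * expR (2^-1 * j%:R * (y - de)))).
      by rewrite addr_ge0// mulr_ge0// ltW.
    have I4 := lin2 _ _ _ _ _ _ ler01 ler01 p3 p4 mt (mlin _ _ e K mg1 mg2) (esym (moment_tail j0)) I3.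
    have I5 := lin2 _ _ _ _ _ _ a_ge0 (lexx 0) p1 p1 mg1 mg1 I1 I1.
    rewrite mul0r addr0 in I5; rewrite !mul1r in I4.
    rewrite -lee_fin -I5 -I4; apply: ge0_le_integral => //.
    - by move=> y _; rewrite lee_fin mul0r addr0 mulr_ge0.
    - exact: mlin.
    - by apply: (mlin _ _ 1 1) => //; exact: mlin.
    move=> y /=; rewrite in_itv/= andbT => y0; rewrite lee_fin.
    have [_ H2] := H j%:R y jp y0.
    rewrite mul0r addr0 !mul1r; have := ler_wpM2l (W0 y) H2.
    move=> H3; apply: le_trans (le_trans H3 _); rewrite le_eqVlt; apply/orP; left; apply/eqP; ring.
  have jal : 0 < j%:R `^ al :> R by rewrite powR_gt0.
  have U' := ler_wpM2l (ltW jal) U; have L' := ler_wpM2l (ltW jal) L.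
  have jj : j%:R `^ al * j%:R `^ (- al) = 1 :> R by rewrite powRN divff// gt_eqF.
  set J := j%:R `^ al in U' L' jj *; set J' := j%:R `^ (- al) in U' L' jj.
  have E1 c : J * (c * (J' * G)) = c * G * (J * J') by ring.
  have E2 : J * (K * (J' * G * Q)) = K * G * Q * (J * J') by ring.
  rewrite mulrDr E1 E2 jj !mulr1 in U'.
  rewrite !mulrDr !E1 E2 jj !mulr1 in L'.
  have -> : G * (K * 2 `^ (al + 1)) * expR (- (2^-1 * de * j%:R)) = K * G * Q by rewrite /Q; ring.
  by rewrite ler_norml; lra.
apply/cvgrPdist_le => e e0.
have e20 : 0 < e / (2 * G) by rewrite divr_gt0// mulr_gt0.
have [de [K [de0 H]]] := key _ e20.
have lim0 : G * (K * 2 `^ (al + 1)) * expR (- (2^-1 * de * j%:R)) @[j --> \oo] --> (0 : R).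
  rewrite -[X in _ --> X](mulr0 (G * (K * 2 `^ (al + 1)))); apply: cvgMr.
  apply: (cvg_comp _ (fun z : R => expR (- z)) _ (@cvgr_expR R)).
  have c0 : 0 < 2^-1 * de by rewrite mulr_gt0// invr_gt0.
  exact: (cvg_comp _ (fun z : R => 2^-1 * de * z) (@cvgr_idn R) (gt0_cvgMry c0 cvg_id)).
have e2 : 0 < e / 2 by rewrite divr_gt0.
near=> j.
have j0 : (0 < j)%N by near: j; exists 1%N.
apply: (le_trans (H j j0)).
have -> : G * (e / (2 * G)) = e / 2 by field; rewrite gt_eqF.
have : G * (K * 2 `^ (al + 1)) * expR (- (2^-1 * de * j%:R)) <= e / 2.
  by near: j; apply: cvgr_le e2; exact: lim0.
lra.
Unshelve. all: by end_near. Qed.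
End abelian.

(** * The probability that a random vertex set spans no edge *)

Section edgeless.
Context {R : realType} (I : finType) (e : rel I) (rho : I -> R) (tau : R).
Variable pr : ({set I} -> bool) -> R.
Hypothesis e_sym : symmetric e.
Hypothesis e_irr : irreflexive e.
Hypothesis rho_ge0 : forall i, 0 <= rho i.
Hypothesis deg_le : forall v, \sum_(u | e v u) rho u <= tau.
Hypothesis tau_le : tau <= 3^-1.
Hypothesis pr_ge0 : forall g, 0 <= pr g.
Hypothesis pr_split : forall g h, pr g = pr (fun S => g S && h S) + pr (fun S => g S && ~~ h S).
Hypothesis pr_void : forall U : {set I},
  pr (fun S => S :&: U == finset.set0) = expR (- \sum_(i in U) rho i).

Implicit Types (U V W N S T : {set I}).

Let disjP U V : reflect (forall x, x \in U -> x \notin V) [disjoint U & V]%B.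
Proof. by rewrite disjoint_subset; apply: (iffP fintype.subsetP). Qed.

Let eq_pr (g h : {set I} -> bool) : g =1 h -> pr g = pr h.
Proof. by move/funext ->. Qed.

Let pr_le (g h : {set I} -> bool) : (forall S, g S -> h S) -> pr g <= pr h.
Proof.
move=> gh; rewrite [leRHS](pr_split h g) (@eq_pr g (fun S => h S && g S)).
  by rewrite lerDl.
by move=> S; case: (boolP (g S)) => [/gh ->//|_]; rewrite andbF.
Qed.

Let pr_true : pr xpredT = 1.
Proof.
have := pr_void finset.set0; rewrite big_set0 oppr0 expR0 => <-.
by apply: eq_pr => S; rewrite finset.setI0 eqxx.
Qed.

Let pr_false : pr xpred0 = 0.
Proof.
have := pr_split xpred0 xpred0; rewrite (@eq_pr _ xpred0)// => H.
by apply/eqP; rewrite -(inj_eq (addrI (pr xpred0))) -H addr0.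
Qed.

Let voidU1 v U S : (S :&: (v |: U) == finset.set0) = (v \notin S) && (S :&: U == finset.set0).
Proof.
rewrite finset.setIUr finset.setU_eq0; congr (_ && _).
apply/eqP/idP => [H|vS].
  by apply/negP => vS; have := finset.in_set0 v; rewrite -H !inE vS eqxx.
by apply/setP => x; rewrite !inE; apply/negP => /andP[xS /eqP xv]; rewrite -xv xS in vS.
Qed.

Let sum_setU1 v U : v \notin U -> \sum_(i in v |: U) rho i = rho v + \sum_(i in U) rho i.
Proof. by move=> vU; rewrite big_setU1. Qed.

(** Independence of the configurations in disjoint sets, recovered from
    the void probabilities alone by induction on the second set: adding a
    vertex to it splits the event according to the occupation of that
    vertex. *)
Let indep V : forall U (g : {set I} -> bool), [disjoint U & V]%B ->
  pr (fun S => (S :&: U == finset.set0) && g (S :&: V)) =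
  expR (- \sum_(i in U) rho i) * pr (fun S => g (S :&: V)).
Proof.
have [n] := ubnP #|V|; elim: n V => // n IH V; rewrite ltnS => Vn U g dUV.
have [V0|[v vV]] := set_0Vmem V.
  rewrite V0; case: (boolP (g finset.set0)) => g0.
    rewrite (@eq_pr (fun S => g (S :&: finset.set0)) xpredT); last first.
      by move=> S; rewrite finset.setI0 g0.
    rewrite pr_true mulr1 -pr_void; apply: eq_pr => S.
    by rewrite finset.setI0 g0 andbT.
  rewrite (@eq_pr (fun S => g (S :&: finset.set0)) xpred0); last first.
    by move=> S; rewrite finset.setI0 (negbTE g0).
  rewrite pr_false mulr0 -[RHS]pr_false; apply: eq_pr => S.
  by rewrite finset.setI0 (negbTE g0) andbF.
pose V' := V :\ v; have VE : V = v |: V' by rewrite finset.setD1K.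
have vV' : v \notin V' by rewrite !inE eqxx.
have V'n : (#|V'| < n)%N by move: Vn; rewrite (cardsD1 v) vV.
pose A := pr (fun S => g (S :&: V')).
pose A' := pr (fun S => g (v |: (S :&: V'))).
suff key W : [disjoint W & V]%B ->
    pr (fun S => (S :&: W == finset.set0) && g (S :&: V)) =
    expR (- \sum_(i in W) rho i) * (expR (- rho v) * A + A' - expR (- rho v) * A').
  rewrite key//; congr (_ * _); have := key finset.set0.
  rewrite big_set0 oppr0 expR0 mul1r => <-; last first.
    by rewrite -finset.setI_eq0 finset.set0I.
  by apply: eq_pr => S; rewrite finset.setI0 eqxx.
move=> dWV.
have vW : v \notin W.
  by apply/negP => vW; move/disjP : dWV => /(_ v vW); rewrite vV.
have dWV' : [disjoint W & V']%B.
  by apply: disjointWr dWV; rewrite VE finset.subsetUr.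
have dvWV' : [disjoint v |: W & V']%B.
  apply/disjP => x; rewrite !inE => /orP[/eqP ->|]; first by rewrite eqxx.
  by move=> xW; move/disjP : dWV' => /(_ x xW); rewrite !inE.
rewrite (pr_split _ (fun S => v \notin S)).
have E1 : pr (fun S => [&& S :&: W == finset.set0, g (S :&: V) & v \notin S]) =
    expR (- \sum_(i in v |: W) rho i) * A.
  rewrite -(IH V' V'n _ g dvWV'); apply: eq_pr => S.
  rewrite voidU1; case: (boolP (v \in S)) => vS; rewrite ?andbF ?andbT//=.
  congr (_ && g _); apply/setP => x; rewrite !inE.
  by case: eqVneq => //= -> ; rewrite (negbTE vS).
have E2 : pr (fun S => (S :&: W == finset.set0) && g (S :&: V) && ~~ (v \notin S)) =
    expR (- \sum_(i in W) rho i) * A' - expR (- \sum_(i in v |: W) rho i) * A'.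
  have H1 := IH V' V'n _ (fun T => g (v |: T)) dWV'.
  have H2 := IH V' V'n _ (fun T => g (v |: T)) dvWV'.
  rewrite /A' -H1 -H2; apply/eqP; rewrite eq_sym subr_eq; apply/eqP.
  rewrite (pr_split (fun S => (S :&: W == finset.set0) && g (v |: (S :&: V'))) (fun S => v \in S)).
  congr (_ + _); apply: eq_pr => S.
    rewrite negbK; case: (boolP (v \in S)) => vS; rewrite ?andbF ?andbT//=.
    congr (_ && g _); apply/setP => x; rewrite !inE.
    by case: eqVneq => //= ->; rewrite vS vV.
  by rewrite voidU1; case: (v \in S); rewrite ?andbF ?andbT.
under eq_pr do rewrite -andbA.
rewrite [X in X + _]E1 E2 sum_setU1// opprD expRD; ring.
Qed.

Definition edgeless T := [forall i in T, forall j in T, ~~ e i j].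
Definition edgeless_prob V := pr (fun S => edgeless (S :&: V)).
Let q U := expR (- \sum_(i in U) rho i).
Definition nbr v V := [set u in V | e v u].

Let edgeless_prob_ge0 V : 0 <= edgeless_prob V. Proof. exact: pr_ge0. Qed.

Let edgeless_sub T T' : T \subset T' -> edgeless T' -> edgeless T.
Proof.
move=> /fintype.subsetP TT' /forallP H; apply/forallP => i; apply/implyP => /TT' iT'.
move: (H i); rewrite iT'/= => /forallP Hi; apply/forallP => j; apply/implyP => /TT' jT'.
by move: (Hi j); rewrite jT'.
Qed.

Let edgeless_prob_anti V W : V \subset W -> edgeless_prob W <= edgeless_prob V.
Proof.
move=> VW; apply: pr_le => S; apply: edgeless_sub; exact: finset.setIS.
Qed.

(** If the new vertex is occupied, its neighbours have to be empty and the
    rest independent of them. *)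
Let edgeless_prob_rec v V : v \notin V ->
  edgeless_prob (v |: V) = expR (- rho v) * edgeless_prob V + (1 - expR (- rho v)) * (q (nbr v V) * edgeless_prob (V :\: nbr v V)).
Proof.
move=> vV; rewrite /edgeless_prob (pr_split _ (fun S => v \notin S)).
have E1 : pr (fun S => edgeless (S :&: (v |: V)) && (v \notin S)) = expR (- rho v) * edgeless_prob V.
  have dvV : [disjoint [set v]%SET & V]%B by rewrite disjoints1.
  have := indep (fun T => edgeless T) dvV; rewrite big_set1 => <-.
  apply: eq_pr => S; rewrite -[in RHS](finset.setU0 [set v]%SET) voidU1 finset.setI0 eqxx andbT andbC.
  case: (boolP (v \in S)) => //= vS; congr edgeless; apply/setP => x; rewrite !inE.
  by case: eqVneq => //= ->; rewrite (negbTE vS).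
have key S : v \in S -> edgeless (S :&: (v |: V)) =
    (S :&: nbr v V == finset.set0) && edgeless (S :&: (V :\: nbr v V)).
  move=> vS; apply/idP/idP => [H|/andP[/eqP H1 /forallP H2]].
    apply/andP; split; last first.
      apply: edgeless_sub H; apply: finset.setIS; apply: fintype.subset_trans (finset.subsetDl _ _) _.
      exact: finset.subsetUr.
    apply/eqP/setP => u; rewrite !inE; apply/negP => /and3P[uS uV evu].
    move/forallP : H => /(_ v); rewrite !inE eqxx vS/= => /forallP/(_ u).
    by rewrite !inE uS uV orbT/= evu.
  have nv u : u \in S -> u \in V -> e v u = false.
    move=> uS uV; apply/negP => evu; have := finset.in_set0 u.
    by rewrite -H1 !inE uS uV evu.
  apply/forallP => i; apply/implyP; rewrite !inE => /andP[iS iV].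
  apply/forallP => j; apply/implyP; rewrite !inE => /andP[jS jV].
  case/orP : iV => [/eqP ->|iV].
    by case/orP : jV => [/eqP ->|jV]; rewrite ?e_irr// nv.
  case/orP : jV => [/eqP ->|jV]; first by rewrite e_sym nv.
  move: (H2 i); rewrite !inE iS iV nv//= => /forallP/(_ j).
  by rewrite !inE jS jV nv.
have dN U : v \notin U -> [disjoint v |: nbr v V & V :\: nbr v V]%B.
  move=> _; apply/disjP => x; rewrite !inE => /orP[/eqP ->|/andP[xV evx]].
    by rewrite (negbTE vV) andbF.
  by rewrite xV evx.
have dN' : [disjoint nbr v V & V :\: nbr v V]%B.
  by apply: disjointWl (dN V vV); exact: finset.subsetUr.
have vN : v \notin nbr v V by rewrite !inE (negbTE vV).
have E2 : pr (fun S => edgeless (S :&: (v |: V)) && ~~ (v \notin S)) =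
   (1 - expR (- rho v)) * (q (nbr v V) * edgeless_prob (V :\: nbr v V)).
  have H1 := indep edgeless dN'.
  have H2 := indep edgeless (dN V vV).
  rewrite mulrBl mul1r mulrA /q -expRD -opprD -sum_setU1// /edgeless_prob -H1 -H2.
  apply/eqP; rewrite eq_sym subr_eq; apply/eqP.
  rewrite (pr_split _ (fun S => v \in S)); congr (_ + _); apply: eq_pr => S.
    by rewrite negbK; case: (boolP (v \in S)) => vS; rewrite ?andbF// !andbT key.
  by rewrite voidU1; case: (v \in S); rewrite ?andbF ?andbT.
by rewrite [X in X + _]E1 E2.
Qed.

Definition nbr_sum v V := \sum_(u in nbr v V) rho u.
Let nbr_sum_ge0 v V : 0 <= nbr_sum v V. Proof. exact: sumr_ge0. Qed.
Let nbr_sum_le v V : nbr_sum v V <= tau.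
Proof.
apply: le_trans (deg_le v); rewrite /nbr_sum big_mkcond [leRHS]big_mkcond; apply: ler_sum => u _.
by rewrite !inE; case: (u \in V) => //=; case: ifP.
Qed.
Let tau_ge0 (v : I) : 0 <= tau.
Proof. by apply: le_trans (deg_le v); apply: sumr_ge0. Qed.

Let p_le x : 0 <= x -> 1 - expR (- x) <= x :> R.
Proof. by move=> x0; have := expR_ge1Dx (- x); lra. Qed.
Let p_ge0 (x : R) : 0 <= x -> 0 <= 1 - expR (- x).
Proof. by move=> x0; rewrite subr_ge0 expR_le1 oppr_le0. Qed.

(** The vertex can only do harm if it is occupied while one of its
    neighbours is, which has probability at most [rho v * nbr_sum v V]. *)
Let lower1 v V : v \notin V -> edgeless_prob V * (1 - rho v * nbr_sum v V) <= edgeless_prob (v |: V).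
Proof.
move=> vV; rewrite edgeless_prob_rec//.
have Zm : edgeless_prob V <= edgeless_prob (V :\: nbr v V) by apply: edgeless_prob_anti; exact: finset.subsetDl.
set q1 := q _; have q1E : 1 - q1 <= nbr_sum v V by apply: p_le; exact: sumr_ge0.
have q10 : 0 <= q1 by exact: expR_ge0.
have p0 := p_ge0 (rho_ge0 v); have p1 := p_le (rho_ge0 v).
have H1 : (1 - expR (- rho v)) * (q1 * edgeless_prob V) <= (1 - expR (- rho v)) * (q1 * edgeless_prob (V :\: nbr v V)).
  by rewrite ler_wpM2l// ler_wpM2l.
apply: le_trans (lerD (lexx _) H1).
have H2 : (1 - expR (- rho v)) * (1 - q1) <= rho v * nbr_sum v V.
  by rewrite ler_pM// subr_ge0 expR_le1 oppr_le0; exact: sumr_ge0.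
have := ler_wpM2l (edgeless_prob_ge0 V) H2; lra.
Qed.

(** Removing the neighbourhood of a vertex changes the probability by a
    factor close to 1, since the degrees are at most [tau]. *)
Let lower2 N : forall W, (forall u, u \in N -> rho u <= tau) -> [disjoint N & W]%B ->
  edgeless_prob W * (1 - tau * \sum_(u in N) rho u) <= edgeless_prob (N :|: W).
Proof.
have [n] := ubnP #|N|; elim: n N => // n IH N; rewrite ltnS => Nn W rN dNW.
have [->|[v vN]] := set_0Vmem N; first by rewrite big_set0 mulr0 subr0 mulr1 finset.set0U.
pose N' := N :\ v; have NE : N = v |: N' by rewrite finset.setD1K.
have vN' : v \notin N' by rewrite !inE eqxx.
have N'n : (#|N'| < n)%N by move: Nn; rewrite (cardsD1 v) vN.
have vW : v \notin W by apply/negP => vW; move/disjP : dNW => /(_ v vN); rewrite vW.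
have H := IH N' N'n W _ _.
have {}H : edgeless_prob W * (1 - tau * \sum_(u in N') rho u) <= edgeless_prob (N' :|: W).
  apply: H; first by move=> u; rewrite !inE => /andP[_]; exact: rN.
  by apply: disjointWl dNW; rewrite NE; exact: finset.subsetUr.
have vNW : v \notin N' :|: W by rewrite finset.in_setU negb_or vN'.
have := lower1 vNW; rewrite finset.setUA -NE; apply: le_trans.
rewrite NE sum_setU1//; set s := \sum_(i in N') _ in H *.
have s0 : 0 <= s by exact: sumr_ge0.
have t0 := tau_ge0 v.
have tl : tau <= 3^-1 by exact: tau_le.
have r1 : rho v <= tau by exact: rN.
have sg := nbr_sum_le v (N' :|: W); have sg0 := nbr_sum_ge0 v (N' :|: W).
have rs : rho v * nbr_sum v (N' :|: W) <= rho v * tau by rewrite ler_wpM2l.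
have rt1 : rho v * tau <= 1.
  have : rho v * tau <= 3^-1 * 3^-1 by rewrite ler_pM// (le_trans r1).
  lra.
apply: (@le_trans _ _ (edgeless_prob (N' :|: W) * (1 - rho v * tau))); last first.
  by rewrite ler_wpM2l//; lra.
apply: (@le_trans _ _ (edgeless_prob W * (1 - tau * s) * (1 - rho v * tau))); last first.
  by rewrite ler_wpM2r// subr_ge0.
rewrite -mulrA ler_wpM2l//.
have : 0 <= (tau * s) * (rho v * tau) by rewrite !mulr_ge0.
lra.
Qed.

(** By [edgeless_prob_rec] and [lower2]: the factor lost is
    [rho v * nbr_sum v V] up to relative errors of order [tau]. *)
Let upper1 v V : v \notin V -> edgeless_prob (v |: V) <= edgeless_prob V * (1 - (1 - 3 * tau) * (rho v * nbr_sum v V)).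
Proof.
move=> vV; have [sg0|sgN0] := eqVneq (nbr_sum v V) 0.
  by rewrite sg0 !mulr0 subr0 mulr1; apply: edgeless_prob_anti; exact: finset.subsetUr.
have [u /andP[uV evu]] : exists u, (u \in V) && e v u.
  apply/existsP; apply: contraNT sgN0 => /existsPn H.
  by rewrite /nbr_sum big1// => u; rewrite !inE; move/negbTE: (H u) => ->.
have edge_le x y : e x y -> rho x <= tau.
  move=> exy; apply: le_trans (deg_le y); rewrite (bigD1 x)/= 1?e_sym// lerDl.
  exact: sumr_ge0.
have rv := edge_le _ _ evu.
rewrite edgeless_prob_rec//.
set s := nbr_sum v V; have s0 : 0 <= s by exact: nbr_sum_ge0.
have st : s <= tau by exact: nbr_sum_le.
have t0 : 0 <= tau by exact: (tau_ge0 v).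
have tl : tau <= 3^-1 by exact: tau_le.
have H : edgeless_prob (V :\: nbr v V) * (1 - tau * s) <= edgeless_prob V.
  have /= := @lower2 (nbr v V) (V :\: nbr v V) _ _.
  rewrite (_ : nbr v V :|: _ = V); last first.
    by apply/setP => x; rewrite !inE; case: (x \in V) => //=; case: (e v x).
  apply; first by move=> w; rewrite !inE => /andP[_]; rewrite e_sym; exact: edge_le.
  by apply/disjP => x; rewrite !inE => /andP[-> ->].
have qE : q (nbr v V) * (1 + s) <= 1.
  have := expR_ge1Dx s => H1.
  apply: (@le_trans _ _ (q (nbr v V) * expR s)); first by rewrite ler_wpM2l// expR_ge0.
  by rewrite /q -expRD addNr expR0.
set z := edgeless_prob (V :\: nbr v V) in H *; have z0 : 0 <= z by exact: edgeless_prob_ge0.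
set Q := q _ in qE *; have Q0 : 0 <= Q by exact: expR_ge0.
have ts : tau * s <= 9^-1.
  have := ler_pM t0 s0 tau_le (le_trans st tau_le); lra.
have D0 : 0 < (1 + s) * (1 - tau * s) by rewrite mulr_gt0//; lra.
have K : Q * z <= edgeless_prob V * (1 - s * (1 - 2 * tau)).
  rewrite -(ler_pM2r D0).
  apply: (@le_trans _ _ (edgeless_prob V)).
    have -> : Q * z * ((1 + s) * (1 - tau * s)) = (Q * (1 + s)) * (z * (1 - tau * s)) by ring.
    rewrite -[leRHS]mul1r; apply: ler_pM => //.
    - by rewrite mulr_ge0//; lra.
    - by rewrite mulr_ge0//; lra.
  rewrite -mulrA -[leLHS]mulr1 ler_wpM2l ?edgeless_prob_ge0//.
  have ts0 : 0 <= tau * s by rewrite mulr_ge0.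
  have h1 : 0 <= s * (tau - s) by rewrite mulr_ge0// subr_ge0.
  have h2 : 0 <= s * (tau - s) * (1 - 2 * tau) by rewrite mulr_ge0 ?h1//; have := tau_le; lra.
  set a := s * (2 * tau - s * (1 - 2 * tau)).
  have aE : (1 - s * (1 - 2 * tau)) * (1 + s) = 1 + a by rewrite /a; ring.
  have aL : tau * s * (1 + 2 * tau) <= a by rewrite /a; lra.
  have c0 : 0 <= 1 - tau * s by lra.
  have c1 : 1 <= (1 + 2 * tau) * (1 - tau * s).
    have : 0 <= tau * (2 - s * (1 + 2 * tau)).
      rewrite mulr_ge0//; have : s * (1 + 2 * tau) <= 3^-1 * (1 + 2 * 3^-1) by rewrite ler_pM//; lra.
      lra.
    lra.
  have c2 := ler_wpM2l ts0 c1; have c3 := ler_wpM2r c0 aL.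
  rewrite mulrA aE; lra.
have p1 : rho v * (1 - tau) <= 1 - expR (- rho v).
  have E : expR (- rho v) * (1 + rho v) <= 1.
    apply: (@le_trans _ _ (expR (- rho v) * expR (rho v))); first by rewrite ler_wpM2l ?expR_ge0// expR_ge1Dx.
    by rewrite -expRD addNr expR0.
  have r0 := rho_ge0 v; have := expR_ge0 (- rho v); have D1 : 0 < 1 + rho v by lra.
  move=> x0; rewrite -(ler_pM2r D1); nra.
have Zv := edgeless_prob_ge0 V.
have p0 := p_ge0 (rho_ge0 v); set p := 1 - expR (- rho v) in p0 p1 *.
have -> : expR (- rho v) = 1 - p by rewrite /p; ring.
have := ler_wpM2l p0 K.
have P2 : rho v * s * (1 - 3 * tau) <= p * (s * (1 - 2 * tau)).
  have : rho v * (1 - tau) * (s * (1 - 2 * tau)) <= p * (s * (1 - 2 * tau)).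
    by rewrite ler_wpM2r// mulr_ge0//; lra.
  have : 0 <= (rho v * s) * (tau * tau) by rewrite !mulr_ge0.
  lra.
have := ler_wpM2l Zv P2; lra.
Qed.

Definition edge_mass V := \sum_(i in V) \sum_(j in V | e i j) rho i * rho j.

Let edge_mass_rec v V : v \notin V -> edge_mass (v |: V) = edge_mass V + 2 * (rho v * nbr_sum v V).
Proof.
move=> vV; rewrite /edge_mass big_setU1//=.
have E1 : \sum_(j in v |: V | e v j) rho v * rho j = rho v * nbr_sum v V.
  rewrite /nbr_sum mulr_sumr; apply: eq_bigl => j; rewrite !inE.
  by case: eqVneq => [->|]//=; rewrite e_irr andbF.
have E2 i : i \in V -> \sum_(j in v |: V | e i j) rho i * rho j =
    (if e v i then rho i * rho v else 0) + \sum_(j in V | e i j) rho i * rho j.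
  move=> iV; rewrite big_mkcondr/= big_setU1//= [in RHS]big_mkcondr/=.
  by rewrite e_sym.
rewrite E1 (eq_bigr _ E2) big_split/=.
have -> : \sum_(i in V) (if e v i then rho i * rho v else 0) = rho v * nbr_sum v V.
  rewrite -big_mkcondr/= /nbr_sum mulr_sumr; apply: eq_big => i; first by rewrite !inE.
  by move=> _; rewrite mulrC.
by ring.
Qed.

(** The set [V] is built vertex by vertex, each step multiplying the
    probability by about [exp (- rho v * nbr_sum v V)]; the exponents add up to
    half of [edge_mass V]. Small degrees make the edges nearly independent. *)
Lemma edgeless_bounds V :
  expR (- ((1 + tau) * (edge_mass V / 2))) <= edgeless_prob V <= expR (- ((1 - 3 * tau) * (edge_mass V / 2))).
Proof.
have [n] := ubnP #|V|; elim: n V => // n IH V; rewrite ltnS => Vn.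
have [->|[v vV]] := set_0Vmem V.
  have -> : edgeless_prob finset.set0 = 1.
    rewrite /edgeless_prob -pr_true; apply: eq_pr => S; rewrite finset.setI0; apply/forallP => i.
    by rewrite inE.
  by rewrite /edge_mass big_set0 mul0r !mulr0 oppr0 expR0 lexx.
pose V' := V :\ v; have VE : V = v |: V' by rewrite finset.setD1K.
have vV' : v \notin V' by rewrite !inE eqxx.
have V'n : (#|V'| < n)%N by move: Vn; rewrite (cardsD1 v) vV.
have /andP[L U] := IH V' V'n.
rewrite VE edge_mass_rec//; set m := edge_mass V' in L U *; set x := rho v * nbr_sum v V'.
have x0 : 0 <= x by rewrite mulr_ge0// nbr_sum_ge0.
have t0 := tau_ge0 v.
have tl : tau <= 3^-1 by exact: tau_le.
have xt : (1 + tau) * x <= tau.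
  have [sg0|sgN0] := eqVneq (nbr_sum v V') 0; first by rewrite /x sg0 !mulr0.
  have [u /andP[uV evu]] : exists u, (u \in V') && e v u.
    apply/existsP; apply: contraNT sgN0 => /existsPn H.
    by rewrite /nbr_sum big1// => u; rewrite inE; move/negbTE: (H u) => ->.
  have rv : rho v <= tau.
    apply: le_trans (deg_le u); rewrite (bigD1 v)/= 1?(e_sym u)// lerDl.
    exact: sumr_ge0.
  have : x <= tau * tau by rewrite ler_pM// ?nbr_sum_ge0 ?nbr_sum_le.
  have : (1 + tau) * tau <= 1 by nra.
  nra.
have Lx : expR (- ((1 + tau) * x)) <= 1 - x.
  have y0 : 0 <= (1 + tau) * x by rewrite mulr_ge0//; lra.
  have E : expR (- ((1 + tau) * x)) * (1 + (1 + tau) * x) <= 1.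
    apply: (@le_trans _ _ (expR (- ((1 + tau) * x)) * expR ((1 + tau) * x))).
      by rewrite ler_wpM2l ?expR_ge0// expR_ge1Dx.
    by rewrite -expRD addNr expR0.
  have D : 0 < 1 + (1 + tau) * x by lra.
  rewrite -(ler_pM2r D); apply: (le_trans E); nra.
have Ux : 1 - (1 - 3 * tau) * x <= expR (- ((1 - 3 * tau) * x)).
  exact: expR_ge1Dx.
apply/andP; split.
- apply: le_trans (lower1 vV').
  have -> : - ((1 + tau) * ((m + 2 * x) / 2)) = - ((1 + tau) * (m / 2)) + - ((1 + tau) * x) by field.
  by rewrite expRD ler_pM ?expR_ge0.
- apply: (le_trans (upper1 vV')).
  have -> : - ((1 - 3 * tau) * ((m + 2 * x) / 2)) = - ((1 - 3 * tau) * (m / 2)) + - ((1 - 3 * tau) * x) by field.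
  rewrite expRD; apply: ler_pM; [exact: edgeless_prob_ge0| |exact: U|exact: Ux].
  have : (1 - 3 * tau) * x <= 1 * x by rewrite ler_wpM2r//; lra.
  have : 0 <= tau * x by rewrite mulr_ge0.
  rewrite -/x; lra.
Qed.
End edgeless.

(** * Inner product and rotations *)

Section rot.
Context {R : realType} {d : nat}.
Implicit Types x y : 'rV[R]_d.

Definition dot x y : R := \sum_(i < d) x ord0 i * y ord0 i.

Lemma dotE x y : dot x y = (x *m y^T) ord0 ord0.
Proof. by rewrite mxE; apply: eq_bigr => i _; rewrite mxE. Qed.

Lemma enorm_ge0 x : 0 <= enorm x. Proof. exact: sqrtr_ge0. Qed.

Lemma enorm_sqr x : enorm x ^+ 2 = dot x x.
Proof.
rewrite /enorm sqr_sqrtr; first by apply: eq_bigr => i _; rewrite expr2.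
by apply: sumr_ge0 => i _; exact: sqr_ge0.
Qed.

Lemma dotC x y : dot x y = dot y x.
Proof. by apply: eq_bigr => i _; rewrite mulrC. Qed.

Lemma dotZr (c : R) x y : dot x (c *: y) = c * dot x y.
Proof. by rewrite /dot mulr_sumr; apply: eq_bigr => i _; rewrite mxE; ring. Qed.

Lemma dotDl x y z : dot (x + y) z = dot x z + dot y z.
Proof. by rewrite /dot -big_split; apply: eq_bigr => i _; rewrite mxE mulrDl. Qed.

Lemma dotNl x z : dot (- x) z = - dot x z.
Proof. by rewrite /dot -sumrN; apply: eq_bigr => i _; rewrite mxE mulNr. Qed.

Lemma dotBl x y z : dot (x - y) z = dot x z - dot y z.
Proof. by rewrite dotDl dotNl. Qed.

Lemma dotBr x y z : dot x (y - z) = dot x y - dot x z.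
Proof. by rewrite dotC dotBl dotC (dotC z). Qed.

Lemma enormZ (c : R) x : enorm (c *: x) = `|c| * enorm x.
Proof.
rewrite /enorm -sqrtr_sqr -sqrtrM ?sqr_ge0// mulr_sumr.
by congr Num.sqrt; apply: eq_bigr => i _; rewrite mxE exprMn.
Qed.

Lemma enorm_eq0 x : enorm x = 0 -> x = 0.
Proof.
move=> x0; apply/rowP => i; rewrite !mxE.
have : dot x x = 0 by rewrite -enorm_sqr x0 expr0n.
move/eqP; rewrite psumr_eq0; last by move=> j _; rewrite -expr2 sqr_ge0.
by move=> /allP/(_ i); rewrite mem_index_enum -expr2 sqrf_eq0 => /(_ isT)/eqP.
Qed.

Lemma enormN x : enorm (- x) = enorm x.
Proof. by rewrite -scaleN1r enormZ normrN1 mul1r. Qed.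

Lemma cauchy_schwarz x y : `|dot x y| <= enorm x * enorm y.
Proof.
have [y0|yn0] := eqVneq (enorm y) 0.
  by rewrite (enorm_eq0 y0) (_ : dot x 0 = 0) ?normr0 ?mulr_ge0 ?enorm_ge0// /dot big1// => i _; rewrite mxE mulr0.
rewrite -(@ler_pXn2r _ 2)// ?nnegrE ?mulr_ge0 ?enorm_ge0//.
rewrite real_normK ?num_real// exprMn !enorm_sqr.
have yy : 0 < dot y y by rewrite -enorm_sqr exprn_gt0// lt_neqAle eq_sym yn0 enorm_ge0.
have : 0 <= dot (x - (dot x y / dot y y) *: y) (x - (dot x y / dot y y) *: y).
  by rewrite -enorm_sqr sqr_ge0.
rewrite !dotBl !dotBr !dotZr (dotC _ x) dotZr (dotC (_ *: _) y) dotZr.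
have E : dot x y / dot y y * dot y y = dot x y by rewrite divfK// gt_eqF.
rewrite E subrr subr0 subr_ge0 mulrAC ler_pdivrMr// -expr2; lra.
Qed.

Lemma enorm_triangle x y : enorm (x + y) <= enorm x + enorm y.
Proof.
rewrite -(@ler_pXn2r _ 2)// ?nnegrE ?addr_ge0 ?enorm_ge0//.
rewrite sqrrD !enorm_sqr !dotDl !(dotC _ (x + y)) !dotDl (dotC y x).
have := le_trans (ler_norm _) (cauchy_schwarz x y); lra.
Qed.

Lemma dot_mulmx (U : 'M[R]_d) x y : U *m U^T = 1%:M -> dot (x *m U) (y *m U) = dot x y.
Proof. by move=> UU; rewrite !dotE trmx_mul mulmxA -(mulmxA x) UU mulmx1. Qed.

Lemma enorm_mulmx (U : 'M[R]_d) x : U *m U^T = 1%:M -> enorm (x *m U) = enorm x.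
Proof.
move=> UU; apply: (@pexpIrn _ 2) => //; rewrite ?nnegrE ?enorm_ge0//.
by rewrite !enorm_sqr dot_mulmx.
Qed.

Definition ebase (i : 'I_d) : 'rV[R]_d := delta_mx ord0 i.

Lemma dot_ebase x i : dot x (ebase i) = x ord0 i.
Proof.
rewrite /dot (bigD1 i)//= mxE !eqxx mulr1 big1 ?addr0// => j ji.
by rewrite mxE (negbTE ji) andbF mulr0.
Qed.

(** The Householder reflection exchanging the two unit vectors. *)
Lemma orthogonal_transitive (i : 'I_d) y : enorm y = 1 ->
  exists2 U : 'M[R]_d, U *m U^T = 1%:M & y = ebase i *m U.
Proof.
move=> y1; set e := ebase i.
have ee : dot e e = 1 by rewrite dot_ebase mxE !eqxx.
have yy : dot y y = 1 by rewrite -enorm_sqr y1 expr1n.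
have [->|ney] := eqVneq y e; first by exists 1%:M; rewrite ?trmx1 mulmx1.
pose w := e - y; pose n := dot w w.
have n0 : n != 0.
  rewrite /n -enorm_sqr sqrf_eq0; apply: contra_neq ney => /enorm_eq0/eqP.
  by rewrite subr_eq0 => /eqP.
have nE : n = 2 * dot e w.
  by rewrite /n /w !dotBl !dotBr ee yy (dotC y e); ring.
pose W : 'M[R]_d := w^T *m w; pose c := 2 / n.
have WW : W *m W = n *: W.
  rewrite /W mulmxA -(mulmxA w^T).
  by rewrite [w *m w^T]mx11_scalar -dotE -/n mul_mx_scalar -scalemxAl.
have WT : W^T = W by rewrite /W trmx_mul trmxK.
exists (1%:M - c *: W).
  have -> : (1%:M - c *: W)^T = 1%:M - c *: W.
    by rewrite [LHS]linearB/= trmx1 [X in _ - X]linearZ/= WT.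
  rewrite mulmxBl mul1mx mulmxBr mulmx1.
  rewrite -scalemxAl -scalemxAr WW !scalerA.
  have -> : c * c * n = c + c by rewrite /c; field.
  by rewrite scalerDl opprB addrK subrK.
rewrite mulmxBr mulmx1 -scalemxAr /W mulmxA [e *m w^T]mx11_scalar -dotE mul_scalar_mx scalerA.
have -> : c * dot e w = 1 by rewrite /c nE; field; move: n0; rewrite nE mulf_eq0 negb_or => /andP[].
by rewrite scale1r /w subKr.
Qed.

(** In dimension at least 2 a sign change of another axis corrects the
    determinant of the orthogonal matrix. *)
Lemma rotation_transitive (i j : 'I_d) y : i != j -> 
  exists2 U : 'M[R]_d, rotation U & y = enorm y *: (ebase i *m U).
Proof.
move=> ij.
have [U UU yU] : exists2 U : 'M[R]_d, U *m U^T = 1%:M & y = enorm y *: (ebase i *m U).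
  have [y0|yn0] := eqVneq (enorm y) 0.
    by exists 1%:M; rewrite ?trmx1 ?mulmx1// y0 scale0r (enorm_eq0 y0).
  have [|U UU yU] := @orthogonal_transitive i ((enorm y)^-1 *: y).
    by rewrite enormZ normfV ger0_norm ?enorm_ge0// mulVf.
  by exists U => //; rewrite -yU scalerA divff// scale1r.
have := congr1 (fun M => \det M) UU; rewrite det_mulmx det_tr det1 -expr2 => /eqP.
rewrite sqrf_eq1 => /orP[/eqP dU|/eqP dU]; first by exists U.
pose D : 'M[R]_d := diag_mx (\row_k (if k == j then -1 else 1)).
have DD : D *m D^T = 1%:M.
  rewrite /D tr_diag_mx; apply/matrixP => a b.
  rewrite mul_diag_mx !mxE; case: (a =P b) => [->|ab]; last by rewrite mulr0n mulr0.
  by case: ifP => _; rewrite mulr1n ?mulrNN mulr1.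
have dD : \det D = -1.
  rewrite det_diag (bigD1 j)//= mxE eqxx big1 ?mulr1// => k kj.
  by rewrite mxE (negbTE kj).
have eD : ebase i *m D = ebase i.
  apply/rowP => k; rewrite /D mul_mx_diag !mxE eqxx/=; case: (k =P i) => [->|]; last by rewrite mul0r.
  by rewrite (negbTE ij) mulr1.
exists (D *m U); last by rewrite mulmxA eD.
split; last by rewrite det_mulmx dD dU mulrNN mulr1.
by rewrite trmx_mul mulmxA -(mulmxA D) UU mulmx1.
Qed.

End rot.

(** * Moments of a spherically symmetric law *)

Section measurability.
Context {R : realType} {d : nat}.
Notation T := (borel_space R d).

Lemma measurable_coord (i : 'I_d) : measurable_fun [set: T] (fun x : T => (x : 'rV[R]_d) ord0 i).
Proof.
apply: (measurability _ (RGenOpens.measurableE R)) => _ [_ [a [b ->] <-]].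
rewrite setTI; apply: sub_sigma_algebra.
have /continuousP := @coord_continuous R 1 d ord0 i.
by apply; exact: interval_open.
Qed.

Lemma measurable_sqrt : measurable_fun [set: R] (@Num.sqrt R).
Proof. by apply: continuous_measurable_fun; exact: sqrt_continuous. Qed.

Lemma measurable_enorm : measurable_fun [set: T] (fun x : T => enorm x).
Proof.
apply: (measurableT_comp measurable_sqrt); apply: measurable_sum => i.
by apply: measurable_funX; exact: measurable_coord.
Qed.

Lemma measurable_dot2 : measurable_fun [set: T * T] (fun z : T * T => dot z.1 z.2).
Proof.
apply: measurable_sum => i; apply: measurable_funM.
  exact: (measurableT_comp (measurable_coord i) measurable_fst).
exact: (measurableT_comp (measurable_coord i) measurable_snd).
Qed.

Lemma measurable_dist2 :
  measurable_fun [set: T * T] (fun z : T * T => enorm ((z.1 : 'rV[R]_d) - (z.2 : 'rV[R]_d))).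
Proof.
apply: (measurableT_comp measurable_sqrt); apply: measurable_sum => i.
apply: measurable_funX.
under eq_fun do rewrite !mxE.
apply: measurable_funB.
  exact: (measurableT_comp (measurable_coord i) measurable_fst).
exact: (measurableT_comp (measurable_coord i) measurable_snd).
Qed.

Lemma measurable_unit_ball : measurable (@unit_ball R d).
Proof.
rewrite (_ : @unit_ball R d = ([set: T] `&` (fun x : T => enorm x) @^-1` `]-oo, 1]%classic)); last first.
  by apply/seteqP; split => x/=; rewrite /unit_ball/= in_itv/=; [|case].
by apply: measurable_enorm => //; exact: measurable_itv.
Qed.
End measurability.
#[global] Hint Resolve measurable_unit_ball : core.

Lemma ge0_integral_law dT (T : measurableType dT) (R : realType)
    (mu : {measure set T -> \bar R}) (f g : T -> R) :
  measurable_fun setT f -> measurable_fun setT g ->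
  (forall x, 0 <= f x) -> (forall x, 0 <= g x) ->
  (forall C, measurable C -> mu (f @^-1` C) = mu (g @^-1` C)) ->
  (\int[mu]_x (f x)%:E = \int[mu]_x (g x)%:E)%E.
Proof.
move=> mf mg f0 g0 fg.
have mabs : measurable_fun [set: R] (fun y : R => `|y|%:E).
  by apply/measurable_EFinP; exact: normr_measurable.
have key (h : T -> R) (mh : measurable_fun setT h) : (forall x, 0 <= h x) ->
    (\int[mu]_x (h x)%:E = \int[pushforward mu h]_y `|y|%:E)%E.
  move=> h0; rewrite (ge0_integral_pushforward mh)//= preimage_setT.
  by apply: eq_integral => x _ /=; rewrite ger0_norm.
rewrite (key f)// (key g)//; apply: eq_measure_integral => A mA _.
exact: fg.
Qed.

Section moments.
Context {R : realType} {d : nat}.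
Notation T := (borel_space R d).
Variables (kappa : probability T R).
Hypothesis kappa_sym : spherically_symmetric kappa.
Variables (i0 i1 : 'I_d).
Hypothesis i01 : i0 != i1.
Local Notation B := (@unit_ball R d).

(** Rotating [y] onto the axis [i0] leaves the law and the norm
    unchanged. *)
Lemma kappa_dot (S : R -> R -> Prop) (y : 'rV[R]_d) :
  measurable [set x : T | S (dot x y) (enorm x)] ->
  kappa [set x : T | S (dot x y) (enorm x)] =
  kappa [set x : T | S (enorm y * (x : 'rV[R]_d) ord0 i0) (enorm x)].
Proof.
move=> mS; have [U rU yE] := rotation_transitive y i01.
rewrite -(kappa_sym rU mS); congr (kappa _); apply/seteqP.
have UU : U *m U^T = 1%:M by case: rU.
have E (x : 'rV[R]_d) : dot (x *m U) y = enorm y * x ord0 i0.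
  by rewrite [in LHS]yE dotZr dot_mulmx// dot_ebase.
by split => x /=; rewrite E enorm_mulmx.
Qed.

Lemma integral_dot (f : R -> R -> R) (y : 'rV[R]_d) :
  (forall u v, 0 <= f u v) ->
  measurable_fun setT (fun x : T => f (dot x y) (enorm x)) ->
  measurable_fun setT (fun x : T => f (enorm y * (x : 'rV[R]_d) ord0 i0) (enorm x)) ->
  (\int[kappa]_(x in B) (f (dot x y) (enorm x))%:E =
   \int[kappa]_(x in B) (f (enorm y * (x : 'rV[R]_d) ord0 i0) (enorm x))%:E)%E.
Proof.
move=> f0 m1 m2; rewrite [LHS]integral_mkcond [RHS]integral_mkcond.
pose g u v := if v <= 1 then f u v else 0.
have gE (h : T -> R) : (fun x : T => (f (h x) (enorm x))%:E) \_ B =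
    (fun x => (g (h x) (enorm x))%:E).
  apply/funext => x; rewrite patchE /g/=; case: ifPn; rewrite ?inE ?notin_setE/=.
    by rewrite /unit_ball/= => ->.
  by rewrite /unit_ball/= => /negP/negbTE ->.
have mgE (h : T -> R) : measurable_fun setT (fun x : T => f (h x) (enorm x)) ->
    measurable_fun setT (fun x => g (h x) (enorm x)).
  move=> mh; apply: measurable_fun_ifT => //.
  by apply: measurable_fun_ler => //; exact: measurable_enorm.
rewrite !gE; apply: ge0_integral_law; try exact: mgE.
- by move=> x; rewrite /g; case: ifP.
- by move=> x; rewrite /g; case: ifP.
move=> C mC; apply: (@kappa_dot (fun u v => C (g u v))).
rewrite -[X in measurable X]setTI; exact: (mgE _ m1).
Qed.

(** A class of functions stable under the algebraic operations, on which
    the integral against [kappa] is linear without further conditions. *)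
Definition tame (f : T -> R) := measurable_fun setT f /\
  exists M : R, forall x, B x -> `|f x| <= M.

Lemma tame_cst c : tame (fun=> c).
Proof. by split; [exact: measurable_cst|exists `|c|]. Qed.
Lemma tameD f g : tame f -> tame g -> tame (fun x => f x + g x).
Proof.
move=> [mf [M fM]] [mg [N gN]]; split; first exact: measurable_funD.
by exists (M + N) => x Bx; apply: le_trans (ler_normD _ _) _; rewrite lerD ?fM ?gN.
Qed.
Lemma tameM f g : tame f -> tame g -> tame (fun x => f x * g x).
Proof.
move=> [mf [M fM]] [mg [N gN]]; split; first exact: measurable_funM.
by exists (M * N) => x Bx; rewrite normrM ler_pM ?fM ?gN.
Qed.
Lemma tameX f n : tame f -> tame (fun x => f x ^+ n).
Proof.
move=> [mf [M fM]]; split; first exact: measurable_funX.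
by exists (M ^+ n) => x Bx; rewrite normrX lerXn2r ?nnegrE ?fM// (le_trans _ (fM x Bx)).
Qed.
Lemma tame_coord i : tame (fun x : T => (x : 'rV[R]_d) ord0 i).
Proof.
split; first exact: measurable_coord.
exists 1 => x; rewrite /unit_ball/= => x1.
rewrite -sqrtr_sqr (le_trans _ x1)// ler_wsqrtr// (bigD1 i)//= lerDl.
by apply: sumr_ge0 => j _; exact: sqr_ge0.
Qed.
Lemma tame_enorm : tame (fun x : T => enorm x).
Proof.
split; first exact: measurable_enorm.
by exists 1 => x; rewrite /unit_ball/= ger0_norm// enorm_ge0.
Qed.
Lemma tame_sum (I : Type) (r : seq I) (f : I -> T -> R) :
  (forall i, tame (f i)) -> tame (fun x => \sum_(i <- r) f i x).
Proof.
move=> tf; elim: r => [|i r IH].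
  by under eq_fun do rewrite big_nil; exact: tame_cst.
by under eq_fun do rewrite big_cons; exact: tameD.
Qed.
Lemma tame_integrable f : tame f -> kappa.-integrable B (EFin \o f).
Proof.
move=> [mf [M fM]]; apply: measurable_bounded_integrable => //.
- by rewrite (le_lt_trans (probability_le1 _ _))// ltry.
- exact: measurable_funTS.
- exists M; split; first exact: num_real.
  by move=> N MN x Bx /=; rewrite (le_trans (fM x Bx))// ltW.
Qed.

Definition ball_mean (f : T -> R) : R := \int[kappa]_(x in B) f x.

Lemma ball_meanD f g : tame f -> tame g -> ball_mean (fun x => f x + g x) = ball_mean f + ball_mean g.
Proof. by move=> tf tg; rewrite /ball_mean RintegralD//; exact: tame_integrable. Qed.
Lemma ball_meanZ c f : tame f -> ball_mean (fun x => c * f x) = c * ball_mean f.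
Proof. by move=> tf; rewrite /ball_mean RintegralZl//; exact: tame_integrable. Qed.
Lemma ball_mean_sum (I : Type) (r : seq I) (f : I -> T -> R) : (forall i, tame (f i)) ->
  ball_mean (fun x => \sum_(i <- r) f i x) = \sum_(i <- r) ball_mean (f i).
Proof.
move=> tf; elim: r => [|i r IH].
  under eq_fun do rewrite big_nil; rewrite big_nil /ball_mean Rintegral_cst//.
  by rewrite mul0r.
under eq_fun do rewrite big_cons.
by rewrite ball_meanD//; [rewrite IH big_cons|exact: tame_sum].
Qed.
Lemma ball_mean_ge0 f : (forall x, B x -> 0 <= f x) -> 0 <= ball_mean f.
Proof. by move=> f0; exact: Rintegral_ge0. Qed.
Lemma ball_mean_fin f : tame f -> (\int[kappa]_(x in B) (f x)%:E = (ball_mean f)%:E)%E.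
Proof.
move=> tf; rewrite /ball_mean /Rintegral fineK//; apply: integrable_fin_num => //.
exact: tame_integrable.
Qed.

Definition axis_moment i l := ball_mean (fun x => (x : 'rV[R]_d) ord0 i0 ^+ (2 * i) * enorm x ^+ (2 * l)).

Lemma tame_axis_moment (j : 'I_d) i l : tame (fun x : T => (x : 'rV[R]_d) ord0 j ^+ i * enorm x ^+ l).
Proof.
by apply: tameM; apply: tameX; [exact: tame_coord|exact: tame_enorm].
Qed.

Lemma tame_dot y : tame (fun x : T => dot x y).
Proof.
apply: tame_sum => i; apply: tameM; [exact: tame_coord|exact: tame_cst].
Qed.

Lemma moment_dot y i l :
  ball_mean (fun x => dot x y ^+ (2 * i) * enorm x ^+ (2 * l)) = enorm y ^+ (2 * i) * axis_moment i l.
Proof.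
rewrite /axis_moment -ball_meanZ; last exact: tame_axis_moment.
have t1 : tame (fun x : T => dot x y ^+ (2 * i) * enorm x ^+ (2 * l)).
  by apply: tameM; apply: tameX; [exact: tame_dot|exact: tame_enorm].
have t2 : tame (fun x : T => (enorm y * (x : 'rV[R]_d) ord0 i0) ^+ (2 * i) * enorm x ^+ (2 * l)).
  apply: tameM; apply: tameX; last exact: tame_enorm.
  by apply: tameM; [exact: tame_cst|exact: tame_coord].
have := @integral_dot (fun u v => u ^+ (2 * i) * v ^+ (2 * l)) y _ t1.1 t2.1.
rewrite !ball_mean_fin// => H.
have {}H : ball_mean (fun x => dot x y ^+ (2 * i) * enorm x ^+ (2 * l)) =
   ball_mean (fun x => (enorm y * (x : 'rV[R]_d) ord0 i0) ^+ (2 * i) * enorm x ^+ (2 * l)).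
  apply: EFin_inj; apply: H => u v.
  by rewrite !exprM mulr_ge0// exprn_ge0 ?sqr_ge0.
by rewrite H; congr ball_mean; apply/funext => x; rewrite exprMn mulrA.
Qed.

Lemma poly_eq_horner (p q : {poly R}) : (forall t, p.[t] = q.[t]) -> p = q.
Proof.
move=> pq; apply/eqP; rewrite -subr_eq0; apply/eqP.
apply: (@roots_geq_poly_eq0 _ _ [seq n%:R | n <- iota 0 (size (p - q))]).
- by apply/allP => x _; rewrite rootE hornerD hornerN pq subrr.
- rewrite map_inj_uniq ?iota_uniq// => m n /eqP; rewrite eqr_nat => /eqP//.
- by rewrite size_map size_iota.
Qed.

(** By [moment_dot] the mean of [<x, e_i0 + t e_j>^(2 i + 2) |x|^(2 l)] is
    [(1 + t^2)^(i + 1)] times its value at [t = 0]; compare the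
    coefficients of [t^2]. *)
Lemma moment_cross (j : 'I_d) i l : j != i0 ->
  (2 * i.+1 - 1)%:R * ball_mean (fun x => (x : 'rV[R]_d) ord0 i0 ^+ (2 * i) *
     (x : 'rV[R]_d) ord0 j ^+ 2 * enorm x ^+ (2 * l)) = axis_moment i.+1 l.
Proof.
move=> ji0; pose n := (2 * i.+1)%N.
pose c k := ball_mean (fun x => (x : 'rV[R]_d) ord0 i0 ^+ (n - k) *
     (x : 'rV[R]_d) ord0 j ^+ k * enorm x ^+ (2 * l)).
have tc k : tame (fun x : T => (x : 'rV[R]_d) ord0 i0 ^+ (n - k) *
     (x : 'rV[R]_d) ord0 j ^+ k * enorm x ^+ (2 * l)).
  by apply: tameM; [apply: tameM; apply: tameX; exact: tame_coord|apply: tameX; exact: tame_enorm].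
pose p : {poly R} := \poly_(k < n.+1) ('C(n, k)%:R * c k).
pose q : {poly R} := axis_moment i.+1 l *: (1 + 'X^2) ^+ i.+1.
have pq : p = q.
  apply: poly_eq_horner => t.
  rewrite horner_poly /q hornerZ horner_exp !hornerE.
  pose y : 'rV[R]_d := ebase i0 + t *: ebase j.
  have yE : enorm y ^+ n = (1 + t ^+ 2) ^+ i.+1.
    rewrite /n exprM enorm_sqr; congr (_ ^+ _).
    rewrite /y !dotDl dotC dotDl dotC !(dotC (t *: _)) !dotDl !dotZr !(dotC (t *: _)) !dotZr.
    by rewrite !dot_ebase !mxE !eqxx (negbTE ji0)/=; ring.
  rewrite -yE mulrC -moment_dot.
  transitivity (\sum_(k < n.+1) ball_mean (fun x => ('C(n, k)%:R * t ^+ k) * ((x : 'rV[R]_d) ord0 i0 ^+ (n - k) *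
     (x : 'rV[R]_d) ord0 j ^+ k * enorm x ^+ (2 * l)))).
    by apply: eq_bigr => k _; rewrite ball_meanZ// /c; ring.
  rewrite -ball_mean_sum; last by move=> k; apply: tameM => //; exact: tame_cst.
  congr ball_mean; apply/funext => x.
  rewrite dotC /y dotDl (dotC _ x) dot_ebase (dotC _ x) dotZr dot_ebase exprDn mulr_suml.
  by apply: eq_bigr => k _; rewrite exprMn -mulr_natl; ring.
have := congr1 (fun r : {poly R} => r`_2) pq.
rewrite /p /q coef_poly coefZ.
have -> : (2 < n.+1)%N by rewrite /n mulnS.
have -> : ((1 + 'X^2) ^+ i.+1 : {poly R})`_2 = i.+1%:R.
  rewrite addrC exprDn coef_sum (bigD1 (inord i))//= inordK; last by rewrite ltnS leqnSn.
  rewrite subSnn expr1 expr1n mulr1 coefMn coefXn eqxx binSn.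
  rewrite big1 ?addr0 ?mulr_natl// => k ki; rewrite expr1n mulr1 coefMn -exprM coefXn.
  case: eqVneq => [/eqP|]; last by rewrite mul0rn.
  rewrite -[2%N in X in X == _]muln1 eqn_mul2l/= => /eqP ki1; case/eqP: ki; apply/val_inj.
  rewrite /= inordK ?ltnS ?leqnSn//; have := ltn_ord k; rewrite ltnS => kle.
  by have := subKn kle; rewrite -ki1 subn1.
move=> H; have i0n : i.+1%:R != 0 :> R by rewrite pnatr_eq0.
apply: (mulfI i0n); rewrite mulrC [RHS]mulrC -H /c.
have -> : (n - 2 = 2 * i)%N by rewrite /n mulnS addKn.
rewrite mulrAC; congr (_ * _); rewrite -natrM; congr (_%:R).
by rewrite bin2 /n mul2n -doubleMl doubleK mulnC -mul2n subn1.
Qed.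

(** One factor [|x|^2] is expanded as the sum of the squared
    coordinates. *)
Lemma axis_moment_rec i l :
  axis_moment i.+1 l * (2 * i%:R + d%:R) = (2 * i%:R + 1) * axis_moment i l.+1.
Proof.
have E1 : axis_moment i l.+1 = \sum_(j < d) ball_mean (fun x => (x : 'rV[R]_d) ord0 i0 ^+ (2 * i) *
     (x : 'rV[R]_d) ord0 j ^+ 2 * enorm x ^+ (2 * l)).
  rewrite -ball_mean_sum; last first.
    by move=> k; apply: tameM; [apply: tameM; apply: tameX; exact: tame_coord|apply: tameX; exact: tame_enorm].
  congr ball_mean; apply/funext => x; rewrite -mulr_suml -mulr_sumr -mulrA; congr (_ * _).
  rewrite mulnS exprD enorm_sqr; congr (_ * _).
have c0 : (2 * i.+1 - 1)%:R = 2 * i%:R + 1 :> R.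
  by rewrite mulnS addnC -addnBA // natrD natrM.
rewrite E1 (bigD1 i0)//= [RHS]mulrDr mulr_sumr.
rewrite (eq_bigr (fun=> axis_moment i.+1 l)); last first.
  by move=> j ji; rewrite -c0 moment_cross.
rewrite sumr_const.
have -> : ball_mean (fun x => (x : 'rV[R]_d) ord0 i0 ^+ (2 * i) *
     (x : 'rV[R]_d) ord0 i0 ^+ 2 * enorm x ^+ (2 * l)) = axis_moment i.+1 l.
  by congr ball_mean; apply/funext => x; rewrite -exprD mulnS addnC.
have -> : #|[pred j : 'I_d | j != i0]| = d.-1.
  have := cardC1 i0; rewrite card_ord => <-; apply: eq_card => j; by rewrite !inE.
have d0 : (0 < d)%N by case: (d) i0 => [[]|].
have dE : d%:R = d.-1%:R + 1 :> R by rewrite natr1 prednK.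
by rewrite -mulr_natr dE; ring.
Qed.

End moments.

(** * The overlap and the distance *)

Section geo.
Context {R : realType}.
Lemma prod_onem_lower (A B C : R) : 0 <= A <= 1 -> 0 <= B <= 1 -> 0 <= C <= 1 ->
  1 - (A + B + 2 * C) <= (1 - A) * (1 - B) * (1 - C) ^+ 2.
Proof.
move=> /andP[A0 A1] /andP[B0 B1] /andP[C0 C1].
have H (x y : R) : 0 <= x -> 0 <= y -> 0 <= x * y by exact: mulr_ge0.
have H1 : 1 - (A + B) <= (1 - A) * (1 - B) by have := H _ _ A0 B0; lra.
have H2 : 1 - 2 * C <= (1 - C) ^+ 2 by have := sqr_ge0 C; rewrite !expr2; lra.
have p1 : (1 - A) * (1 - B) <= 1 by have := H A (1 - B) A0 ltac:(lra); lra.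
have p0 : 0 <= (1 - A) * (1 - B) by apply: mulr_ge0; lra.
have q1 : (1 - C) ^+ 2 <= 1.
  by have := H C (1 - C) C0 ltac:(lra); rewrite !expr2; lra.
have := H (1 - (1 - A) * (1 - B)) (1 - (1 - C) ^+ 2) ltac:(lra) ltac:(lra).
lra.
Qed.

Lemma prod_onem_upper (A B C : R) : 0 <= A <= 1 -> 0 <= B <= 1 -> 0 <= C <= 1 ->
  (1 - A) * (1 - B) * (1 - C) ^+ 2 <= 1 - (A + B + 2 * C) + (A + B + 2 * C) ^+ 2.
Proof.
move=> /andP[A0 A1] /andP[B0 B1] /andP[C0 C1].
have H (x y : R) : 0 <= x -> 0 <= y -> 0 <= x * y by exact: mulr_ge0.
have E (x : R) : 0 <= x -> 1 - x <= expR (- x) by move=> _; exact: expR_ge1Dx.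
set S := A + B + 2 * C.
have S0 : 0 <= S by rewrite /S; lra.
apply: (@le_trans _ _ (expR (- S))).
  have -> : - S = - A + - B + (- C + - C) by rewrite /S; ring.
  rewrite !expRD expr2; apply: ler_pM; rewrite ?mulr_ge0 ?subr_ge0//; first by apply: ler_pM; rewrite ?subr_ge0 ?E.
  by apply: ler_pM; rewrite ?subr_ge0 ?E.
have D : 0 < 1 + S by lra.
rewrite expRN -div1r ler_pdivrMr ?expR_gt0//.
have T : 0 <= 1 - S + S ^+ 2.
  have := sqr_ge0 (S - 2^-1); rewrite !expr2; lra.
apply: (@le_trans _ _ ((1 - S + S ^+ 2) * (1 + S))); last by rewrite ler_wpM2l// expR_ge1Dx.
have := H S (S * S) S0 (H _ _ S0 S0); rewrite expr2; lra.
Qed.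

(** In use [A = 1 - |x|^2], [B = 1 - |y|^2] and [C = 1 + <x, y>], so that
    [4 - (A + B + 2 C)] is the squared distance and the product is the
    overlap. *)
Lemma far_overlap (A B C ep : R) : 0 <= A <= 1 -> 0 <= B <= 1 -> 0 <= C -> 0 <= ep -> ep < 2^-1 ->
  (2 - ep) ^+ 2 <= 4 - (A + B + 2 * C) ->
  C < 1 /\ 1 - 4 * ep <= (1 - A) * (1 - B) * (1 - C) ^+ 2.
Proof.
move=> hA hB C0 e0 e1; move/andP: (hA) => [A0 A1]; move/andP: (hB) => [B0 B1].
rewrite expr2 => H.
have S4 : A + B + 2 * C <= 4 * ep by have := sqr_ge0 ep; rewrite expr2; lra.
have C1 : C < 1 by lra.
split => //.
have hC : 0 <= C <= 1 by rewrite C0 ltW.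
have := prod_onem_lower hA hB hC; lra.
Qed.

(** The converse costs a quadratic term, the second order of the product;
    here [C <= 1] excludes pairs that are nearly equal instead of nearly
    antipodal, for which the overlap is also close to 1. *)
Lemma overlap_far (A B C h ep : R) : 0 <= A <= 1 -> 0 <= B <= 1 -> 0 <= C <= 1 -> 0 <= h -> 0 <= ep <= 2 ->
  h + 16 * h ^+ 2 <= 4 * ep - ep ^+ 2 ->
  1 - h <= (1 - A) * (1 - B) * (1 - C) ^+ 2 ->
  (2 - ep) ^+ 2 <= 4 - (A + B + 2 * C).
Proof.
move=> hA hB hC h0 /andP[e0 e2] he H.
move/andP: (hA) => [A0 A1]; move/andP: (hB) => [B0 B1]; move/andP: (hC) => [C0 C1].
have H0 (x y : R) : 0 <= x -> 0 <= y -> 0 <= x * y by exact: mulr_ge0.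
have M (x y : R) : 0 <= x -> 0 <= y -> y <= 1 -> x * y <= x by move=> *; exact: ler_piMr.
have C2 : 0 <= (1 - C) ^+ 2 <= 1.
  rewrite sqr_ge0/=; have := H0 C (1 - C) C0 ltac:(lra); rewrite !expr2; lra.
have /andP[C20 C21] := C2.
have AB0 : 0 <= (1 - A) * (1 - B) by apply: H0; lra.
have AB1 : (1 - A) * (1 - B) <= 1 - A by apply: M; lra.
have AB2 : (1 - A) * (1 - B) <= 1 - B by rewrite mulrC; apply: M; lra.
have VA := M _ _ AB0 C20 C21.
have hA' : A <= h by lra.
have hB' : B <= h by lra.
have hC' : C <= h.
  have : (1 - A) * (1 - B) * (1 - C) ^+ 2 <= (1 - C) ^+ 2.
    by apply: ler_piMl => //; lra.
  have : (1 - C) ^+ 2 <= 1 - C by rewrite expr2; apply: M; lra.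
  lra.
have U := prod_onem_upper hA hB hC.
set S := A + B + 2 * C in U *.
have S4 : S <= 4 * h by rewrite /S; lra.
have S0 : 0 <= S by rewrite /S; lra.
have S2 : S ^+ 2 <= 16 * h ^+ 2.
  have : S * S <= (4 * h) * (4 * h) by apply: ler_pM.
  rewrite !expr2; lra.
rewrite expr2 in he *; lra.
Qed.
End geo.

(** * Cells and atoms *)

Lemma measure_finite_union dT (T : measurableType dT) (R : realType)
    (mu : {measure set T -> \bar R}) (I : finType) (P : pred I) (F : I -> set T) :
  (forall i, measurable (F i)) -> (forall i j x, F i x -> F j x -> i = j) ->
  mu [set x | exists2 i, P i & F i x] = (\sum_(i | P i) mu (F i))%E.
Proof.
move=> mF dF.
suff H (s : seq I) : uniq s ->
    measurable [set x | exists2 i, i \in s & F i x] /\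
    mu [set x | exists2 i, i \in s & F i x] = (\sum_(i <- s) mu (F i))%E.
  have [_] := H [seq i <- index_enum I | P i] (filter_uniq _ (index_enum_uniq _)).
  rewrite big_filter => <-; congr (mu _); apply/seteqP; split => x /= [i Pi Fi]; exists i => //.
    by rewrite mem_filter Pi mem_index_enum.
  by move: Pi; rewrite mem_filter => /andP[].
elim: s => [|a s IH] /=.
  move=> _; have -> : [set x | exists2 i, i \in [::] & F i x] = set0.
    by apply/seteqP; split => x //= [].
  by rewrite measure0 big_nil.
move=> /andP[aNs us]; have [ms mus] := IH us.
have E : [set x | exists2 i, i \in a :: s & F i x] = F a `|` [set x | exists2 i, i \in s & F i x].
  apply/seteqP; split => x /=.
    by move=> [i]; rewrite inE => /orP[/eqP ->|si] Fi; [left|right; exists i].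
  by move=> [Fa|[i si Fi]]; [exists a; rewrite ?inE ?eqxx|exists i; rewrite // inE si orbT].
rewrite E; split; first exact: measurableU.
rewrite big_cons -mus measureU//.
apply/seteqP; split => x //= -[Fa [i si Fi]].
by move: aNs; rewrite (dF _ _ _ Fa Fi) si.
Qed.

Section cells.
Context {R : realType} {d : nat}.
Notation T := (borel_space R d).
Local Notation B := (@unit_ball R d).
Variable K : nat.
Hypothesis K0 : (0 < K)%N.

Definition cell_index := {ffun 'I_d -> 'I_(2 * K).+1}.
(** Half-open cubes of side [1 / K], indexed by the integer parts of the
    coordinates, which range over [[0, 2 K]] on the unit ball. *)
Definition cell (c : cell_index) : set T :=
  [set x : T | B x /\ forall i, (c i)%:R <= K%:R * ((x : 'rV[R]_d) ord0 i + 1) < (c i).+1%:R].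

Lemma measurable_cell c : measurable (cell c).
Proof.
have -> : cell c = B `&` \bigcap_(i in [set: 'I_d])
    ((fun x : T => K%:R * ((x : 'rV[R]_d) ord0 i + 1)) @^-1` `[(c i)%:R, (c i).+1%:R[%classic).
  apply/seteqP; split => x /=.
    by move=> [Bx H]; split => // i _ /=; rewrite in_itv/=.
  by move=> [Bx H]; split => // i; have := H i Logic.I; rewrite /= in_itv.
apply: measurableI => //; apply: fin_bigcap_measurable; first exact: finite_finset.
move=> i _; rewrite -[X in measurable X]setTI.
have : measurable_fun [set: T] (fun x : T => K%:R * ((x : 'rV[R]_d) ord0 i + 1)).
  apply: measurable_funM => //; apply: measurable_funD => //; exact: measurable_coord.
by apply => //; exact: measurable_itv.
Qed.

Lemma cell_disj c c' x : cell c x -> cell c' x -> c = c'.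
Proof.
move=> [_ H] [_ H']; apply/ffunP => i; apply/val_inj/eqP.
have /andP[a b] := H i; have /andP[a' b'] := H' i.
have := le_lt_trans a b'; have := le_lt_trans a' b.
by rewrite !ltr_nat !ltnS eqn_leq => -> ->.
Qed.

Lemma coord_le1 (x : T) i : B x -> `|(x : 'rV[R]_d) ord0 i| <= 1.
Proof.
rewrite /unit_ball/= => x1.
rewrite -sqrtr_sqr (le_trans _ x1)// ler_wsqrtr// (bigD1 i)//= lerDl.
by apply: sumr_ge0 => j _; exact: sqr_ge0.
Qed.

Lemma cell_cover x : B x -> exists c, cell c x.
Proof.
move=> Bx; pose f (i : 'I_d) := Num.truncn (K%:R * ((x : 'rV[R]_d) ord0 i + 1)).
have f0 i : 0 <= K%:R * ((x : 'rV[R]_d) ord0 i + 1).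
  by rewrite mulr_ge0//; have := coord_le1 i Bx; rewrite ler_norml; lra.
have f2 i : (f i < (2 * K).+1)%N.
  rewrite truncn_lt_nat// -natr1 natrM; have := coord_le1 i Bx; rewrite ler_norml => /andP[_ H].
  have : K%:R * ((x : 'rV[R]_d) ord0 i + 1) <= K%:R * 2 by rewrite ler_wpM2l//; lra.
  lra.
exists [ffun i => Ordinal (f2 i)]; split => // i; rewrite ffunE/=.
exact: truncn_itv.
Qed.

Lemma cell_diam c (x y : 'rV[R]_d) : cell c x -> cell c y -> enorm (x - y) <= d%:R / K%:R.
Proof.
move=> [_ H] [_ H'].
have Kp : 0 < K%:R :> R by rewrite ltr0n.
have dK : 0 <= d%:R / K%:R :> R by rewrite divr_ge0.
have b i : (x - y) ord0 i ^+ 2 <= K%:R^-1 ^+ 2.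
  rewrite !mxE -real_normK ?num_real// lerXn2r ?nnegrE ?invr_ge0//.
  have /andP[a1 a2] := H i; have /andP[a3 a4] := H' i.
  rewrite -(ler_pM2l Kp) divff ?gt_eqF// -[X in X * _](gtr0_norm Kp) -normrM ler_norml.
  rewrite -natr1 in a2 a4; lra.
rewrite -(@ler_pXn2r _ 2)// ?nnegrE ?enorm_ge0// enorm_sqr.
apply: (@le_trans _ _ (\sum_(i < d) K%:R^-1 ^+ 2)).
  by apply: ler_sum => i _; rewrite -expr2.
rewrite sumr_const card_ord exprMn -[leLHS]mulr_natl ler_wpM2r ?exprn_ge0 ?invr_ge0//.
by rewrite -natrX ler_nat; case: (d) => // d'; rewrite leq_pmulr.
Qed.
End cells.

Section atoms.
Context {R : realType} {d : nat}.
Notation T := (borel_space R d).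
Local Notation B := (@unit_ball R d).
Variable nu : {measure set T -> \bar R}.
Hypothesis nu_count : forall A : set T, measurable A -> exists k : nat, nu A = k%:R%:E.
Hypothesis nu_ball : nu (~` B) = 0%E.

Lemma charged_cell (K : nat) (A : set T) : (0 < K)%N -> measurable A -> nu A <> 0%E ->
  exists c, nu (A `&` cell (K := K) c) <> 0%E.
Proof.
move=> K0 mA; apply: contra_notP => /forallNP H.
have N1 : nu.-negligible (~` B) by apply/negligibleP => //; exact: measurableC.
have mc c : measurable (A `&` cell (K := K) c) by apply: measurableI => //; exact: measurable_cell.
have N2 : nu [set x | exists2 c, xpredT c & (A `&` cell (K := K) c) x] = 0%E.
  rewrite measure_finite_union//; first by rewrite big1// => c _; exact: contrapT (H c).
  by move=> c c' x [_ h] [_ h']; exact: cell_disj h h'.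
have mU : measurable [set x | exists2 c, xpredT c & (A `&` cell (K := K) c) x].
  have -> : [set x | exists2 c, xpredT c & (A `&` cell (K := K) c) x] =
      \bigcup_(c in [set: cell_index (d := d) K]) (A `&` cell (K := K) c).
    by apply/seteqP; split => x [c _ h]; exists c.
  by apply: fin_bigcup_measurable => //; exact: finite_finset.
apply/negligibleP => //; apply: negligibleS (negligibleU N1 (proj2 (negligibleP _ mU) N2)).
move=> x Ax; have [Bx|nBx] := pselect (B x); [right|by left].
by have [c cx] := cell_cover K Bx; exists c.
Qed.

(** A counting measure has an atom in every set that it charges: take a
    charged subset of minimal measure. For every mesh one cell carries all of
    it, and these cells shrink to a point. *)
Lemma charged_atom (A : set T) : measurable A -> nu A <> 0%E ->
  exists x, [/\ A x, B x & (0 < nu [set x])%E].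
Proof.
move=> mA nA.
(* The positive values taken by [nu] on the measurable subsets of [A]. *)
pose P (n : nat) := `[< (0 < n)%N /\ exists A' : set T, [/\ measurable A', A' `<=` A & nu A' = n%:R%:E] >].
have exP : exists n, P n.
  have [k kE] := nu_count mA; exists k; apply/asboolP; split; last by exists A; split.
  by rewrite lt0n; apply/eqP => k0; apply: nA; rewrite kE k0.
case: (ex_minnP exP) => n /asboolP[n0 [A' [mA' A'A nE]]] nmin.
have H K : exists c : cell_index (d := d) K.+1, nu (A' `\` cell c) = 0%E.
  have [|c cN] := @charged_cell K.+1 A' isT mA'.
    by rewrite nE => -[] /eqP; rewrite pnatr_eq0 => /eqP n0'; rewrite n0' in n0.
  exists c; have mc := @measurable_cell R d K.+1 c.
  have mI : measurable (A' `&` cell c) by exact: measurableI.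
  have [k kE] := nu_count mI.
  have [l lE] := nu_count (measurableD mA' mc).
  have nk : (n <= k)%N.
    apply: nmin; apply/asboolP; split; last by exists (A' `&` cell c); split => // x [/A'A].
    by rewrite lt0n; apply/eqP => k0; apply: cN; rewrite kE k0.
  have sE : nu A' = (nu (A' `\` cell c) + nu (A' `&` cell c))%E.
    rewrite -measureU//; [by rewrite setUC setUIDK|exact: measurableD|].
    by apply/seteqP; split => x //= [[_ h] [_ h']].
  move: sE; rewrite nE kE lE -EFinD => -[] /eqP; rewrite -natrD eqr_nat => /eqP E.
  have -> : l = 0%N by apply/eqP; rewrite -leqn0 -(leq_add2r k) add0n -E.
  by [].
pose c K := sval (cid (H K)); have cH K : nu (A' `\` cell (c K)) = 0%E := svalP (cid (H K)).
pose C := A' `&` \bigcap_K cell (c K).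
have mC : measurable C.
  by apply: measurableI => //; apply: bigcapT_measurable => K; exact: measurable_cell.
have CE : nu C = n%:R%:E.
  have N : nu (A' `\` C) = 0%E.
    apply/negligibleP; first exact: measurableD.
    apply: (@negligibleS _ _ _ _ (\bigcup_K (A' `\` cell (c K)))).
      move=> x [Ax nC]; apply: contrapT => nU; apply: nC; split => // K _.
      by apply: contrapT => ncK; apply: nU; exists K.
    apply: negligible_bigcup => K; apply/negligibleP; last exact: cH.
    by apply: measurableD => //; exact: measurable_cell.
  have sE : nu A' = (nu (A' `\` C) + nu C)%E.
    rewrite -measureU//; [|exact: measurableD|].
      congr (nu _); apply/seteqP; split => x.
        by move=> Ax; have [Cx|nCx] := pselect (C x); [right|left].
      by move=> [[]|[]].
    by apply/seteqP; split => x //= [[_ h] h'].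
  by move: sE; rewrite N add0e nE.
have [x Cx] : exists x, C x.
  apply: contrapT => /forallNP Cn.
  have C0 : C = set0 by apply/seteqP; split => // x /Cn.
  by move: CE; rewrite C0 measure0 => -[] /eqP; rewrite eq_sym pnatr_eq0 => /eqP n0'; rewrite n0' in n0.
have C1 : C = [set x].
  apply/seteqP; split => y; last by move=> ->.
  move=> Cy /=; apply/eqP; rewrite -subr_eq0; apply/eqP/enorm_eq0.
  apply/eqP; rewrite eq_le enorm_ge0 andbT; apply/ler_addgt0Pl => e e0; rewrite addr0.
  pose K := Num.truncn (d%:R / e).
  have Hd : enorm ((y : 'rV[R]_d) - x) <= d%:R / K.+1%:R.
    by apply: (@cell_diam R d K.+1 isT (c K)); [have [_ h] := Cy|have [_ h] := Cx]; exact: h.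
  apply: (le_trans Hd); rewrite ler_pdivrMr// mulrC -ler_pdivrMr//.
  have := @truncn_itv R (d%:R / e) (divr_ge0 (ler0n _ _) (ltW e0)).
  by move=> /andP[_ /ltW].
have [Ax Hc] := Cx.
exists x; split; [exact: A'A|by have [] := Hc 0%N Logic.I|].
by rewrite -C1 CE lte_fin ltr0n.
Qed.

Lemma diam_pairs (s e : R) : 0 < s -> 0 < e -> s <= diam (points nu) ->
  exists x y, [/\ (0 < nu [set x])%E, (0 < nu [set y])%E & s - e < enorm (x - y)].
Proof.
move=> s0 e0 sd; pose S := [set r : R | exists x y, [/\ points nu x, points nu y & r = enorm (x - y)]].
have hs : has_sup S.
  apply: contrapT => /sup_out S0; move: sd; rewrite /diam S0 => /(lt_le_trans s0).
  by rewrite ltxx.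
have [r [x [y [px py ->]]] rs] := sup_adherent e0 hs.
exists x, y; split => //; apply: le_lt_trans rs; rewrite lerD2r; exact: sd.
Qed.

Lemma atom_ball (x : 'rV[R]_d) : measurable ([set x] : set T) -> (0 < nu [set x])%E -> B x.
Proof.
move=> mx; apply: contraPP => nB; apply/negP; rewrite -leNgt -nu_ball.
apply: le_measure; rewrite ?inE//; first exact: measurableC.
by move=> y ->.
Qed.

Lemma diam_ge (x y : 'rV[R]_d) : (forall z : 'rV[R]_d, (0 < nu [set z])%E -> B z) ->
  (0 < nu [set x])%E -> (0 < nu [set y])%E ->
  enorm (x - y) <= diam (points nu).
Proof.
move=> aB px py; apply: ub_le_sup; last by exists x, y.
exists 2 => r [u [v [pu pv ->]]].
have := enorm_triangle u (- v); rewrite enormN => H; apply: (le_trans H).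
by have := lerD (aB _ pu) (aB _ pv).
Qed.
End atoms.

(** * Occupied cells of a Poisson process *)

Section poisson.
Context {R : realType} {d : nat}.
Notation T := (borel_space R d).
Local Notation B := (@unit_ball R d).
Context dO {Omega : measurableType dO} (P : probability Omega R).
Variables (kappa : probability T R) (n : nat) (N : R.-ker Omega ~> T).
Hypothesis HN : poisson_process P B (mscale (n%:R%:nng : {nonneg R}) kappa) N.

Definition mass (A : set T) : R := fine (kappa A).

Lemma massE A : measurable A -> kappa A = (mass A)%:E.
Proof. by move=> mA; rewrite /mass fineK// fin_num_measure. Qed.

Lemma mass_ge0 A : 0 <= mass A.
Proof. by rewrite /mass fine_ge0. Qed.

Lemma mass_le A A' : measurable A -> measurable A' -> A `<=` A' -> mass A <= mass A'.
Proof. by move=> mA mA' AA'; rewrite -lee_fin -!massE// le_measure ?inE. Qed.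

Lemma void_probability A : measurable A ->
  P [set w | N w A = 0%E] = (expR (- (n%:R * mass A)))%:E.
Proof.
move=> mA; have /(_ 0%N) := poisson_process_law HN mA.
have -> : fine (mscale (n%:R%:nng : {nonneg R}) kappa A) = n%:R * mass A.
  by rewrite /mscale/= massE//.
move=> ->; rewrite /poisson_prob; case: ifPn => [pos|].
  by rewrite esum_set1 ?lee_fin ?poisson_pmf_ge0// /poisson_pmf pos expr0 fact0 invr1 !mul1r.
rewrite -leNgt => neg; have -> : n%:R * mass A = 0.
  by apply/eqP; rewrite eq_le neg mulr_ge0 ?mass_ge0.
by rewrite oppr0 expR0 diracE mem_set.
Qed.

Variable K : nat.
Hypothesis K0 : (0 < K)%N.
Local Notation I := (cell_index (d := d) K).
Local Notation delta := (d%:R / K%:R : R).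

Definition edge (s : R) : rel I := fun c c' =>
  `[< exists x y : 'rV[R]_d, [/\ cell c x, cell c' y & s <= enorm (x - y)] >].
Definition occupied (w : Omega) : {set I} := finset (fun c : I => N w (cell c) != 0%E).
(** Some two occupied cells contain points at distance at least [s]. *)
Definition linked (s : R) : set Omega := [set w | ~~ edgeless (edge s) (occupied w)].

Lemma linkedP s w : linked s w <->
  exists c c', [/\ edge s c c', N w (cell c) <> 0%E & N w (cell c') <> 0%E].
Proof.
split.
  rewrite /linked/= /edgeless negb_forall => /existsP[c]; rewrite negb_imply => /andP[oc].
  rewrite negb_forall => /existsP[c']; rewrite negb_imply negbK => /andP[oc' e].
  by exists c, c'; split => //; apply/eqP; move: oc oc'; rewrite !inE.
move=> [c [c' [e /eqP oc /eqP oc']]]; rewrite /linked/= /edgeless negb_forall.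
apply/existsP; exists c; rewrite negb_imply !inE oc/= negb_forall.
by apply/existsP; exists c'; rewrite negb_imply !inE oc'/= negbK.
Qed.

Lemma measurable_occupied (g : {set I} -> bool) : measurable [set w | g (occupied w)].
Proof.
have -> : [set w | g (occupied w)] = \bigcup_(S in [set S | g S])
    \bigcap_(c in [set: I]) [set w | (N w (cell c) != 0%E) = (c \in S)].
  apply/seteqP; split => w /=.
    by move=> gw; exists (occupied w) => // c _ /=; rewrite inE.
  move=> [S gS H]; suff -> : occupied w = S by [].
  by apply/setP => c; rewrite inE; exact: H.
apply: fin_bigcup_measurable; first exact: finite_finset.
move=> S _; apply: fin_bigcap_measurable; first exact: finite_finset.
move=> c _; have mk := measurable_kernel N (cell c) (@measurable_cell R d K c).
have m0 : measurable [set w | N w (cell c) = 0%E].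
  by rewrite -[X in measurable X]setTI; exact: (mk measurableT [set 0%E] (emeasurable_set1 _)).
case: (boolP (c \in S)) => cS.
  rewrite (_ : [set w | _] = ~` [set w | N w (cell c) = 0%E]); first exact: measurableC.
  by apply/seteqP; split => w /= /eqP.
rewrite (_ : [set w | _] = [set w | N w (cell c) = 0%E])//.
by apply/seteqP; split => w /= => [/negbFE/eqP|->]; rewrite ?eqxx.
Qed.

Lemma measurable_linked s : measurable (linked s).
Proof. exact: (measurable_occupied (fun S => ~~ edgeless (edge s) S)). Qed.

Let pr (g : {set I} -> bool) : R := fine (P [set w | g (occupied w)]).

Let prE (g : {set I} -> bool) : P [set w | g (occupied w)] = (pr g)%:E.
Proof. by rewrite /pr fineK// fin_num_measure//; exact: measurable_occupied. Qed.

Let pr_ge0 (g : {set I} -> bool) : 0 <= pr g. Proof. by rewrite /pr fine_ge0. Qed.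

Let pr_split (g h : {set I} -> bool) :
  pr g = pr (fun S => g S && h S) + pr (fun S => g S && ~~ h S).
Proof.
have m1 := measurable_occupied (fun S => g S && h S).
have m2 := measurable_occupied (fun S => g S && ~~ h S).
apply: EFin_inj; rewrite EFinD -!prE.
transitivity (P ([set w | g (occupied w) && h (occupied w)] `|` [set w | g (occupied w) && ~~ h (occupied w)])).
  congr (P _); apply/seteqP; split => w /=.
    by move=> gw; rewrite gw/=; case: (h _); [left|right].
  by move=> [/andP[]|/andP[]].
rewrite measureU//.
by apply/seteqP; split => w //= [/andP[_ hw] /andP[_]]; rewrite hw.
Qed.

Let rho (c : I) : R := n%:R * mass (cell c).

Let rho_ge0 c : 0 <= rho c. Proof. by rewrite mulr_ge0 ?mass_ge0. Qed.

Let mass_union (U : {pred I}) :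
  measurable [set x : T | exists2 c, c \in U & cell c x] /\
  n%:R * mass [set x : T | exists2 c, c \in U & cell c x] = \sum_(c in U) rho c.
Proof.
have mU : measurable [set x : T | exists2 c, c \in U & cell c x].
  rewrite (_ : [set x | _] = \bigcup_(c in [set c | c \in U]) cell c); last first.
    by apply/seteqP; split => x [c cU cx]; exists c.
  by apply: fin_bigcup_measurable; [exact: finite_finset|move=> c _; exact: measurable_cell].
split => //; rewrite -mulr_sumr; congr (_ * _); apply: EFin_inj.
rewrite -massE// (@measure_finite_union _ _ _ kappa _ (mem U) (@cell R d K)).
- by rewrite -sumEFin; apply: eq_bigr => c _; apply: massE; exact: measurable_cell.
- by move=> c; exact: measurable_cell.
- by move=> c c' x h h'; exact: cell_disj h h'.
Qed.

Let pr_void (U : {set I}) :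
  pr (fun S => S :&: U == finset.set0) = expR (- \sum_(i in U) rho i).
Proof.
have [mU <-] := mass_union (mem U); apply: EFin_inj; rewrite -prE -void_probability//.
have mc c : measurable (@cell R d K c) by exact: measurable_cell.
congr (P _); apply/seteqP; split => w /=.
  move=> /eqP H; apply/negligibleP => //.
  rewrite (_ : [set x | _] = \bigcup_(k in [set k : nat | True]) (if insub k is Some i then if (i : 'I_#|I|) \in [pred i | enum_val i \in U] then cell (enum_val i) else set0 else set0)); last first.
    apply/seteqP; split => x /=.
      move=> [c cU cx]; exists (enum_rank c) => //=; rewrite insubT ?ltn_ord//= => lt.
      have -> : Sub (enum_rank c : nat) lt = enum_rank c by exact/val_inj.
      by rewrite inE enum_rankK cU.
    move=> [k _]; case: insubP => // i _ _; rewrite inE; case: ifP => // iU cx.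
    by exists (enum_val i).
  apply: negligible_bigcup => k; case: insubP => [i _ _|_]; last exact: negligible_set0.
  rewrite inE; case: ifP => iU; last exact: negligible_set0.
  apply/negligibleP => //; apply/eqP; apply/negPn/negP => nz.
  have := finset.in_set0 (enum_val i); rewrite -H !inE iU nz//.
move=> H; apply/eqP/setP => c; rewrite !inE; apply/negP => /andP[/eqP oc cU]; apply: oc.
apply/eqP; rewrite -measure_le0 -H; apply: le_measure; rewrite ?inE//.
by move=> x cx; exists c.
Qed.

Definition far (s : R) (x : 'rV[R]_d) : set T :=
  B `&` [set y : T | s <= enorm ((y : 'rV[R]_d) - x)].
Definition far_pair_set (s : R) : set (T * T) :=
  [set z | [/\ B z.1, B z.2 & s <= enorm ((z.1 : 'rV[R]_d) - z.2)]].
Definition pair_law : probability (T * T)%type R := (kappa \x kappa)%E.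
Definition far_pairs (s : R) : R := fine (pair_law (far_pair_set s)).

Lemma measurable_far s x : measurable (far s x).
Proof.
apply: measurableI => //.
have mf : measurable_fun [set: T] (fun y : T => enorm ((y : 'rV[R]_d) - x)).
  apply: (measurableT_comp measurable_sqrt); apply: measurable_sum => i.
  apply: measurable_funX; under eq_fun do rewrite !mxE.
  by apply: measurable_funB => //; exact: measurable_coord.
rewrite (_ : [set y | _] = [set: T] `&` ((fun y : T => enorm ((y : 'rV[R]_d) - x)) @^-1` `[s, +oo[%classic)).
  by apply: mf => //; exact: measurable_itv.
by apply/seteqP; split => y /=; rewrite in_itv/= andbT => // -[].
Qed.

Lemma measurable_far_pair_set s : measurable (far_pair_set s).
Proof.
rewrite (_ : far_pair_set s = (B `*` B) `&` ([set: T * T] `&`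
    ((fun z : T * T => enorm ((z.1 : 'rV[R]_d) - z.2)) @^-1` `[s, +oo[%classic))).
  apply: measurableI; first exact: measurableX.
  by apply: measurable_dist2 => //; exact: measurable_itv.
by apply/seteqP; split => z /=; rewrite in_itv/= andbT; [move=> [? ? ?]|move=> [[? ?] [_ ?]]].
Qed.

Lemma enorm_sub_sym (x y : 'rV[R]_d) : enorm (x - y) = enorm (y - x).
Proof. by rewrite -opprB enormN. Qed.

Lemma edge_close s c c' (x y : 'rV[R]_d) : edge s c c' -> cell c x -> cell c' y ->
  s - 2 * delta <= enorm (x - y).
Proof.
move=> /asboolP[x' [y' [cx' cy' sxy]]] cx cy.
have H1 := @cell_diam R d K K0 c x' x cx' cx.
have H2 := @cell_diam R d K K0 c' y y' cy cy'.
have E : x' - y' = (x' - x) + ((x - y) + (y - y')).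
  by rewrite !addrA !subrK.
have := enorm_triangle (x' - x) ((x - y) + (y - y')).
have := enorm_triangle (x - y) (y - y').
rewrite -E; lra.
Qed.

Variables (s tau : R).
Hypothesis s_delta : delta < s.
Hypothesis tau_ge0 : 0 <= tau.
Hypothesis tau_le : tau <= 3^-1.
Hypothesis far_tau : forall x : 'rV[R]_d, B x -> n%:R * mass (far (s - 2 * delta) x) <= tau.

Let e_sym : symmetric (edge s).
Proof.
move=> c c'; apply/asboolP/asboolP => -[x [y [cx cy H]]];
  by exists y, x; split => //; rewrite enorm_sub_sym.
Qed.

Let e_irr : irreflexive (edge s).
Proof.
move=> c; apply/asboolP => -[x [y [cx cy H]]].
by have := le_lt_trans (le_trans H (@cell_diam R d K K0 c x y cx cy)) s_delta; rewrite ltxx.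
Qed.

Let deg_le v : \sum_(u | edge s v u) rho u <= tau.
Proof.
case: (pselect (exists x, @cell R d K v x)) => [[x cx]|H]; last first.
  rewrite big1// => u /asboolP[x [y [cx _ _]]]; by case: H; exists x.
have [mU <-] := mass_union [pred u | edge s v u].
have Bx : B x by have [] := cx.
apply: le_trans (far_tau Bx); rewrite ler_wpM2l//; apply: mass_le => //.
  exact: measurable_far.
move=> y [u eu0 cy]; have eu : edge s v u by exact: eu0.
split; first by have [] := cy.
by rewrite /= enorm_sub_sym; exact: edge_close eu cx cy.
Qed.

Let mass_cells (r : R) : (far_pairs r)%:E =
  (\sum_(p : I * I) pair_law (far_pair_set r `&` (cell p.1 `*` cell p.2)))%E.
Proof.
rewrite -(@measure_finite_union _ _ _ pair_law _ xpredT (fun p : I * I => far_pair_set r `&` (cell p.1 `*` cell p.2))).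
- rewrite /far_pairs fineK; first congr (_ _).
    apply/seteqP; split => z /=.
      move=> H; have [B1 B2 _] := H.
      have [c1 h1] := cell_cover K B1; have [c2 h2] := cell_cover K B2.
      by exists (c1, c2).
    by move=> [p _ []].
  by apply: fin_num_measure; exact: measurable_far_pair_set.
- move=> p; apply: measurableI; first exact: measurable_far_pair_set.
  by apply: measurableX; exact: measurable_cell.
- move=> [a b] [a' b'] z [_ [/= h1 h2]] [_ [/= h1' h2']].
  by rewrite (cell_disj h1 h1') (cell_disj h2 h2').
Qed.

(** Both sides count pairs of cells; a pair of joined cells differs from
    the set of far pairs by the cell diameters. *)
Let mass_bounds : n%:R ^+ 2 * far_pairs s <= edge_mass (edge s) rho [set: I]%SET <=
  n%:R ^+ 2 * far_pairs (s - 2 * delta).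
Proof.
have ME : edge_mass (edge s) rho [set: I]%SET =
    n%:R ^+ 2 * \sum_(p : I * I | edge s p.1 p.2) mass (cell p.1) * mass (cell p.2).
  rewrite /edge_mass mulr_sumr.
  under eq_bigl do rewrite inE.
  under eq_bigr => i _ do under eq_bigl do rewrite inE/=.
  rewrite pair_big_dep/=; apply: eq_bigr => p _; rewrite /rho; ring.
have cc (p : I * I) : pair_law (cell p.1 `*` cell p.2) = (mass (cell p.1) * mass (cell p.2))%:E.
  rewrite /pair_law/= product_measure1E ?EFinM -?massE//; exact: measurable_cell.
have mc (p : I * I) : measurable (@cell R d K p.1 `*` @cell R d K p.2).
  by apply: measurableX; exact: measurable_cell.
have mfc (p : I * I) r : measurable (far_pair_set r `&` (@cell R d K p.1 `*` @cell R d K p.2)).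
  by apply: measurableI => //; exact: measurable_far_pair_set.
rewrite ME; apply/andP; split; rewrite ler_wpM2l ?exprn_ge0// -lee_fin mass_cells -sumEFin.
  rewrite [leRHS]big_mkcond/=; apply: lee_sum => p _.
  case: ifPn => ep; first by rewrite -cc; apply: le_measure; rewrite ?inE//; exact: subIsetr.
  rewrite (_ : _ `&` _ = set0) ?measure0//; apply/seteqP; split => // z [[_ _ H] [/= h1 h2]].
  by move/asboolP: ep; apply; exists z.1, z.2.
rewrite big_mkcond/=; apply: lee_sum => p _; case: ifPn => ep //.
rewrite -cc; apply: le_measure; rewrite ?inE//.
move=> z [/= h1 h2]; split => //; split; [by have [] := h1|by have [] := h2|].
exact: edge_close ep h1 h2.
Qed.

(** [edgeless_bounds] for the graph on the cells, whose degrees are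
    controlled by the mass of the far partners of a point. *)
Lemma linked_bounds :
  1 - expR (- ((1 - 3 * tau) * (n%:R ^+ 2 * far_pairs s / 2))) <= fine (P (linked s)) <=
  1 - expR (- ((1 + tau) * (n%:R ^+ 2 * far_pairs (s - 2 * delta) / 2))).
Proof.
have /andP[L U] := edgeless_bounds e_sym e_irr rho_ge0 deg_le tau_le pr_ge0 pr_split pr_void [set: I]%SET.
have ZE : edgeless_prob (edge s) pr [set: I]%SET = pr (edgeless (edge s)).
  by rewrite /edgeless_prob; congr (fine (P _)); apply/seteqP; split => w /=; rewrite finset.setIT.
have PE : fine (P (linked s)) = 1 - pr (edgeless (edge s)).
  have -> : linked s = ~` [set w | edgeless (edge s) (occupied w)].
    by apply/seteqP; split => w /=; rewrite /linked/= => /negP.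
  by rewrite probability_setC ?prE//; exact: measurable_occupied.
have /andP[m1 m2] := mass_bounds.
rewrite PE -ZE; apply/andP; split; rewrite lerD2l lerN2.
  apply: (le_trans U); rewrite ler_expR lerN2 ler_wpM2l//; first by have := tau_le; lra.
  by rewrite ler_pM2r.
apply: le_trans L; rewrite ler_expR lerN2 ler_wpM2l//; first by have := tau_ge0; lra.
by rewrite ler_pM2r.
Qed.

End poisson.

(** * The diameter of a Poisson process *)

Section diamlaw.
Context {R : realType} {d : nat}.
Notation T := (borel_space R d).
Local Notation B := (@unit_ball R d).
Context dO {Omega : measurableType dO} (P : probability Omega R).
Variables (kappa : probability T R) (n : nat) (N : R.-ker Omega ~> T).
Hypothesis HN : poisson_process P B (mscale (n%:R%:nng : {nonneg R}) kappa) N.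

Lemma measurable_point (x : 'rV[R]_d) : measurable ([set x] : set T).
Proof.
rewrite (_ : [set x] = \bigcap_(i in [set: 'I_d]) ([set: T] `&`
  ((fun y : T => (y : 'rV[R]_d) ord0 i) @^-1` [set x ord0 i]))).
  apply: fin_bigcap_measurable; first exact: finite_finset.
  by move=> i _; apply: measurable_coord => //; exact: measurable_set1.
apply/seteqP; split => y /=; first by move=> -> i _.
by move=> H; apply/rowP => i; have [] := H i Logic.I.
Qed.

Let ballP w (z : 'rV[R]_d) : (0 < N w [set z])%E -> B z.
Proof. by apply: atom_ball; [exact: (poisson_process_on HN)|exact: measurable_point]. Qed.

Lemma linked_diam K s w : (0 < K)%N -> linked N K s w ->
  s - 2 * (d%:R / K%:R) <= diam (points (N w)).
Proof.
move=> K0 /linkedP[c [c' [e oc oc']]].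
have nuc A : measurable A -> exists k : nat, N w A = k%:R%:E := poisson_process_counting HN w (A := A).
have nub := poisson_process_on HN w.
have [x [cx _ px]] := charged_atom nuc nub (measurable_cell c) oc.
have [y [cy _ py]] := charged_atom nuc nub (measurable_cell c') oc'.
apply: (le_trans (edge_close K0 e cx cy)); apply: diam_ge => //; exact: ballP.
Qed.

Lemma diam_linked K (s e : R) w : 0 < s -> 0 < e -> s <= diam (points (N w)) ->
  linked N K (s - e) w.
Proof.
move=> s0 e0 sd; have [x [y [px py H]]] := diam_pairs s0 e0 sd.
have [c cx] := cell_cover K (ballP px); have [c' cy] := cell_cover K (ballP py).
apply/linkedP; exists c, c'; split.
- by apply/asboolP; exists x, y; split => //; exact: ltW.
- apply/eqP; rewrite gt_eqF//; apply: (lt_le_trans px); apply: le_measure; rewrite ?inE.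
  + exact: measurable_point.
  + exact: measurable_cell.
  + by move=> z ->.
- apply/eqP; rewrite gt_eqF//; apply: (lt_le_trans py); apply: le_measure; rewrite ?inE.
  + exact: measurable_point.
  + exact: measurable_cell.
  + by move=> z ->.
Qed.

Definition diam_event s : set Omega := [set w | s <= diam (points (N w))].

(** The diameter involves uncountably many pairs of points; the cells of
    mesh [1 / k] reduce it to countably many events. *)
Lemma measurable_diam_event s : 0 < s -> measurable (diam_event s).
Proof.
move=> s0; have -> : diam_event s = \bigcap_k linked N k.+1 (s - k.+1%:R^-1).
  apply/seteqP; split => w.
    by move=> sd k _; apply: diam_linked.
  move=> H; rewrite /diam_event/=; apply/ler_addgt0Pl => e e0.
  pose k := Num.truncn ((1 + 2 * d%:R) / e).
  have := linked_diam (ltn0Sn k) (H k Logic.I).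
  have dd : 0 <= (1 + 2 * d%:R) / e by rewrite divr_ge0 ?ltW// addr_ge0// mulr_ge0.
  have /andP[_] := truncn_itv dd; rewrite -/k ltr_pdivrMr// => kH.
  have k0 : 0 < k.+1%:R :> R by rewrite ltr0n.
  have : k.+1%:R^-1 + 2 * (d%:R / k.+1%:R) <= e.
    rewrite (_ : _ + _ = (1 + 2 * d%:R) / k.+1%:R); last by ring.
    by rewrite ler_pdivrMr// (mulrC e) ltW.
  by set u := _^-1; set v := _ / _; set D := diam _ => h1 h2; lra.
by apply: bigcapT_measurable => k; exact: measurable_linked.
Qed.

Lemma far_mono (s s' : R) (x : 'rV[R]_d) : s <= s' -> far s' x `<=` far s x.
Proof. by move=> ss y [By /= H]; split => //=; exact: le_trans H. Qed.

Lemma far_pairs_mono (s s' : R) : s <= s' -> far_pairs kappa s' <= far_pairs kappa s.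
Proof.
move=> ss; rewrite /far_pairs fine_le ?fin_num_measure//; try exact: measurable_far_pair_set.
apply: le_measure; rewrite ?inE; try exact: measurable_far_pair_set.
by move=> z [? ? H]; split => //; exact: le_trans H.
Qed.

Let fine_mono (A A' : set Omega) : measurable A -> measurable A' -> A `<=` A' ->
  fine (P A) <= fine (P A').
Proof. by move=> mA mA' AA'; rewrite fine_le ?fin_num_measure// le_measure ?inE. Qed.

Let mesh (e : R) : 0 < e -> exists K, (0 < K)%N /\ d%:R / K%:R <= e :> R.
Proof.
move=> e0; exists (Num.truncn (d%:R / e)).+1; split => //.
have /andP[_ H] := @truncn_itv R (d%:R / e) (divr_ge0 (ler0n _ _) (ltW e0)).
by rewrite ler_pdivrMr// mulrC -ler_pdivrMr// ltW.
Qed.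

(** [linked_bounds] for a mesh small compared to the gap between [s'] and
    [s]. *)
Lemma diam_upper (s s' tau : R) : 0 < s' -> s' < s -> 0 <= tau -> tau <= 3^-1 ->
  (forall x : 'rV[R]_d, B x -> n%:R * mass kappa (far s' x) <= tau) ->
  fine (P (diam_event s)) <= 1 - expR (- ((1 + tau) * (n%:R ^+ 2 * far_pairs kappa s' / 2))).
Proof.
move=> s'0 ss t0 t1 H; have s0 : 0 < s by exact: lt_trans ss.
have e0 : 0 < (s - s') / 2 by rewrite divr_gt0// subr_gt0.
have m0 : 0 < Num.min ((s - s') / 4) (s' / 2) by rewrite lt_min !divr_gt0// subr_gt0.
(* The gap is split between the tolerance [e] and two cell diameters. *)
have [K [K0 ]] := mesh m0; rewrite le_min => /andP[dK1 dK2].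
have mE := measurable_diam_event s0.
set e := (s - s') / 2 in e0.
have sub : diam_event s `<=` linked N K (s - e) by move=> w; exact: diam_linked.
apply: (le_trans (fine_mono mE (measurable_linked _ _ _) sub)).
have s1 : s' <= s - e - 2 * (d%:R / K%:R) by rewrite /e; lra.
have s2 : d%:R / K%:R < s - e by rewrite /e; lra.
have far_tau (x : 'rV[R]_d) : B x -> n%:R * mass kappa (far (s - e - 2 * (d%:R / K%:R)) x) <= tau.
  move=> Bx; apply: le_trans (H x Bx); rewrite ler_wpM2l//; apply: mass_le; try exact: measurable_far.
  exact: far_mono.
have /andP[_ U] := linked_bounds HN K0 s2 t0 t1 far_tau.
apply: (le_trans U).
rewrite lerD2l lerN2 ler_expR lerN2 ler_wpM2l ?addr_ge0// ler_pM2r// ler_wpM2l ?exprn_ge0//.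
exact: far_pairs_mono.
Qed.

Lemma diam_lower (s s'' tau : R) : 0 < s -> s < s'' -> 0 <= tau -> tau <= 3^-1 ->
  (forall x : 'rV[R]_d, B x -> n%:R * mass kappa (far s x) <= tau) ->
  1 - expR (- ((1 - 3 * tau) * (n%:R ^+ 2 * far_pairs kappa s'' / 2))) <= fine (P (diam_event s)).
Proof.
move=> s0 ss t0 t1 H.
have m0 : 0 < Num.min ((s'' - s) / 2) (s / 2) by rewrite lt_min !divr_gt0// subr_gt0.
have [K [K0 ]] := mesh m0; rewrite le_min => /andP[dK1 dK2].
have mE := measurable_diam_event s0.
have s1 : s <= s'' - 2 * (d%:R / K%:R) by lra.
have sub : linked N K s'' `<=` diam_event s.
  by move=> w /(linked_diam K0); exact: le_trans.
apply: le_trans (fine_mono (measurable_linked _ _ _) mE sub).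
have s2 : d%:R / K%:R < s'' by lra.
have far_tau (x : 'rV[R]_d) : B x -> n%:R * mass kappa (far (s'' - 2 * (d%:R / K%:R)) x) <= tau.
  move=> Bx; apply: le_trans (H x Bx); rewrite ler_wpM2l//; apply: mass_le; try exact: measurable_far.
  exact: far_mono.
by have /andP[] := linked_bounds HN K0 s2 t0 t1 far_tau.
Qed.
End diamlaw.

(** * A product of Wallis type *)

Section wallis_product.
Context {R : realType}.
Variable d : nat.
Hypothesis d0 : (0 < d)%N.

(** The moments of order [2 j] of one coordinate of a uniform point of the
    unit sphere. *)
Definition wallis (j : nat) : R := \prod_(i < j) ((2 * i%:R + 1) / (2 * i%:R + d%:R)).

Lemma wallisE j : wallis j * Gamma (j%:R + d%:R / 2) * Gamma (2^-1 : R) =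
  Gamma (j%:R + 2^-1) * Gamma (d%:R / 2).
Proof.
have dp : 0 < d%:R / 2 :> R by rewrite divr_gt0// ltr0n.
elim: j => [|j IH].
  by rewrite /wallis big_ord0 mul1r !add0r mulrC.
rewrite /wallis big_ord_recr/= -/(wallis j) -(natr1 j).
have -> : j%:R + 1 + d%:R / 2 = (j%:R + d%:R / 2) + 1 :> R by ring.
have -> : j%:R + 1 + 2^-1 = (j%:R + 2^-1) + 1 :> R by ring.
have j2 : 0 < j%:R + 2^-1 :> R by rewrite ltr_wpDl// invr_gt0.
have jd : 0 < j%:R + d%:R / 2 :> R by rewrite ltr_wpDl.
rewrite (GammaS j2) (GammaS jd).
have D : 2 * j%:R + d%:R != 0 :> R.
  by apply: lt0r_neq0; apply: ltr_wpDl; [apply: mulr_ge0|rewrite ltr0n].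
apply: (@eq_trans _ _ ((j%:R + 2^-1) * (wallis j * Gamma (j%:R + d%:R / 2) * Gamma 2^-1))); last by rewrite IH mulrA.
by field.
Qed.

(** [Gamma_half_step] at [x j] and at [x j + 1 / 2]. *)
Let half_ratio (x : nat -> R) : (forall j, 0 < x j) -> x j @[j --> \oo] --> +oo ->
  Num.sqrt (x j) * Gamma (x j) / Gamma (x j + 2^-1) @[j --> \oo] --> (1 : R).
Proof.
move=> x0 xoo.
have Gp j : 0 < Gamma (x j) by exact: Gamma_gt0.
have h0 : 0 < 2^-1 :> R by rewrite invr_gt0.
have Gp2 j : 0 < Gamma (x j + 2^-1) by apply: Gamma_gt0; rewrite addr_gt0.
apply: (@squeeze_cvgr _ _ _ _ (fun=> 1) (fun j => Num.sqrt (1 + 2^-1 * (x j)^-1))).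
- near=> j; have xj := x0 j.
  have q0 : 0 < Num.sqrt (x j) by rewrite sqrtr_gt0.
  apply/andP; split.
    by rewrite ler_pdivlMr// mul1r Gamma_half_step.
  rewrite ler_pdivrMr//.
  have xh : 0 < x j + 2^-1 by rewrite addr_gt0.
  have := Gamma_half_step xh.
  have -> : x j + 2^-1 + 2^-1 = x j + 1 by field.
  rewrite (GammaS (x0 j)) => H.
  have -> : 1 + 2^-1 * (x j)^-1 = (x j + 2^-1) / x j by field; rewrite gt_eqF.
  rewrite sqrtrM; last exact: ltW.
  rewrite sqrtrV ?(ltW xj)// mulrAC ler_pdivlMr//.
  by rewrite mulrAC -expr2 sqr_sqrtr ?(ltW xj)// mulrC mulrC.
- exact: cvg_cst.
- have e1 : (1 : R) = Num.sqrt (1 + 2^-1 * 0) by rewrite mulr0 addr0 sqrtr1.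
  rewrite [X in _ --> X]e1; apply: continuous_cvg; first exact: sqrt_continuous.
  apply: cvgD; first exact: cvg_cst.
  apply: cvgMr; apply/gtr0_cvgV0 => //.
  by near=> j.
Unshelve. all: by end_near. Qed.

Let ratio (m : nat) : j%:R `^ (m%:R / 2) * Gamma (j%:R + 2^-1) / Gamma (j%:R + (m%:R + 1) / 2)
  @[j --> \oo] --> (1 : R).
Proof.
elim: m => [|m IH].
  rewrite (_ : (fun j => _) = (fun=> 1)); first exact: cvg_cst.
  apply/funext => j; rewrite mul0r powRr0 add0r mul1r [1 / 2]mul1r divff// gt_eqF//.
  by apply: Gamma_gt0; apply: ltr_wpDl; rewrite ?ler0n// invr_gt0.
have c0 : 0 < (m%:R + 1) / 2 :> R by rewrite divr_gt0// ltr_wpDl.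
have H := @half_ratio (fun j => j%:R + (m%:R + 1) / 2) _ _.
have {}H := H (fun j => ltr_wpDl (ler0n R j) c0).
have xoo : j%:R + (m%:R + 1) / 2 @[j --> \oo] --> (+oo : set_system R).
  apply/cvgryPge => A; near=> j.
  have H1 : A <= (Num.bound A)%:R by exact/ltW/unstable.ltr_bound.
  have H2 : (Num.bound A)%:R <= j%:R :> R by rewrite ler_nat; near: j; exists (Num.bound A).
  by apply: (le_trans H1); apply: (le_trans H2); rewrite lerDl (ltW c0).
have {}H := H xoo.
have sq : Num.sqrt (j%:R / (j%:R + (m%:R + 1) / 2)) @[j --> \oo] --> (1 : R).
  rewrite -[X in _ --> X](@sqrtr1 R); apply: continuous_cvg; first exact: sqrt_continuous.
  have : 1 - (m%:R + 1) / 2 * (j%:R + (m%:R + 1) / 2)^-1 @[j --> \oo] --> (1 - (m%:R + 1) / 2 * 0 : R).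
    apply: cvgB; first exact: cvg_cst.
    apply: cvgMr; apply/gtr0_cvgV0 => //.
    by near=> j; rewrite ltr_wpDl.
  rewrite mulr0 subr0; apply: cvg_trans; apply: near_eq_cvg; near=> j.
  have D : j%:R + (m%:R + 1) / 2 != 0 :> R by rewrite gt_eqF// ltr_wpDl.
  by rewrite -{1}(divff D) -mulrBl addrK.
have KK : (j%:R `^ (m%:R / 2) * Gamma (j%:R + 2^-1) / Gamma (j%:R + (m%:R + 1) / 2)) *
    (Num.sqrt (j%:R + (m%:R + 1) / 2) * Gamma (j%:R + (m%:R + 1) / 2) /
       Gamma (j%:R + (m%:R + 1) / 2 + 2^-1)) *
    Num.sqrt (j%:R / (j%:R + (m%:R + 1) / 2)) @[j --> \oo] --> (1 : R).
  have e1 : (1 : R) = 1 * 1 * 1 by rewrite !mulr1.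
  rewrite [X in _ --> X]e1.
  exact: (cvgM (cvgM IH H) sq).
apply: cvg_trans KK; apply: near_eq_cvg; near=> j.
have j0 : 0 < j%:R :> R by rewrite ltr0n; near: j; exists 1%N.
have jm : 0 < j%:R + (m%:R + 1) / 2 :> R by rewrite ltr_wpDl.
rewrite /=.
have -> : j%:R + (m.+1%:R + 1) / 2 = j%:R + (m%:R + 1) / 2 + 2^-1 :> R by rewrite -(natr1 m); field.
have -> : m.+1%:R / 2 = m%:R / 2 + 2^-1 :> R by rewrite -(natr1 m); field.
rewrite powRD ?(gt_eqF j0) ?implybT// powR12_sqrt ?ler0n//.
rewrite sqrtrM ?ler0n// sqrtrV ?(ltW jm)//.
have s0 : Num.sqrt (j%:R + (m%:R + 1) / 2) != 0 :> R by rewrite gt_eqF// sqrtr_gt0.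
have G0 : Gamma (j%:R + (m%:R + 1) / 2) != 0 :> R by rewrite gt_eqF// Gamma_gt0.
have G1 : Gamma (j%:R + (m%:R + 1) / 2 + 2^-1) != 0 :> R.
  by rewrite gt_eqF// Gamma_gt0// addr_gt0// invr_gt0.
move: s0 G0 G1; set X := Num.sqrt (j%:R + _); set Y := Gamma (j%:R + _); set Z := Gamma _; set W := Gamma _.
by clearbody X Y Z W; move=> s0 G0 G1; field; rewrite s0 G0 G1.
Unshelve. all: by end_near. Qed.

(** The product is a ratio of values of [Gamma] at distance [(d - 1) / 2],
    which is covered by [d - 1] steps of length [1 / 2]. *)
Lemma wallis_lim : j%:R `^ ((d%:R - 1) / 2) * wallis j @[j --> \oo] --> (Gamma (d%:R / 2) / Num.sqrt pi : R).
Proof.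
have H := ratio d.-1.
have dE : d.-1%:R + 1 = d%:R :> R by rewrite natr1 prednK.
have dB : d.-1%:R = d%:R - 1 :> R by rewrite -dE addrK.
have KK : (j%:R `^ (d.-1%:R / 2) * Gamma (j%:R + 2^-1) / Gamma (j%:R + (d.-1%:R + 1) / 2)) *
    (Gamma (d%:R / 2) / Num.sqrt pi) @[j --> \oo] --> (Gamma (d%:R / 2) / Num.sqrt pi : R).
  have e1 : Gamma (d%:R / 2 : R) / Num.sqrt pi = 1 * (Gamma (d%:R / 2) / Num.sqrt pi) by rewrite mul1r.
  by rewrite [X in _ --> X]e1; apply: cvgM => //; exact: cvg_cst.
apply: cvg_trans KK; apply: near_eq_cvg; near=> j; rewrite /=.
rewrite dE dB -mulrA -mulrA; congr (_ * _).
have dp : 0 < d%:R / 2 :> R by rewrite divr_gt0// ltr0n.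
have G0 : Gamma (j%:R + d%:R / 2) != 0 :> R by rewrite gt_eqF// Gamma_gt0// ltr_wpDl.
have p0 : Num.sqrt pi != 0 :> R by rewrite gt_eqF// sqrtr_gt0 pi_gt0.
have := wallisE j; rewrite Gamma_half => E.
apply: (mulIf p0); apply: (mulIf G0).
rewrite -[RHS]mulrA (mulrC (Num.sqrt pi)) [RHS]mulrA E.
move: p0 G0; set X := Num.sqrt pi; set Y := Gamma _; clearbody X Y => p0 G0.
by field; rewrite p0 G0.
Unshelve. all: by end_near. Qed.

End wallis_product.

(** * Moments and tail of the overlap *)

Section overlap.
Context {R : realType} {d : nat}.
Notation T := (borel_space R d).
Local Notation B := (@unit_ball R d).
Variable kappa : probability T R.
Hypothesis kappa_sym : spherically_symmetric kappa.
Hypothesis kappa_ball : kappa B = 1%E.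
Variables (i0 i1 : 'I_d).
Hypothesis i01 : i0 != i1.

Local Notation kappa2 := (pair_law kappa).
Local Notation Mm := (axis_moment kappa i0).
Local Notation B2 := (B `*` B : set (T * T)).

Let d_gt0 : (0 < d)%N. Proof. by case: d i0 => // -[]. Qed.

Definition radial (j : nat) : R := power_moment kappa B (fun x : T => enorm x) j.

Lemma axis_moment0 l : Mm 0 l = radial (2 * l).
Proof.
rewrite /radial /power_moment /axis_moment /ball_mean; apply: eq_Rintegral => x _.
by rewrite muln0 expr0 mul1r.
Qed.

Lemma axis_moment_wallis j l : Mm j l = wallis d j * radial (2 * (l + j)).
Proof.
elim: j l => [|j IH] l; first by rewrite axis_moment0 addn0 /wallis big_ord0 mul1r.
have D : 2 * j%:R + d%:R != 0 :> R.
  by rewrite gt_eqF// ltr_wpDl ?ltr0n// mulr_ge0.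
apply: (mulIf D); rewrite (axis_moment_rec kappa_sym i01) IH addSnnS /wallis big_ord_recr/=.
by field.
Qed.

(** Close to 1 exactly when the two points are nearly collinear and both
    near the sphere. *)
Definition overlap (z : T * T) : R := dot z.1 z.2 ^+ 2 * enorm z.1 ^+ 2 * enorm z.2 ^+ 2.

Lemma measurable_overlap : measurable_fun setT overlap.
Proof.
apply: measurable_funM; [apply: measurable_funM|].
- by apply: measurable_funX; exact: measurable_dot2.
- by apply: measurable_funX; exact: (measurableT_comp measurable_enorm measurable_fst).
- by apply: measurable_funX; exact: (measurableT_comp measurable_enorm measurable_snd).
Qed.

Lemma overlap_ge0 z : 0 <= overlap z.
Proof. by apply: mulr_ge0; [apply: mulr_ge0|]; exact: sqr_ge0. Qed.

Let ball_sqr (x : T) : B x -> 0 <= enorm x ^+ 2 <= 1.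
Proof. by move=> Bx; rewrite sqr_ge0/= expr_le1// enorm_ge0. Qed.

Lemma overlap01 z : B2 z -> 0 <= overlap z <= 1.
Proof.
case=> B1 B2'; rewrite overlap_ge0/=.
have /andP[x0 x1] := ball_sqr B1; have /andP[y0 y1] := ball_sqr B2'.
have H : dot z.1 z.2 ^+ 2 <= 1.
  rewrite -real_normK ?num_real// expr_le1//.
  apply: (le_trans (cauchy_schwarz _ _)); rewrite -[leRHS]mulr1.
  by apply: ler_pM; rewrite ?enorm_ge0.
apply: mulr_ile1 => //; first by apply: mulr_ge0; exact: sqr_ge0.
by apply: mulr_ile1 => //; exact: sqr_ge0.
Qed.

Lemma measurable_B2 : measurable B2.
Proof. exact: measurableX. Qed.

(** For fixed [x] the integral over [y] is a moment of [<x, y>], known by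
    rotation invariance; [x] then enters through its norm only. *)
Lemma overlap_moment j : power_moment kappa2 B2 overlap j = wallis d j * radial (4 * j) ^+ 2.
Proof.
pose g (z : T * T) : \bar R := (overlap z ^+ j)%:E.
have mg : measurable_fun setT g.
  by apply/measurable_EFinP; apply: measurable_funX; exact: measurable_overlap.
have g0 z : (0 <= g z)%E by rewrite lee_fin exprn_ge0// overlap_ge0.
have mr : measurable_fun setT (g \_ B2).
  apply/(measurable_restrictT _ _).1; first exact: measurable_B2.
  exact: measurable_funTS.
have r0 z : (0 <= (g \_ B2) z)%E by rewrite /patch; case: ifP.
have tr l : tame (fun x : T => enorm x ^+ l) by apply: tameX; exact: tame_enorm.
suff H : (\int[kappa2]_(z in B2) g z = (wallis d j * radial (4 * j) ^+ 2)%:E)%E.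
  by rewrite /power_moment /Rintegral H.
rewrite integral_mkcond fubini_tonelli1//.
transitivity (\int[kappa]_(x in B) (Mm j j * enorm x ^+ (4 * j))%:E)%E.
  rewrite [RHS]integral_mkcond; apply: eq_integral => x _.
  rewrite /fubini_F/= /patch/=.
  case: ifPn => xB; last first.
    rewrite integral0_eq// => y _; rewrite /patch ifF//.
    by apply/negbTE/negP; rewrite inE => -[/= /mem_set]; rewrite (negbTE xB).
  have Bx : B x by rewrite inE in xB.
  transitivity (\int[kappa]_(y in B) g (x, y))%E.
    rewrite [RHS]integral_mkcond; apply: eq_integral => y _.
    rewrite /patch; congr (if _ then _ else _).
    by apply/idP/idP; rewrite !inE; [case|].
  have E y : g (x, y) = (enorm x ^+ (2 * j) * (dot y x ^+ (2 * j) * enorm y ^+ (2 * j)))%:E.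
    by rewrite /g /overlap/= exprMn exprMn -!exprM (dotC x y); congr (_%:E); ring.
  have tm : tame (fun y : T => dot y x ^+ (2 * j) * enorm y ^+ (2 * j)).
    by apply: tameM => //; apply: tameX; exact: tame_dot.
  under eq_integral do rewrite E.
  rewrite ball_mean_fin; last by apply: tameM => //; exact: tame_cst.
  rewrite ball_meanZ// (moment_dot kappa_sym i01) mulrA -exprD.
  by rewrite mulrC; do 3 f_equal; rewrite -mulnDl.
rewrite ball_mean_fin; last by apply: tameM => //; exact: tame_cst.
rewrite ball_meanZ// axis_moment_wallis; congr (_%:E).
rewrite -/(radial (4 * j)) (_ : 2 * (j + j) = 4 * j)%N; last by rewrite addnn -mul2n mulnA.
by rewrite expr2 mulrA.
Qed.

Variables (al a : R).
Hypotheses (al0 : 0 <= al) (a0 : 0 < a).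
Hypothesis radial_tail : y `^ (- al) * upper_tail kappa B (fun x : T => enorm x) y @[y --> 0^'+] --> a.
Local Notation gam := (gamma_exp d al).
Hypothesis d2 : (2 <= d)%N.

Lemma radial_lim : j%:R `^ al * radial j @[j --> \oo] --> a * Gamma (al + 1).
Proof.
apply: abelian => //; first exact: measurable_enorm.
by move=> x Bx; rewrite enorm_ge0.
Qed.

Lemma radial_lim4 : j%:R `^ al * radial (4 * j) @[j --> \oo] --> a * Gamma (al + 1) * 4 `^ (- al).
Proof.
have H : (4 * j)%:R `^ al * radial (4 * j) @[j --> \oo] --> a * Gamma (al + 1).
  have : (4 * j)%N @[j --> \oo] --> \oo.
    by move=> A [N _ NA]; exists N => // j /= Nj; apply: NA => /=; rewrite (leq_trans Nj)// leq_pmull.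
  by move=> c4; exact: (cvg_comp _ _ c4 radial_lim).
have K : (4 * j)%:R `^ al * radial (4 * j) * 4 `^ (- al) @[j --> \oo] --> a * Gamma (al + 1) * 4 `^ (- al).
  by apply: cvgM => //; exact: cvg_cst.
apply: cvg_trans K; apply: near_eq_cvg; near=> j.
rewrite natrM powRM// powRN.
have P0 : 4 `^ al != 0 :> R by rewrite gt_eqF// powR_gt0.
by field.
Unshelve. all: by end_near. Qed.

Lemma gamma_exp_gt0 : 0 < gam.
Proof.
rewrite /gamma_exp ltr_pwDl ?mulr_ge0// divr_gt0// subr_gt0.
by rewrite (ltr_nat R 1).
Qed.

Definition overlap_cst : R := Gamma (d%:R / 2) / Num.sqrt pi * (a * Gamma (al + 1) * 4 `^ (- al)) ^+ 2.

Lemma overlap_moment_lim : j%:R `^ gam * power_moment kappa2 B2 overlap j @[j --> \oo] --> overlap_cst.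
Proof.
have K : (j%:R `^ ((d%:R - 1) / 2) * wallis d j) * (j%:R `^ al * radial (4 * j)) ^+ 2
    @[j --> \oo] --> overlap_cst.
  apply: cvgM; first exact: wallis_lim.
  by rewrite expr2; under eq_cvg do rewrite expr2; apply: cvgM; exact: radial_lim4.
apply: cvg_trans K; apply: near_eq_cvg; near=> j.
have j0 : 0 < j%:R :> R by rewrite ltr0n; near: j; exists 1%N.
rewrite overlap_moment /gamma_exp powRD ?(gt_eqF j0) ?implybT//.
rewrite mulr_natl mulr2n powRD ?(gt_eqF j0) ?implybT//.
by ring.
Unshelve. all: by end_near. Qed.

Lemma overlap_tail : x `^ (- gam) * upper_tail kappa2 B2 overlap x @[x --> 0^'+] -->
  overlap_cst / Gamma (gam + 1).
Proof.
apply: karamata.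
- exact: measurable_B2.
- by rewrite (le_lt_trans (probability_le1 _ _)) ?ltry//; exact: measurable_B2.
- by apply: measurable_funTS; exact: measurable_overlap.
- exact: overlap01.
- exact: gamma_exp_gt0.
- exact: overlap_moment_lim.
Qed.
End overlap.

(** * Far pairs and the overlap *)

Lemma upper_tailE dT (T : measurableType dT) (R : realType) (mu : {measure set T -> \bar R})
    (D : set T) (V : T -> R) y : measurable D -> measurable_fun D V ->
  upper_tail mu D V y = fine (mu (D `&` [set x | expR (- y) <= V x])).
Proof.
move=> mD mV; set E := [set x | _].
have -> : D `&` E = D `&` V @^-1` `[expR (- y), +oo[%classic.
  by apply/seteqP; split => x /=; rewrite in_itv/= andbT.
have mE : measurable (D `&` V @^-1` `[expR (- y), +oo[%classic) by apply: mV.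
rewrite /upper_tail /Rintegral; congr fine.
transitivity (\int[mu]_(x in D) (\1_(D `&` V @^-1` `[expR (- y), +oo[%classic) x)%:E)%E.
  apply: eq_integral => x xD; congr (_%:E); rewrite indicE; congr (nat_of_bool _)%:R.
  rewrite inE in xD; apply/idP/idP; rewrite inE/= in_itv/= andbT; last by case.
  by move=> H; split.
by rewrite integral_indic// setIAC setIid.
Qed.

Section pairs.
Context {R : realType} {d : nat}.
Notation T := (borel_space R d).
Local Notation B := (@unit_ball R d).
Variable kappa : probability T R.
Hypothesis kappa_sym : spherically_symmetric kappa.
Hypothesis kappa_ball : kappa B = 1%E.
Variables (i0 i1 : 'I_d).
Hypothesis i01 : i0 != i1.

Local Notation Mm := (axis_moment kappa i0).
Local Notation B2 := (B `*` B : set (T * T)).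

Let level (c : R) : set (T * T) := B2 `&` [set z | c <= overlap z].
Let opposite (c : R) : set (T * T) := level c `&` [set z | dot z.1 z.2 < 0].

Let m_level c : measurable (level c).
Proof.
have -> : level c = B2 `&` (setT `&` overlap @^-1` `[c, +oo[%classic).
  by apply/seteqP; split => z [? /= H]; split => //; move: H; rewrite ?in_itv/= ?andbT// => -[].
apply: measurableI; first exact: measurable_B2.
by apply: measurable_overlap.
Qed.

Let m_opposite c : measurable (opposite c).
Proof.
have -> : opposite c = level c `&` (setT `&` (fun z : T * T => dot z.1 z.2) @^-1` `]-oo, 0[%classic).
  by apply/seteqP; split => z [? /= H]; split => //; move: H; rewrite ?in_itv/= ?andbT// => -[].
by apply: measurableI => //; apply: measurable_dot2.
Qed.

(** For fixed [x], the law of [y] sees [<x, y>] and [<- x, y>] alike. *)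
Lemma opposite_half c : 0 < c -> fine (pair_law kappa (level c)) = 2 * fine (pair_law kappa (opposite c)).
Proof.
move=> c0; pose same := level c `&` [set z : T * T | 0 < dot z.1 z.2].
have m_same : measurable same.
  have -> : same = level c `&` (setT `&` (fun z : T * T => dot z.1 z.2) @^-1` `]0, +oo[%classic).
    by apply/seteqP; split => z [? /= H]; split => //; move: H; rewrite ?in_itv/= ?andbT// => -[].
  by apply: measurableI => //; apply: measurable_dot2.
have LE : level c = opposite c `|` same.
  apply/seteqP; split => z; last by case=> -[].
  move=> H; case: (ltgtP (dot z.1 z.2) 0) => D0; [by left|by right|].
  by case: H => _; rewrite /= /overlap D0 expr0n/= !mul0r leNgt c0.
have dis : opposite c `&` same = set0.
  by rewrite -subset0 => z [[_ /= D1] [_ /= D2]]; have := lt_trans D1 D2; rewrite ltxx.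
have E A : pair_law kappa A = (\int[kappa]_x kappa (xsection A x))%E by [].
suff OS : pair_law kappa same = pair_law kappa (opposite c).
  have U : pair_law kappa (opposite c `|` same) = (pair_law kappa (opposite c) + pair_law kappa same)%E.
    by apply: measureU.
  by rewrite LE U OS fineD ?fin_num_measure// mulr_natl mulr2n.
rewrite !E; apply: eq_integral => x _.
pose S (u v : R) := [/\ B x, v <= 1, c <= u ^+ 2 * enorm x ^+ 2 * v ^+ 2 & u < 0].
have E1 : xsection (opposite c) x = [set y : T | S (dot y x) (enorm y)].
  apply/seteqP; split => y; rewrite /xsection/= inE /opposite /level /overlap/=.
    by case=> -[[Bx By]] /=; rewrite dotC.
  by case=> Bx By; rewrite dotC.
have E2 : xsection same x = [set y : T | S (dot y (- (x : 'rV[R]_d))) (enorm y)].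
  have dN y : dot y (- (x : 'rV[R]_d)) = - dot x y by rewrite dotC dotNl.
  apply/seteqP; split => y; rewrite /xsection/= inE /same /level /overlap /S/= dN sqrrN oppr_lt0.
    by case=> -[[Bx By]] /=.
  by case=> Bx By.
have mS (A : set (T * T)) : measurable A -> measurable (xsection A x) by exact: measurable_xsection.
have m1 : measurable [set y : T | S (dot y x) (enorm y)] by rewrite -E1; exact: mS.
have m2 : measurable [set y : T | S (dot y (- (x : 'rV[R]_d))) (enorm y)] by rewrite -E2; exact: mS.
by rewrite E1 E2 (kappa_dot kappa_sym i01 m1) (kappa_dot kappa_sym i01 m2) enormN.
Qed.

Lemma dist_sqr (x y : 'rV[R]_d) :
  enorm (x - y) ^+ 2 = 4 - ((1 - enorm x ^+ 2) + (1 - enorm y ^+ 2) + 2 * (1 + dot x y)).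
Proof. by rewrite !enorm_sqr dotBl !dotBr (dotC y x); ring. Qed.

Let Vt := upper_tail (pair_law kappa) B2 (@overlap R d).

Let VtE y : Vt y = fine (pair_law kappa (level (expR (- y)))).
Proof.
by rewrite /Vt upper_tailE//; [exact: measurable_B2|apply: measurable_funTS; exact: measurable_overlap].
Qed.

Let ball1 (x : T) : B x -> 0 <= 1 - enorm x ^+ 2 <= 1.
Proof.
by move=> Bx; rewrite subr_ge0 gerBl sqr_ge0 andbT expr_le1// enorm_ge0.
Qed.

Let dot_ge (x y : T) : B x -> B y -> -1 <= dot x y.
Proof.
move=> Bx By; have := cauchy_schwarz x y; rewrite ler_norml => /andP[H _].
apply: le_trans H; rewrite lerN2; apply: mulr_ile1 => //; exact: enorm_ge0.
Qed.

Lemma far_opposite (ep : R) : 0 <= ep < 2^-1 ->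
  far_pair_set (2 - ep) `<=` [set z : T * T | [/\ B2 z, 1 - 4 * ep <= overlap z & dot z.1 z.2 < 0]].
Proof.
move=> /andP[e0 e1] z [Bx By sz].
have e2 : 0 <= 2 - ep by lra.
have sq : (2 - ep) ^+ 2 <= enorm ((z.1 : 'rV[R]_d) - z.2) ^+ 2.
  by rewrite ler_pXn2r// nnegrE// enorm_ge0.
rewrite dist_sqr in sq.
have C0 : 0 <= 1 + dot z.1 z.2 by have := dot_ge Bx By; lra.
have [C1 H] := far_overlap (ball1 Bx) (ball1 By) C0 e0 e1 sq.
split => //=; last by rewrite -(ltrD2l 1) addr0.
by apply: (le_trans H); rewrite /overlap le_eqVlt; apply/orP; left; apply/eqP; ring.
Qed.

Lemma far_pairs_upper (ep : R) : 0 <= ep -> ep < 8^-1 ->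
  2 * far_pairs kappa (2 - ep) <= Vt (4 * ep / (1 - 4 * ep)).
Proof.
move=> e0 e8; have c0 : 0 < 1 - 4 * ep by lra.
rewrite VtE opposite_half ?expR_gt0// ler_pM2l// /far_pairs.
rewrite fine_le ?fin_num_measure//; try exact: measurable_far_pair_set.
rewrite le_measure ?inE//; first exact: measurable_far_pair_set.
have eI : 0 <= ep < 2^-1 by rewrite e0/=; lra.
move=> z /(far_opposite eI)[Bz H D]; split => //; split => //=; apply: le_trans H.
rewrite expRN -[leRHS]invrK lef_pV2 ?posrE ?expR_gt0 ?invr_gt0//.
apply: le_trans (expR_ge1Dx _); rewrite le_eqVlt; apply/orP; left; apply/eqP; field.
by rewrite gt_eqF.
Qed.

Lemma far_pairs_lower (ep : R) : 0 <= ep -> ep <= 100^-1 ->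
  Vt (4 * ep - 257 * ep ^+ 2) <= 2 * far_pairs kappa (2 - ep).
Proof.
(* [257 = 256 + 1]: [16 * h ^+ 2 <= 256 * ep ^+ 2], and [ep ^+ 2] comes from
   the square of [2 - ep]. *)
move=> e0 e8; set h := _ - _.
have h0 : 0 <= h by rewrite /h; nra.
have h1 : h <= 1 by rewrite /h; nra.
have h4 : h <= 4 * ep by rewrite /h; nra.
have hh : h + 16 * h ^+ 2 <= 4 * ep - ep ^+ 2.
  have : h ^+ 2 <= (4 * ep) ^+ 2 by rewrite ler_pXn2r ?nnegrE//; lra.
  by rewrite {2}/h; lra.
rewrite VtE opposite_half ?expR_gt0// ler_pM2l// /far_pairs.
rewrite fine_le ?fin_num_measure//; try exact: measurable_far_pair_set.
rewrite le_measure ?inE//; first exact: measurable_far_pair_set.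
move=> z [[[Bx By] /= H] /= D].
have H' : 1 - h <= overlap z by apply: le_trans H; exact: expR_ge1Dx.
have C1 : 0 <= 1 + dot z.1 z.2 <= 1 by have := dot_ge Bx By; move: D => /= D' D''; apply/andP; split; lra.
have e2 : 0 <= ep <= 2 by apply/andP; split; lra.
have H2 : 1 - h <= (1 - (1 - enorm z.1 ^+ 2)) * (1 - (1 - enorm z.2 ^+ 2)) * (1 - (1 + dot z.1 z.2)) ^+ 2.
  by apply: (le_trans H'); rewrite /overlap le_eqVlt; apply/orP; left; apply/eqP; ring.
have sq := overlap_far (ball1 Bx) (ball1 By) C1 h0 e2 hh H2.
rewrite -dist_sqr in sq; split => //.
rewrite -(@ler_pXn2r _ 2) ?nnegrE ?enorm_ge0//; lra.
Qed.

(** Markov's inequality for the power [j] of the overlap, which on far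
    pairs is at least [1 - 4 ep * j >= 1 / 2]. *)
Lemma far_moment (ep : R) (j : nat) (x : 'rV[R]_d) : B x -> 0 <= ep -> ep < 8^-1 ->
  4 * ep * j%:R <= 2^-1 -> mass kappa (far (2 - ep) x) <= 2 * Mm j j.
Proof.
move=> Bx e0 e8 ej.
have ev (u : R) : 0 <= u ^+ (2 * j) by rewrite exprM exprn_ge0// sqr_ge0.
have tm : tame (fun y : T => dot y x ^+ (2 * j) * enorm y ^+ (2 * j)).
  by apply: tameM; apply: tameX; [exact: tame_dot|exact: tame_enorm].
have tme : tame (fun y : T => (2 * enorm x ^+ (2 * j)) * (dot y x ^+ (2 * j) * enorm y ^+ (2 * j))).
  by apply: tameM => //; exact: tame_cst.
have mf : measurable (far (2 - ep) x) by exact: measurable_far.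
have K : ball_mean kappa (fun y : T => (2 * enorm x ^+ (2 * j)) * (dot y x ^+ (2 * j) * enorm y ^+ (2 * j))) <= 2 * Mm j j.
  rewrite ball_meanZ// (moment_dot kappa_sym i01) mulrA -mulrA -mulrA ler_wpM2l//.
  rewrite mulrA -exprD -[leRHS]mul1r ler_wpM2r//.
    by apply: ball_mean_ge0 => y _; rewrite mulr_ge0.
  by rewrite exprn_ile1// enorm_ge0.
apply: le_trans K; rewrite -lee_fin -ball_mean_fin// -massE//.
have -> : kappa (far (2 - ep) x) = (\int[kappa]_(y in B) (\1_(far (2 - ep) x) y)%:E)%E.
  by rewrite integral_indic// setIC; congr (kappa _); apply/seteqP; split => y [].
apply: ge0_le_integral => //.
- by apply/measurable_EFinP; apply: measurable_funTS; exact: measurable_indic.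
- by apply/measurable_EFinP; apply: measurable_funTS; exact: (proj1 tme).
move=> y By; rewrite lee_fin indicE.
have E : 2 * enorm x ^+ (2 * j) * (dot y x ^+ (2 * j) * enorm y ^+ (2 * j)) = 2 * overlap (x : T, y) ^+ j.
  by rewrite /overlap/= exprMn exprMn -!exprM (dotC x y); ring.
rewrite E; case: (boolP (y \in _)) => [|_]; last by rewrite mulr_ge0// exprn_ge0// overlap_ge0.
rewrite inE => -[_ /= H].
have eI : 0 <= ep < 2^-1 by rewrite e0/=; lra.
have [_ V _] : [/\ B2 (x : T, y), 1 - 4 * ep <= overlap (x : T, y) & dot x y < 0].
  by apply: (far_opposite eI); split => //=; rewrite enorm_sub_sym.
have c0 : 0 <= 1 - 4 * ep by lra.
have b : 1 - 4 * ep * j%:R <= (1 - 4 * ep) ^+ j.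
  elim: j {ev tm tme E ej} => [|j IH]; first by rewrite mulr0 subr0.
  rewrite exprS -(natr1 j); apply: (le_trans _ (ler_wpM2l c0 IH)).
  have := ler0n R j; nra.
have : (1 - 4 * ep) ^+ j <= overlap (x : T, y) ^+ j by rewrite lerXn2r// nnegrE// overlap_ge0.
by rewrite /=; lra.
Qed.
End pairs.

(** * Asymptotics of far pairs and of far partners *)

Lemma cvg_at_right0 (R : realType) (f : R -> R) :
  f e @[e --> 0^'+] --> 0 -> (\forall e \near 0^'+, 0 < f e) -> f e @[e --> 0^'+] --> 0^'+.
Proof.
move=> f0 fp A /f0 H; change (\forall e \near 0^'+, A (f e)).
have {}H : \forall e \near 0^'+, 0 < f e -> A (f e) by exact: H.
near=> e.
have : 0 < f e by near: e.
by near: e; exact: H.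
Unshelve. all: by end_near. Qed.

Lemma tail_rescale (R : realType) (W : R -> R) (g L c : R) (th : R -> R) : 0 < c ->
  x `^ (- g) * W x @[x --> 0^'+] --> L -> th e / e @[e --> 0^'+] --> c ->
  e `^ (- g) * W (th e) @[e --> 0^'+] --> c `^ g * L.
Proof.
move=> c0 WL thc.
have e0 : e @[e --> 0^'+] --> (0 : R) by apply: cvg_at_right_filter; exact: cvg_id.
have th0 : th e @[e --> 0^'+] --> 0.
  have K : th e / e * e @[e --> 0^'+] --> c * 0 by apply: cvgM.
  rewrite mulr0 in K; apply: cvg_trans K; apply: near_eq_cvg; near=> e.
  by rewrite divfK// gt_eqF.
have thp : \forall e \near 0^'+, 0 < th e / e.
  by near=> e; near: e; apply: (cvgr_gt _ thc).
have thp' : \forall e \near 0^'+, 0 < th e.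
  near=> e; have : 0 < th e / e by near: e.
  by rewrite pmulr_lgt0// invr_gt0.
have W2 := cvg_comp _ _ (cvg_at_right0 th0 thp') WL.
have P : (th e / e) `^ g @[e --> 0^'+] --> c `^ g.
  exact: (cvg_comp _ _ thc (@continuous_powR R g c c0)).
have K : (th e / e) `^ g * (th e `^ (- g) * W (th e)) @[e --> 0^'+] --> c `^ g * L.
  by apply: cvgM.
apply: cvg_trans K; apply: near_eq_cvg; near=> e.
have r0 : 0 < th e / e by near: e.
have ep : 0 < e by [].
have -> : th e `^ (- g) = (th e / e) `^ (- g) * e `^ (- g).
  by rewrite -powRM ?(ltW r0) ?(ltW ep)// divfK// gt_eqF.
rewrite !mulrA -powRD ?(gt_eqF r0) ?implybT//.
by rewrite subrr powRr0 mul1r.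
Unshelve. all: by end_near. Qed.

Section asymptotics.
Context {R : realType} {d : nat}.
Notation T := (borel_space R d).
Local Notation B := (@unit_ball R d).
Variable kappa : probability T R.
Hypothesis kappa_sym : spherically_symmetric kappa.
Hypothesis kappa_ball : kappa B = 1%E.
Variables (i0 i1 : 'I_d).
Hypothesis i01 : i0 != i1.
Local Notation B2 := (B `*` B : set (T * T)).
Local Notation Mm := (axis_moment kappa i0).
Variables (al a : R).
Hypotheses (al0 : 0 <= al) (a0 : 0 < a).
Hypothesis radial_tail : y `^ (- al) * upper_tail kappa B (fun x : T => enorm x) y @[y --> 0^'+] --> a.
Local Notation gam := (gamma_exp d al).
Hypothesis d2 : (2 <= d)%N.

Definition pair_cst : R := 4 `^ gam * (@overlap_cst R d al a / Gamma (gam + 1)) / 2.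

Lemma pair_cstE : pair_cst = a ^+ 2 * const_c R d *
  (Gamma (al + 1) ^+ 2 * (Gamma ((d%:R + 1) / 2) / Gamma (2 * al + (d%:R + 1) / 2))).
Proof.
have d1 : 0 < d%:R - 1 :> R by rewrite subr_gt0 (ltr_nat R 1).
have dh : 0 < (d%:R - 1) / 2 :> R by rewrite divr_gt0.
have g1 : gam + 1 = 2 * al + (d%:R + 1) / 2 by rewrite /gamma_exp; field.
have g2 : (d%:R + 1) / 2 = (d%:R - 1) / 2 + 1 :> R by field.
have n4 : (4 != 0 :> R) = true by rewrite pnatr_eq0.
have P4 : 4 `^ gam = 2 ^+ (d - 1) * (4 `^ al) ^+ 2 :> R.
  rewrite /gamma_exp powRD ?n4 ?implybT//; congr (_ * _); last first.
    by rewrite mulr_natl mulr2n powRD ?n4 ?implybT// expr2.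
  have -> : (4 : R) = 2 `^ 2 by rewrite powR_mulrn//; ring.
  rewrite -powRrM mulrCA mulfV// mulr1 -powR_mulrn// natrB// ltnW//.
have N4 : 4 `^ (- al) = (4 `^ al)^-1 :> R by rewrite powRN.
have p4 : 4 `^ al != 0 :> R by rewrite gt_eqF// powR_gt0.
have sp : Num.sqrt pi != 0 :> R by rewrite gt_eqF// sqrtr_gt0 pi_gt0.
have G1 : Gamma ((d%:R - 1) / 2) != 0 :> R by rewrite gt_eqF// Gamma_gt0.
have G2 : Gamma (2 * al + (d%:R + 1) / 2) != 0 :> R.
  by rewrite gt_eqF// Gamma_gt0// g2 addrA ltr_wpDl// addr_ge0 ?mulr_ge0// ltW.
rewrite /pair_cst /overlap_cst /const_c g1 P4 N4.
move: G2; set X4 := Gamma (2 * al + _) => G2; rewrite g2 (GammaS dh).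
move: p4 sp G1 G2; set X1 := 4 `^ al; set X2 := Num.sqrt pi; set X3 := Gamma ((d%:R - 1) / 2).
set X5 := Gamma (al + 1); set X6 := Gamma (d%:R / 2); set X7 := 2 ^+ (d - 1).
move=> p4 sp G1 G2; field.
by rewrite p4 sp G1 G2 gt_eqF.
Qed.

Lemma far_pairs_lim : e `^ (- gam) * far_pairs kappa (2 - e) @[e --> 0^'+] --> pair_cst.
Proof.
have OT := overlap_tail kappa_sym i01 al0 radial_tail d2.
have e0 : e @[e --> 0^'+] --> (0 : R) by apply: cvg_at_right_filter; exact: cvg_id.
have c4 (k : R) : k * e @[e --> 0^'+] --> 0.
  have K : k * e @[e --> 0^'+] --> k * 0 by apply: cvgMr.
  by rewrite mulr0 in K.
have U : 4 * e / (1 - 4 * e) / e @[e --> 0^'+] --> (4 : R).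
  have K : 4 * (1 - 4 * e)^-1 @[e --> 0^'+] --> (4 * (1 - 0)^-1 : R).
    apply: cvgM; first exact: cvg_cst.
    apply: cvgV; first by rewrite subr0.
    by apply: cvgB => //; exact: cvg_cst.
  rewrite subr0 invr1 mulr1 in K; apply: cvg_trans K; apply: near_eq_cvg; near=> e.
  have ep : e != 0 by rewrite gt_eqF.
  have e4 : 1 - 4 * e != 0.
    by rewrite gt_eqF// subr_gt0 -ltr_pdivlMl//; near: e; exact: nbhs_right_lt.
  by field; rewrite ep e4.
have L : (4 * e - 257 * e ^+ 2) / e @[e --> 0^'+] --> (4 : R).
  have K : 4 - 257 * e @[e --> 0^'+] --> (4 - 0 : R) by apply: cvgB => //; exact: cvg_cst.
  rewrite subr0 in K; apply: cvg_trans K; apply: near_eq_cvg; near=> e.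
  have ep : e != 0 by rewrite gt_eqF.
  by field.
have p4 : 0 < 4 :> R by [].
have UT := tail_rescale p4 OT U.
have LT := tail_rescale p4 OT L.
have UT2 := cvgM UT (cvg_cst (2^-1 : R)).
have LT2 := cvgM LT (cvg_cst (2^-1 : R)).
apply: (squeeze_cvgr _ (LT2 _ _) (UT2 _ _)).
near=> e.
have ep : 0 < e by [].
have e8 : e < 8^-1 by near: e; exact: nbhs_right_lt.
have e100 : e <= 100^-1 by apply: ltW; near: e; exact: nbhs_right_lt.
have u := far_pairs_upper kappa_sym i01 (ltW ep) e8.
have l := far_pairs_lower kappa_sym i01 (ltW ep) e100.
have P := powR_ge0 e (- gam).
by apply/andP; split; rewrite /= -(mulrA (e `^ _)) ler_wpM2l//; lra.
Unshelve. all: by end_near. Qed.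

(** Powers [j] of order [1 / e] in [far_moment], for which the moment is of
    order [j ^ (- ((d - 1) / 2 + al))]. *)
Lemma far_bound : exists K e1 : R, [/\ 0 <= K, 0 < e1 & forall e (x : 'rV[R]_d), 0 < e -> e <= e1 -> B x ->
  mass kappa (far (2 - e) x) <= K * e `^ ((d%:R - 1) / 2 + al)].
Proof.
have d0 : (0 < d)%N by exact: ltnW.
set b := (d%:R - 1) / 2 + al.
have b0 : 0 <= b by rewrite addr_ge0// divr_ge0// subr_ge0 (ler_nat R 1).
pose l := Gamma (d%:R / 2) / Num.sqrt pi * (a * Gamma (al + 1) * 4 `^ (- al)).
have ML : j%:R `^ b * Mm j j @[j --> \oo] --> l.
  have K : (j%:R `^ ((d%:R - 1) / 2) * wallis d j) * (j%:R `^ al * radial kappa (4 * j)) @[j --> \oo] --> l.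
    by apply: cvgM; [exact: wallis_lim|exact: radial_lim4].
  apply: cvg_trans K; apply: near_eq_cvg; near=> j.
  have j0 : 0 < j%:R :> R by rewrite ltr0n; near: j; exists 1%N.
  rewrite (axis_moment_wallis kappa_sym i01) /b powRD ?(gt_eqF j0) ?implybT//.
  rewrite (_ : 2 * (j + j) = 4 * j)%N; last by rewrite addnn -mul2n mulnA.
  by ring.
have : \forall j \near \oo, j%:R `^ b * Mm j j <= l + 1.
  by near=> j; near: j; apply: (cvgr_le _ ML); rewrite ltrDl.
case=> N _ NM.
have l0 : 0 <= l + 1.
  have := NM N (leqnn N) => /=; apply: le_trans; rewrite mulr_ge0 ?powR_ge0//.
  by apply: ball_mean_ge0 => y _; rewrite mulr_ge0// exprM exprn_ge0 ?sqr_ge0.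
exists (2 * (l + 1) * 16 `^ b), (16 * N.+1%:R)^-1; split.
- by rewrite !mulr_ge0 ?powR_ge0.
- by rewrite invr_gt0 mulr_gt0.
move=> e x e0 ee Bx.
have N1 : 1 <= N.+1%:R :> R by rewrite (ler_nat R 1).
have eN : e * (16 * N.+1%:R) <= 1 by rewrite -ler_pdivlMr ?mulr_gt0// mul1r.
have e16 : e <= 16^-1.
  by apply: (le_trans ee); rewrite lef_pV2 ?posrE ?mulr_gt0// ler_peMr.
(* Then [4 * e * j <= 1 / 2], while [j * e] stays bounded below. *)
pose j := Num.truncn ((8 * e)^-1).
have /andP[j1 j2] := @truncn_itv R (8 * e)^-1 ltac:(by rewrite invr_ge0 mulr_ge0 ?ltW).
rewrite -/j in j1 j2.
have ie : (8 * e)^-1 * e = 8^-1 by field; rewrite gt_eqF.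
have J1 : j%:R * e <= 8^-1 by rewrite -ie ler_wpM2r// ltW.
have J2 : 16^-1 <= j%:R * e.
  have : (8 * e)^-1 * e <= (j%:R + 1) * e by rewrite ler_wpM2r ?(ltW e0)// natr1 ltW.
  rewrite ie; lra.
have jN : (N <= j)%N.
  rewrite -(ler_nat R) -(ler_pM2r e0); apply: le_trans J2.
  by rewrite -(natr1 N) in eN; lra.
have e8 : e < 8^-1 by apply: (le_lt_trans e16); rewrite ltf_pV2 ?posrE// ltr_nat.
have H := far_moment kappa_sym i01 Bx (ltW e0) e8.
have ej : 4 * e * j%:R <= 2^-1 by lra.
have {}H := H j ej.
apply: (le_trans H); rewrite -!mulrA ler_pM2l// -powRM ?(ltW e0)//.
have jp : 0 < j%:R :> R.
  by rewrite -(pmulr_lgt0 _ e0); apply: lt_le_trans J2; rewrite invr_gt0.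
have Pj : 0 < j%:R `^ b :> R by rewrite powR_gt0.
rewrite -(ler_pM2l Pj); apply: (le_trans (NM j jN)).
rewrite mulrCA -powRM ?(ltW jp)// ?mulr_ge0 ?(ltW e0)// -[leLHS]mulr1 ler_wpM2l//.
apply: (@le_trans _ _ (1 `^ b)); first by rewrite powR1.
apply: ge0_ler_powR; rewrite // ?nnegrE//; last lra.
by rewrite !mulr_ge0// ltW.
Unshelve. all: by end_near. Qed.
End asymptotics.

(** * The law of the radius and the limit law *)

Section radial_law.
Context {R : realType} {d : nat}.
Notation T := (borel_space R d).
Local Notation B := (@unit_ball R d).
Variable kappa : probability T R.
Hypothesis kappa_ball : kappa B = 1%E.
Context d0 {Omega0 : measurableType d0} (P0 : probability Omega0 R).
Variables (xi : {RV P0 >-> T}) (eta : {RV P0 >-> R}).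
Hypothesis xi_law : forall A : set T, measurable A -> distribution P0 xi A = kappa A.
Hypothesis etaE : forall w, eta w = 1 - enorm (xi w).
Variables (al a : R).
Hypotheses (al0 : 0 <= al) (a0 : 0 < a).
Local Notation F := (fun s => fine (cdf eta s)).
Hypothesis F_lim : s `^ (- al) * F s @[s --> 0^'+] --> a.

Lemma upper_tail_enorm y : upper_tail kappa B (fun x : T => enorm x) y = F (1 - expR (- y)).
Proof.
have me : measurable_fun B (fun x : T => enorm x).
  by apply: measurable_funTS; exact: measurable_enorm.
rewrite upper_tailE//; congr fine; set E := [set x : T | _].
have mE : measurable E.
  have -> : E = setT `&` (fun x : T => enorm x) @^-1` `[expR (- y), +oo[%classic.
    by apply/seteqP; split => x /=; rewrite in_itv/= ?andbT// => -[].
  by apply: measurable_enorm.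
transitivity (kappa E).
  have nul : kappa (E `&` ~` B) = 0%E.
    apply/eqP; rewrite eq_le measure_ge0 andbT.
    have <- : kappa (~` B) = 0%E by rewrite probability_setC// kappa_ball subee.
    apply: le_measure; rewrite ?inE; try exact: measurableC.
      by apply: measurableI => //; exact: measurableC.
    by move=> x [].
  have KE : kappa E = (kappa (E `&` ~` B) + kappa (E `&` B))%E.
    by rewrite -setDE -measureDI.
  by rewrite KE nul add0e setIC.
rewrite -xi_law// /cdf /distribution /pushforward; congr (P0 _).
by apply/seteqP; split => w /=; rewrite in_itv/= etaE lerD2l lerN2.
Qed.

Lemma radial_tail_lim : y `^ (- al) * upper_tail kappa B (fun x : T => enorm x) y @[y --> 0^'+] --> a.
Proof.
have e0 : e @[e --> 0^'+] --> (0 : R) by apply: cvg_at_right_filter; exact: cvg_id.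
have th : (1 - expR (- e)) / e @[e --> 0^'+] --> (1 : R).
  apply: (@squeeze_cvgr _ _ _ _ (fun e => 1 - e) (fun=> 1)).
  - near=> e; have ep : 0 < e by [].
    have e1 : e < 1 by near: e; exact: nbhs_right_lt.
    have h1 := expR_ge1Dx (- e); have h2 := expR_ge1Dx e; have h3 := expR_gt0 e.
    rewrite ler_pdivlMr// ler_pdivrMr// mul1r expRN.
    have h4 : (expR e)^-1 * expR e = 1 by rewrite mulVf// gt_eqF.
    have h5 : 0 < (expR e)^-1 by rewrite invr_gt0.
    rewrite expRN in h1; apply/andP; split; last lra.
    move: h1 h2 h3 h4 h5; set u := expR e; set v := u^-1 => h1 h2 h3 h4 h5; nra.
  - have K : 1 - e @[e --> 0^'+] --> (1 - 0 : R) by apply: cvgB => //; exact: cvg_cst.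
    by rewrite subr0 in K.
  - exact: cvg_cst.
have H := tail_rescale ltr01 F_lim th.
rewrite powR1 mul1r in H; apply: cvg_trans H; apply: near_eq_cvg; near=> e.
by rewrite upper_tail_enorm.
Unshelve. all: by end_near. Qed.

Let F_mono s s' : s <= s' -> F s <= F s'.
Proof.
move=> ss; rewrite fine_le ?cdf_nondecreasing//.
  by rewrite /cdf fin_num_measure//; exact: measurable_itv.
by rewrite /cdf fin_num_measure//; exact: measurable_itv.
Qed.

(** With an atom at 0, [F] does not tend to 0, so no positive power of [s]
    compensates. *)
Lemma atom_index0 : 0 < F 0 -> al = 0.
Proof.
move=> F0; apply/eqP; rewrite eq_le al0 andbT leNgt; apply/negP => alp.
have [M M0 HM] : exists2 M : R, 0 < M & \forall s \near 0^'+, s `^ (- al) * F s <= M.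
  exists (a + 1); first by rewrite addr_gt0.
  by near=> s; near: s; apply: (cvgr_le _ F_lim); rewrite ltrDl.
(* At [s0] the bound reads [2 * F s <= F 0]. *)
pose s0 : R := (F 0 / (2 * M)) `^ al^-1.
have q0 : 0 < F 0 / (2 * M) by rewrite divr_gt0// mulr_gt0.
have s0p : 0 < s0 by rewrite powR_gt0.
near (0 : R)^'+ => s.
have sp : 0 < s by [].
have H : s `^ (- al) * F s <= M by near: s.
have ss : s < s0 by near: s; exact: nbhs_right_lt.
have pp : 0 < s `^ al by rewrite powR_gt0.
have : s `^ al < F 0 / (2 * M).
  rewrite [ltRHS](_ : _ = s0 `^ al); last by rewrite /s0 -powRrM mulVf ?gt_eqF// powRr1// ltW.
  by apply: gt0_ltr_powR; rewrite // nnegrE ltW.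
have : F 0 <= F s by apply: F_mono; exact: ltW.
move: H; rewrite powRN mulrC ler_pdivrMr// => H1 H2; rewrite ltr_pdivlMr ?mulr_gt0// => H3.
have : s `^ al * (2 * M) <= M * s `^ al -> False.
  move=> ?; have : 0 < s `^ al * M by rewrite mulr_gt0.
  lra.
have : F 0 <= M * s `^ al by exact: le_trans H1.
have : 0 < M * s `^ al by rewrite mulr_gt0.
lra.
Unshelve. all: by end_near. Qed.

(** If the exponent were 0, then by right continuity [a] would be the mass
    of the atom. *)
Lemma no_atom_index_gt0 : ~~ (0 < F 0) -> 0 < al.
Proof.
move=> F0; rewrite lt_neqAle al0 andbT eq_sym; apply/negP => /eqP al_0.
have R0 : cdf eta s @[s --> 0^'+] --> cdf eta 0 by exact: cdf_right_continuous.
have f0 : (cdf eta 0) \is a fin_num by rewrite /cdf fin_num_measure//; exact: measurable_itv.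
rewrite -(fineK f0) in R0; have /fine_cvgP[_ R1] := R0.
have R2 : F s @[s --> 0^'+] --> a.
  apply: cvg_trans F_lim; apply: near_eq_cvg; near=> s.
  by rewrite al_0 oppr0 powRr0 mul1r.
have E : fine (cdf eta 0) = a by apply: (cvg_unique _ R1 R2).
by move: F0; rewrite E a0.
Unshelve. all: by end_near. Qed.

Lemma pair_cst_sigma0 : (2 <= d)%N -> @pair_cst R d al a = sigma0 d al a (F 0).
Proof.
move=> d2; rewrite pair_cstE// /sigma0; case: ifPn => F0.
  rewrite (atom_index0 F0) add0r Gamma1 mulr0 add0r expr1n mul1r divff//.
  by rewrite gt_eqF// Gamma_gt0// divr_gt0// ltr_wpDl.
by rewrite GammaS ?no_atom_index_gt0// exprMn.
Qed.
End radial_law.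

Section limit_law.
Context {R : realType} {d : nat}.
Notation T := (borel_space R d).
Local Notation B := (@unit_ball R d).
Variable kappa : probability T R.
Variables (al pc : R).
Hypothesis al0 : 0 <= al.
Hypothesis d2 : (2 <= d)%N.
Local Notation gam := (gamma_exp d al).
Hypothesis pc_lim : e `^ (- gam) * far_pairs kappa (2 - e) @[e --> 0^'+] --> pc.
Hypothesis far_le : exists K e1 : R, [/\ 0 <= K, 0 < e1 & forall e (x : 'rV[R]_d), 0 < e -> e <= e1 -> B x ->
  mass kappa (far (2 - e) x) <= K * e `^ ((d%:R - 1) / 2 + al)].
Variables (dO : nat -> measure_display) (Omega : forall n, measurableType (dO n))
  (P : forall n, probability (Omega n) R) (Pi : forall n, R.-ker (Omega n) ~> T).
Hypothesis Pi_poisson : forall n, poisson_process (P n) B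
  (mscale (n%:R%:nng : {nonneg R}) kappa) (Pi n).

Let g0 : 0 < gam. Proof. exact: gamma_exp_gt0. Qed.

Let q (n : nat) : R := n%:R `^ (- (2 / gam)).

Let q_gt0 n : (0 < n)%N -> 0 < q n.
Proof. by move=> n0; rewrite powR_gt0// ltr0n. Qed.

Let powN_cvg0 (p : R) : 0 < p -> n%:R `^ (- p) @[n --> \oo] --> (0 : R).
Proof.
move=> p0; apply/cvgrPdist_le => e e0.
near=> n.
have n0 : 0 < n%:R :> R by rewrite ltr0n; near: n; exists 1%N.
rewrite sub0r normrN ger0_norm ?powR_ge0// powRN -[leRHS]invrK lef_pV2 ?posrE ?invr_gt0 ?powR_gt0//.
have N : e^-1 `^ p^-1 <= n%:R.
  apply: (@le_trans _ _ (Num.bound (e^-1 `^ p^-1))%:R); first exact/ltW/unstable.ltr_bound.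
  by rewrite ler_nat; near: n; exists (Num.bound (e^-1 `^ p^-1)).
have -> : e^-1 = (e^-1 `^ p^-1) `^ p by rewrite -powRrM mulVf ?gt_eqF// powRr1// invr_ge0 ltW.
by apply: ge0_ler_powR; rewrite ?nnegrE ?powR_ge0// ltW.
Unshelve. all: by end_near. Qed.

Let q_cvg0 : q n @[n --> \oo] --> (0 : R).
Proof. by apply: powN_cvg0; rewrite divr_gt0. Qed.

Let uq_cvg0 (u : R) : u * q n @[n --> \oo] --> (0 : R).
Proof.
have K : u * q n @[n --> \oo] --> u * 0 by apply: cvgMr.
by rewrite mulr0 in K.
Qed.

Let pairs_lim (u : R) : 0 < u ->
  n%:R ^+ 2 * far_pairs kappa (2 - u * q n) @[n --> \oo] --> u `^ gam * pc.
Proof.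
move=> u0.
have uq : u * q n @[n --> \oo] --> 0^'+.
  move=> A /(uq_cvg0 u) H; change (\forall n \near \oo, A (u * q n)).
  have {}H : \forall n \near \oo, 0 < u * q n -> A (u * q n) by exact: H.
  near=> n; have : 0 < u * q n by rewrite mulr_gt0// q_gt0//; near: n; exists 1%N.
  by near: n; exact: H.
have K : u `^ gam * ((u * q n) `^ (- gam) * far_pairs kappa (2 - u * q n)) @[n --> \oo] --> u `^ gam * pc.
  by apply: cvgMr; exact: (cvg_comp _ _ uq pc_lim).
apply: cvg_trans K; apply: near_eq_cvg; near=> n.
have n0 : (0 < n)%N by near: n; exists 1%N.
have q0 := q_gt0 n0.
have ug : u `^ gam != 0 by rewrite gt_eqF// powR_gt0.
have E : q n `^ (- gam) = n%:R ^+ 2.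
  by rewrite /q -powRrM mulrNN divfK ?gt_eqF// powR_mulrn.
rewrite powRM ?(ltW u0) ?(ltW q0)// E !mulrA powRN mulfV// mul1r//.
Unshelve. all: by end_near. Qed.

(** The exponent of [n] is [1 - 2 ((d - 1) / 2 + al) / gam], which is
    negative. *)
Let tau_lim (K u : R) : 0 < u ->
  n%:R * (K * (u * q n) `^ ((d%:R - 1) / 2 + al)) @[n --> \oo] --> (0 : R).
Proof.
move=> u0; set b := (d%:R - 1) / 2 + al.
have b0 : 0 < (d%:R - 1) / 2 / gam.
  by rewrite divr_gt0// divr_gt0// subr_gt0 (ltr_nat R 1).
have L : (K * u `^ b) * n%:R `^ (- ((d%:R - 1) / 2 / gam)) @[n --> \oo] --> (K * u `^ b) * 0.
  by apply: cvgMr; exact: powN_cvg0.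
rewrite mulr0 in L; apply: cvg_trans L; apply: near_eq_cvg; near=> n.
have n0 : (0 < n)%N by near: n; exists 1%N.
have nR : 0 < n%:R :> R by rewrite ltr0n.
rewrite powRM ?(ltW u0) ?powR_ge0// /q -powRrM.
have -> : n%:R `^ (- ((d%:R - 1) / 2 / gam)) = n%:R * n%:R `^ (- (2 / gam) * b) :> R.
  rewrite -{2}(powRr1 (ltW nR)) -powRD ?(gt_eqF nR) ?implybT//; congr (_ `^ _).
  have gn : gam != 0 by rewrite gt_eqF.
  move: gn; rewrite /b /gamma_exp => gn; field.
  by apply: contra_neq gn => E; rewrite -[RHS](mul0r (2^-1)) -E; field.
by ring.
Unshelve. all: by end_near. Qed.

(** The limit law in the variable [m = t ^ gam], in which it is continuous
    at every point, 0 included. *)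
Let Phi (m : R) : R := 1 - expR (- (m * pc / 2)).

Let exp_lim {I : Type} (Fl : set_system I) {FF : Filter Fl} (x : I -> R) (l : R) :
  x i @[i --> Fl] --> l -> 1 - expR (- x i) @[i --> Fl] --> 1 - expR (- l).
Proof.
move=> xl; apply: cvgB; first exact: cvg_cst.
by apply: (cvg_comp _ _ (cvgN xl)); exact: continuous_expR.
Qed.

Let Phi_cvg (m0 : R) : Phi m @[m --> m0] --> Phi m0.
Proof.
apply: exp_lim; apply: cvgMl; apply: cvgMl; exact: cvg_id.
Qed.

Let f (t : R) (n : nat) : R := fine (P n (diam_event (Pi n) (2 - t * q n))).

Let root_gam (m : R) : 0 < m -> 0 < m `^ gam^-1 /\ (m `^ gam^-1) `^ gam = m.
Proof.
by move=> m0; rewrite powR_gt0// -powRrM mulVf ?gt_eqF// powRr1// ltW.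
Qed.

Let upper (t m e : R) : 0 <= t -> t `^ gam < m -> 0 < e -> \forall n \near \oo, f t n <= Phi m + e.
Proof.
move=> t0 tm e0; have m0 : 0 < m by apply: le_lt_trans tm; exact: powR_ge0.
have [u0 um] := root_gam m0; set u := m `^ gam^-1 in u0 um.
have tu : t < u.
  rewrite ltNge; apply/negP => ut; move: tm; rewrite ltNge -um.
  by rewrite ge0_ler_powR// ?nnegrE ltW.
have [K [e1 [K0 e10 far_e]]] := far_le.
have tl := tau_lim K u0.
have pl := pairs_lim u0; rewrite um in pl.
have bl : 1 - expR (- ((1 + n%:R * (K * (u * q n) `^ ((d%:R - 1) / 2 + al))) *
    (n%:R ^+ 2 * far_pairs kappa (2 - u * q n) / 2))) @[n --> \oo] --> Phi m.
  have -> : Phi m = 1 - expR (- ((1 + 0) * (m * pc / 2))) by rewrite addr0 mul1r.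
  apply: exp_lim; apply: cvgM; last by apply: cvgMl.
  by apply: cvgD => //; exact: cvg_cst.
near=> n.
have n0 : (0 < n)%N by near: n; exists 1%N.
have q0 := q_gt0 n0.
have b1 : u * q n < 1 by near: n; apply: (cvgr_lt _ (uq_cvg0 u)).
have b2 : u * q n <= e1 by near: n; apply: (cvgr_le _ (uq_cvg0 u)).
have b3 : n%:R * (K * (u * q n) `^ ((d%:R - 1) / 2 + al)) <= 3^-1.
  by near: n; apply: (cvgr_le _ tl); rewrite invr_gt0.
have b4 : 1 - expR (- ((1 + n%:R * (K * (u * q n) `^ ((d%:R - 1) / 2 + al))) *
    (n%:R ^+ 2 * far_pairs kappa (2 - u * q n) / 2))) <= Phi m + e.
  by near: n; apply: (cvgr_le _ bl); rewrite ltrDl.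
apply: le_trans b4; apply: (diam_upper (Pi_poisson n)) => //.
- lra.
- by rewrite ltrD2l ltrN2 ltr_pM2r.
- by rewrite mulr_ge0// mulr_ge0// powR_ge0.
- by move=> x Bx; rewrite ler_wpM2l//; apply: far_e => //; rewrite mulr_gt0.
Unshelve. all: by end_near. Qed.

Let lower (t m e : R) : 0 <= t -> 0 < m -> m < t `^ gam -> 0 < e -> \forall n \near \oo, Phi m - e <= f t n.
Proof.
move=> t0 m0 tm e0.
have [u0 um] := root_gam m0; set u := m `^ gam^-1 in u0 um.
have tu : u < t.
  rewrite ltNge; apply/negP => ut; move: tm; rewrite ltNge -um.
  by rewrite ge0_ler_powR// ?nnegrE// ltW.
have tp : 0 < t by exact: lt_trans tu.
have [K [e1 [K0 e10 far_e]]] := far_le.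
have tl := tau_lim K tp.
have pl := pairs_lim u0; rewrite um in pl.
have bl : 1 - expR (- ((1 - 3 * (n%:R * (K * (t * q n) `^ ((d%:R - 1) / 2 + al)))) *
    (n%:R ^+ 2 * far_pairs kappa (2 - u * q n) / 2))) @[n --> \oo] --> Phi m.
  have -> : Phi m = 1 - expR (- ((1 - 3 * 0) * (m * pc / 2))) by rewrite mulr0 subr0 mul1r.
  apply: exp_lim; apply: cvgM; last by apply: cvgMl.
  by apply: cvgB; [exact: cvg_cst|apply: cvgMr].
near=> n.
have n0 : (0 < n)%N by near: n; exists 1%N.
have q0 := q_gt0 n0.
have b1 : t * q n < 1 by near: n; apply: (cvgr_lt _ (uq_cvg0 t)).
have b2 : t * q n <= e1 by near: n; apply: (cvgr_le _ (uq_cvg0 t)).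
have b3 : n%:R * (K * (t * q n) `^ ((d%:R - 1) / 2 + al)) <= 3^-1.
  by near: n; apply: (cvgr_le _ tl); rewrite invr_gt0.
have b4 : Phi m - e <= 1 - expR (- ((1 - 3 * (n%:R * (K * (t * q n) `^ ((d%:R - 1) / 2 + al)))) *
    (n%:R ^+ 2 * far_pairs kappa (2 - u * q n) / 2))).
  by near: n; apply: (cvgr_ge _ bl); rewrite ltrBlDr ltrDl.
apply: (le_trans b4); apply: (diam_lower (Pi_poisson n)) => //.
- lra.
- by rewrite ltrD2l ltrN2 ltr_pM2r.
- by rewrite mulr_ge0// mulr_ge0// powR_ge0.
- by move=> x Bx; rewrite ler_wpM2l//; apply: far_e => //; rewrite mulr_gt0.
Unshelve. all: by end_near. Qed.

(** [diam_upper] and [diam_lower] compare the probability at [t] with the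
    limit law at points slightly above and below; continuity of the limit law
    concludes. *)
Lemma diam_law (t : R) : 0 <= t ->
  P n [set w | n%:R `^ (2 / gam) * (2 - diam (points (Pi n w))) <= t] @[n --> \oo] -->
  (1 - expR (- (1 / 2 * t `^ gam * pc)))%:E.
Proof.
move=> t0; have fE : \forall n \near \oo,
    P n [set w | n%:R `^ (2 / gam) * (2 - diam (points (Pi n w))) <= t] = (f t n)%:E.
  near=> n.
  have n0 : (0 < n)%N by near: n; exists 1%N.
  have q0 := q_gt0 n0.
  have b1 : t * q n < 1 by near: n; apply: (cvgr_lt _ (uq_cvg0 t)).
  have -> : [set w | n%:R `^ (2 / gam) * (2 - diam (points (Pi n w))) <= t] =
      diam_event (Pi n) (2 - t * q n).
    apply/seteqP; split => w; rewrite /diam_event/= /q powRN -ler_pdivlMl ?powR_gt0 ?ltr0n// mulrC; lra.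
  rewrite /f fineK// fin_num_measure//.
  apply: (measurable_diam_event (Pi_poisson n)); lra.
have fl : f t n @[n --> \oo] --> Phi (t `^ gam).
  apply/cvgrPdist_le => e e0.
  have e2 : 0 < e / 2 by rewrite divr_gt0.
  have U : \forall n \near \oo, f t n <= Phi (t `^ gam) + e.
    near (t `^ gam)^'+ => m.
    have mt : t `^ gam < m by [].
    have Pm : Phi m <= Phi (t `^ gam) + e / 2.
      by near: m; apply: (cvgr_le _ (cvg_at_right_filter (@Phi_cvg (t `^ gam)))); rewrite ltrDl.
    near=> n; have : f t n <= Phi m + e / 2 by near: n; exact: upper.
    by rewrite (splitr e); lra.
  have L : \forall n \near \oo, Phi (t `^ gam) - e <= f t n.
    have [tz|tp] := eqVneq t 0.
      near=> n; rewrite tz powR0 ?gt_eqF// /Phi mul0r mul0r oppr0 expR0 subrr sub0r.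
      apply: (@le_trans _ _ 0); first by rewrite oppr_le0 ltW.
      by rewrite /f fine_ge0.
    have tg : 0 < t `^ gam by rewrite powR_gt0// lt_neqAle eq_sym tp.
    near (t `^ gam)^'- => m.
    have mt : m < t `^ gam by [].
    have m0 : 0 < m by near: m; exact: nbhs_left_gt.
    have Pm : Phi (t `^ gam) - e / 2 <= Phi m.
      by near: m; apply: (cvgr_ge _ (cvg_at_left_filter (@Phi_cvg (t `^ gam)))); rewrite ltrBlDr ltrDl.
    near=> n; have : Phi m - e / 2 <= f t n by near: n; exact: lower.
    by rewrite (splitr e); lra.
  near=> n; rewrite ler_norml.
  have h1 : f t n <= Phi (t `^ gam) + e by near: n.
  have h2 : Phi (t `^ gam) - e <= f t n by near: n.
  by apply/andP; split; lra.
have -> : (1 - expR (- (1 / 2 * t `^ gam * pc)))%:E = (Phi (t `^ gam))%:E.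
  by rewrite /Phi; congr (1 - expR (- _))%:E; field.
apply/fine_cvgP; split.
  by near=> n; have -> : P n [set w | n%:R `^ (2 / gam) * (2 - diam (points (Pi n w))) <= t] = (f t n)%:E by near: n.
apply: cvg_trans fl; apply: near_eq_cvg; near=> n; rewrite /=.
by have -> : P n [set w | n%:R `^ (2 / gam) * (2 - diam (points (Pi n w))) <= t] = (f t n)%:E by near: n.
Unshelve. all: by end_near. Qed.
End limit_law.

Unset Implicit Arguments.
Theorem theorem4p2 (R : realType) (d : nat) (hd : (2 <= d)%N)
  (kappa : probability (borel_space R d) R)
  (kappa_ball : kappa (@unit_ball R d) = 1%E)
  (kappa_sym : spherically_symmetric kappa)
  (* xi_1 ~ kappa, and eta = 1 - |xi_1| *)
  (d0 : measure_display) (Omega0 : measurableType d0)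
  (P0 : probability Omega0 R)
  (xi : {RV P0 >-> borel_space R d})
  (xi_law : forall A : set (borel_space R d), measurable A ->
     distribution P0 xi A = kappa A)
  (eta : {RV P0 >-> R})
  (etaE : forall w, eta w = 1 - enorm (xi w))
  (alpha a : R) (alpha_ge0 : 0 <= alpha) (a_gt0 : 0 < a)
  (F_lim : s `^ (- alpha) * fine (cdf eta s) @[s --> 0^'+] --> a)
  (* Pi n is a Poisson process with intensity n * kappa *)
  (dO : nat -> measure_display)
  (Omega : forall n, measurableType (dO n))
  (P : forall n, probability (Omega n) R)
  (Pi : forall n, R.-ker (Omega n) ~> borel_space R d)
  (Pi_poisson : forall n, poisson_process (P n) (@unit_ball R d)
     (mscale (n%:R%:nng : {nonneg R}) kappa) (Pi n))
  (t : R) (t_ge0 : 0 <= t) :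
  P n [set w | n%:R `^ (2 / gamma_exp d alpha) *
                 (2 - diam (points (Pi n w))) <= t] @[n --> \oo] -->
  (1 - expR (- (1 / 2 * t `^ gamma_exp d alpha *
                sigma0 d alpha a (fine (cdf eta 0)))))%:E.
Proof.
pose i0 := Ordinal (ltnW hd); pose i1 := Ordinal hd.
have i01 : i0 != i1 by [].
have tail := radial_tail_lim kappa_ball xi_law etaE F_lim.
rewrite -(pair_cst_sigma0 alpha_ge0 a_gt0 F_lim hd).
apply: diam_law => //.
- exact: (far_pairs_lim kappa_sym i01 alpha_ge0 tail hd).
- exact: (far_bound kappa_sym i01 alpha_ge0 tail hd).
Qed.
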